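(* Let $n\ge 2$, $1<p<+\infty$, let $\Omega\subset\mathbb{R}^n$ be a $C^1$ domain (bounded or unbounded), let $f\in C^1(\mathbb{R})$ and let $\kappa> 0$ be a constant (i.e. $\kappa\ge 0$ and $\kappa\neq 0$). Let $u$ be a bounded $C^3$ solution of \[ \begin{cases} \mathrm{div}\left(|\nabla u|^{p-2}\nabla u\right)+f(u)=0 & \text{in } \Omega,\\ u>0 & \text{in } \Omega,\\ u=0 & \text{on } \partial\Omega,\\ \partial_\nu u=-\kappa & \text{on } \partial\Omega, \end{cases} \] where $\nu$ is the exterior unit normal to $\partial\Omega$. Suppose there exists a primitive $F\in C^2(\mathbb{R})$ of $f$ (i.e. $F'=f$) with $F\le 0$ on $\mathbb{R}$ and \[ F(0)\ge -\frac{p-1}{p}\kappa^p . \] If $p>2$, assume in addition that for every $u_0\in\mathbb{R}$ with $F(u_0)=0$ one has $F(s)=O(|s-u_0|^p)$ as $s\to u_0$. Then either $\Omega$ is a half-space and $u$ is parallel, or $H(q)<0$ for every $q\in\partial\Omega$, where $H(q)$ denotes the mean curvature of $\partial\Omega$ at $q$.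
   Context: A solution $u$ is called parallel (one-dimensional) if there exist $x_0,a\in\mathbb{R}^n$ and a function $g:[0,+\infty)\to\mathbb{R}$ such that $\Omega=\{x\in\mathbb{R}^n: a\cdot(x-x_0)>0\}$ and $u(x)=g(a\cdot(x-x_0))$ for all $x$ in this half-space. The mean curvature $H$ of $\partial\Omega$ is taken with the sign convention for which, with $\nu$ the exterior unit normal, $\partial^2_{\nu\nu}u=\Delta u-(n-1)H\,\partial_\nu u$ on $\partial\Omega$ for functions vanishing on $\partial\Omega$ (so that the boundary sphere of a ball has positive mean curvature). *)

(* Defs.v *)
From HB Require Import structures.
From mathcomp Require Import all_boot all_order all_algebra.
From mathcomp Require Import all_classical all_reals all_analysis.
Set Implicit Arguments. Unset Strict Implicit. Unset Printing Implicit Defensive.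
Import Order.TTheory GRing.Theory Num.Theory.
Import numFieldNormedType.Exports.
Local Open Scope classical_set_scope.
Local Open Scope ring_scope.

Section Defs.
Variables (R : realType) (n : nat).
Local Notation V := 'rV[R]_n.

Definition evec (i : 'I_n) : V := delta_mx 0 i.

Definition dotv (a b : V) : R := (a *m b^T) 0 0.
Definition enorm (a : V) : R := Num.sqrt (dotv a a).

Definition partial (i : 'I_n) (f : V -> R) (x : V) : R := 'D_(evec i) f x.
Definition grad (f : V -> R) (x : V) : V := \row_i partial i f x.
Definition divergence (W : V -> V) (x : V) : R :=
  \sum_(i < n) partial i (fun y => W y 0 i) x.

Fixpoint Ck (k : nat) (U : set V) (f : V -> R) : Prop :=
  match k with
  | 0%N => forall x, U x -> {for x, continuous f}
  | k'.+1 => (forall x, U x -> {for x, continuous f}) /\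
             forall i, (forall x, U x -> derivable f x (evec i)) /\
                       Ck k' U (partial i f)
  end.

Definition bd (A : set V) : set V := closure A `\` interior A.

Definition local_defining (Om : set V) (q : V) (r : R) (rho : V -> R) : Prop :=
  0 < r /\ Ck 1 (ball q r) rho /\ (forall x, ball q r x -> grad rho x != 0) /\
  Om `&` ball q r = [set x | ball q r x /\ rho x < 0].

Definition C1_domain (Om : set V) : Prop :=
  Om !=set0 /\ open Om /\ connected Om /\
  forall q, bd Om q -> exists r rho, local_defining Om q r rho.

Definition ext_normal (Om : set V) (q nu : V) : Prop :=
  exists r rho, local_defining Om q r rho /\
    nu = (enorm (grad rho q))^-1 *: grad rho q.

(* h is the mean curvature of bd Om at q: (1/(n-1)) times the divergence at q
   of any C^1 unit vector field extending the exterior unit normal near q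
   (sign convention: spheres bounding balls have positive mean curvature) *)
Definition mean_curvature (Om : set V) (q : V) (h : R) : Prop :=
  exists r (N : V -> V), 0 < r /\
    (forall j, Ck 1 (ball q r) (fun x => N x 0 j)) /\
    (forall x, ball q r x -> enorm (N x) = 1) /\
    (forall x, ball q r x -> bd Om x -> ext_normal Om x (N x)) /\
    h = divergence N q / (n.-1)%:R.

Definition plap_field (p : R) (u : V -> R) (x : V) : V :=
  (enorm (grad u x) `^ (p - 2)) *: grad u x.

Definition halfspace_parallel (Om : set V) (u : V -> R) : Prop :=
  exists (x0 a : V) (g : R -> R), a != 0 /\
    Om = [set x | 0 < dotv a (x - x0)] /\
    forall x, Om x -> u x = g (dotv a (x - x0)).

End Defs.
Arguments evec {R n}.

(* Main.v *)
(* Let P = (p-1)/p |grad u|^p + F(u), which on the boundary takes the constant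
   value P0 = (p-1)/p kappa^p + F(0) >= 0.  Where grad u <> 0, P is a
   subsolution of a linear elliptic equation whose defect is a sum of squares
   measuring how far the Hessian of u is from a multiple of grad u (x) grad u.

   P <= P0 holds without any uniform regularity: if P(x0) > P0, a maximum point
   of P * exp(eps * exp(lam * u)) * (1 - |x - x0|^2 / rho^2)^k is interior, the
   gradient there is bounded below because F <= 0, and the second order
   conditions at that point fail for rho large.

   If P < P0 in Om, Hopf's lemma on an interior tangent ball gives an outward
   derivative of P which is positive, and by the equation it equals a negative
   multiple of the mean curvature.  Otherwise the strong maximum principle
   (together with a Gronwall argument ruling out critical points where P = P0)
   makes P constant; then the Hessian of u has rank one, grad u keeps a fixed
   direction a, and Om is stable under translation by every v with a.v >= 0,
   so it is a half-space. *)

Require Import Defs.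
From HB Require Import structures.
From mathcomp Require Import all_boot all_order all_algebra.
From mathcomp Require Import all_classical all_reals all_analysis.
From mathcomp Require Import ring lra.
Import Order.TTheory GRing.Theory Num.Theory.
Import numFieldNormedType.Exports.
Set Implicit Arguments. Unset Strict Implicit. Unset Printing Implicit Defensive.
Local Open Scope classical_set_scope.
Local Open Scope ring_scope.

(** * Directional derivatives and second order jets *)

(** A merely C^1 domain need not admit interior tangent balls. Here the ball comes from [u], which
    is C^3 on a neighbourhood [U] of the closure of [Om] and has a gradient of length kappa on the
    boundary: a second order Taylor bound makes [u] positive on a small ball touching the boundary,
    while [u = 0] at boundary points. The same extension lets P be differentiated at boundary
    points. On an unbounded [Om] the supremum of P need not be attained and P is not known to be
    bounded beforehand, hence the cutoff. The gain produced by the factor exp(eps exp(lam u)) does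
    not depend on the cutoff radius rho, whereas the cutoff errors are O(1 / rho^2). The sign of P0
    matters because P = F(u) <= 0 at critical points: a value above P0 >= 0 is taken only where the
    equation for P is nondegenerate. A critical point with P = P0 forces P0 = 0, and the growth
    condition on F then turns P <= 0 into |grad u| <= D |u - u0|, the input of the Gronwall
    argument. For p <= 2 this growth follows from F being C^2 with maximum value 0. *)

Lemma near0_normM_lt (R : realType) (C r : R) : 0 <= C -> 0 < r ->
  \forall h \near (0 : R), `|h| * C < r.
Proof.
move=> C0 r0; apply/nbhs_ballP; exists (r / (C + 1)) => /=.
  by rewrite divr_gt0// ltr_wpDl.
move=> h; rewrite -ball_normE /ball_ /= sub0r normrN => hr.
have C1 : 0 < C + 1 by rewrite ltr_wpDl.
rewrite ltr_pdivlMr// in hr; apply: le_lt_trans hr.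
by apply: ler_wpM2l => //; rewrite lerDl.
Qed.

Section DirectionalDerivatives.
Variables (R : realType) (V : normedModType R).
Implicit Types (f g : V -> R) (x v w : V).

Lemma is_derive_cvg f x v d :
  is_derive x v f d <-> h^-1 * (f (h *: v + x) - f x) @[h --> 0^'] --> d.
Proof.
split=> [[fd <-]|cd]; first exact: fd.
split; first by apply/cvg_ex; exists d.
exact: cvg_lim.
Qed.

(** Restriction to a line makes the one-variable chain rule and mean value theorem available for
    directional derivatives. *)
Lemma is_derive_line f x v d :
  is_derive x v f d <-> is_derive (0 : R) 1 (fun h : R => f (h *: v + x)) d.
Proof.
rewrite is_derive_cvg; set l := fun h : R => f (h *: v + x).
have e : (fun h : R => h^-1 *: ((l \o shift 0) (h *: 1) - l 0)) =
    (fun h => h^-1 * (f (h *: v + x) - f x)).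
  by apply/funext => h; rewrite /l /= [_%:A]mulr1 addr0 scale0r add0r.
split => [cd|[cd <-]].
  by split; rewrite ?/derivable ?/derive e; [apply/cvg_ex; exists d|exact: cvg_lim].
by move: cd; rewrite /derivable /derive e.
Qed.

Lemma is_derive_line_at f x v (t d : R) :
  is_derive (x + t *: v) v f d ->
  is_derive t 1 (fun h : R => f (x + h *: v)) d.
Proof.
move=> /is_derive_line df.
have -> : (fun h : R => f (x + h *: v)) =
  (fun h : R => f (h *: v + (x + t *: v))) \o (shift (- t)).
  apply/funext => h /=; congr f.
  by rewrite scalerDl scaleNr addrCA addrC addrNK addrC.
rewrite -[d]mulr1; apply: is_derive1_comp; last exact: is_derive_shift.
by rewrite /= subrr.
Qed.

Lemma is_deriveZdir f x v (c d : R) :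
  is_derive x v f d -> is_derive x (c *: v) f (c * d).
Proof.
move=> /is_derive_line df; apply/is_derive_line.
have -> : (fun h : R => f (h *: (c *: v) + x)) =
  (fun h : R => f (h *: v + x)) \o ( *%R c).
  by apply/funext => h /=; rewrite scalerA mulrC.
rewrite mulrC; apply: is_derive1_comp; first by rewrite mulr0.
have -> : *%R c = c *: (@id R) :> (R -> R) by apply/funext.
by rewrite -[X in is_derive _ _ _ X]mulr1; exact: is_deriveZ.
Qed.

Lemma is_derive_comp1 (h : R -> R) f x v (dh df : R) :
  is_derive (f x) 1 h dh -> is_derive x v f df ->
  is_derive x v (h \o f) (dh * df).
Proof.
move=> hd /is_derive_line fd; apply/is_derive_line.
have -> : (fun t : R => (h \o f) (t *: v + x)) = h \o (fun t : R => f (t *: v + x)).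
  by [].
by apply: is_derive1_comp; rewrite // scale0r add0r.
Qed.

Lemma is_derive_mul f g x v (a b : R) : is_derive x v f a -> is_derive x v g b ->
  is_derive x v (fun y => f y * g y) (a * g x + f x * b).
Proof.
move=> df dg; have := is_deriveM df dg.
by rewrite /GRing.scale/= addrC (mulrC (g x)).
Qed.

Lemma is_derive_add f g x v (a b : R) : is_derive x v f a -> is_derive x v g b ->
  is_derive x v (fun y => f y + g y) (a + b).
Proof. exact: is_deriveD. Qed.

Lemma is_derive_scale f x v (c a : R) : is_derive x v f a ->
  is_derive x v (fun y => c * f y) (c * a).
Proof. exact: is_deriveZ. Qed.

Lemma is_derive_bigsum (I : Type) (r : seq I) (f : I -> V -> R) x v (d : I -> R) :
  (forall i, is_derive x v (f i) (d i)) ->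
  is_derive x v (fun y => \sum_(i <- r) f i y) (\sum_(i <- r) d i).
Proof.
move=> df; elim: r => [|i r IH].
  rewrite big_nil (_ : (fun y => _) = cst 0); first exact: is_derive_cst.
  by apply/funext => y; rewrite big_nil.
rewrite big_cons (_ : (fun y => _) = (fun y => f i y + \sum_(i <- r) f i y)).
  exact: is_derive_add.
by apply/funext => y; rewrite big_cons.
Qed.

Lemma mean_value_line f (f' : V -> R) x v :
  (forall t : R, 0 <= t <= 1 -> is_derive (x + t *: v) v f (f' (x + t *: v))) ->
  exists2 t : R, 0 < t < 1 & f (x + v) - f x = f' (x + t *: v).
Proof.
move=> df.
have dl (t : R) : 0 <= t <= 1 ->
    is_derive t 1 (fun h : R => f (x + h *: v)) (f' (x + t *: v)).
  by move=> t01; apply: is_derive_line_at; exact: df.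
have [||t t01 e] := @MVT _ (fun h : R => f (x + h *: v))
  (fun t => f' (x + t *: v)) 0 1 ltr01.
- by move=> t; rewrite in_itv/= => /andP[t0 t1]; apply: dl; rewrite !ltW.
- apply: derivable_within_continuous => t; rewrite in_itv/= => t01.
  by have [] := dl _ t01.
exists t; first by move: t01; rewrite in_itv.
by move: e; rewrite subr0 mulr1 scale1r scale0r addr0.
Qed.

(** Directional derivatives are not additive in the direction in general. The increment along v + w
    is split into a leg along v from x and a leg along w from x + h v; the mean value theorem turns
    the second leg into a value of [dw] near x, and continuity of [dw] at x concludes. *)
Lemma is_deriveDdir f (dw : V -> R) x v w (dv : R) :
  is_derive x v f dv -> (\forall y \near x, is_derive y w f (dw y)) ->
  {for x, continuous dw} -> is_derive x (v + w) f (dv + dw x).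
Proof.
move=> /is_derive_cvg cv nw cw; apply/is_derive_cvg.
suff cw' : h^-1 * (f (h *: v + x + h *: w) - f (h *: v + x)) @[h --> 0^']
    --> dw x.
  rewrite [X in X @ _ --> _](_ : _ = (fun h => h^-1 * (f (h *: v + x) - f x) +
      h^-1 * (f (h *: v + x + h *: w) - f (h *: v + x)))); last first.
    apply/funext => h; rewrite -mulrDr; congr (_ * _); rewrite scalerDr addrAC.
    by rewrite [RHS]addrC addrA subrK.
  exact: cvgD.
apply/cvgrPdist_lt => e e0.
have : \forall y \near x, is_derive y w f (dw y) /\ `|dw x - dw y| < e.
  by apply: filterI => //; move/cvgrPdist_lt : cw; apply.
move=> /nbhs_ballP[r /= r0 rP].
have nh : \forall h \near (0 : R), `|h| * (`|v| + `|w|) < r.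
  by apply: near0_normM_lt => //; rewrite addr_ge0.
rewrite near_withinE; move: nh; apply: filterS => h hr h0.
have inb t : 0 <= t <= 1 -> ball x r (h *: v + x + t *: (h *: w)).
  move=> /andP[t0 t1]; rewrite -ball_normE /ball_ /=.
  rewrite (addrC (h *: v)) opprD opprD addrA addrA subrr add0r -opprD normrN.
  apply: le_lt_trans hr; rewrite mulrDr.
  apply: (le_trans (ler_normD _ _)); apply: lerD; first by rewrite normrZ.
  rewrite normrZ ger0_norm// -normrZ; apply: ler_piMl => //.
have [t /andP[t0 t1] ->] := @mean_value_line f (fun y => h * dw y)
    (h *: v + x) (h *: w) (fun t t01 => is_deriveZdir _ (rP _ (inb t t01)).1).
rewrite mulrA mulVf// mul1r.
by apply: (rP _ (inb t _)).2; rewrite !ltW.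
Qed.

End DirectionalDerivatives.

(** * Euclidean geometry of row vectors, quadratic forms, and the elliptic trace [ptr] *)

Section DotProduct.
Variables (R : realType) (n : nat).
Local Notation V := 'rV[R]_n.
Implicit Types (a b c v w g : V) (M N : 'M[R]_n) (k p : R).

Lemma dotvE a b : dotv a b = \sum_i a 0 i * b 0 i.
Proof. by rewrite /dotv mxE; apply: eq_bigr => i _; rewrite mxE. Qed.

Lemma dotvC a b : dotv a b = dotv b a.
Proof. by rewrite !dotvE; apply: eq_bigr => i _; rewrite mulrC. Qed.

Lemma dotvDl a b c : dotv (a + b) c = dotv a c + dotv b c.
Proof. by rewrite /dotv mulmxDl mxE. Qed.

Lemma dotvDr a b c : dotv a (b + c) = dotv a b + dotv a c.
Proof. by rewrite dotvC dotvDl !(dotvC a). Qed.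

Lemma dotvZl k a b : dotv (k *: a) b = k * dotv a b.
Proof. by rewrite /dotv -scalemxAl mxE. Qed.

Lemma dotvZr k a b : dotv a (k *: b) = k * dotv a b.
Proof. by rewrite dotvC dotvZl dotvC. Qed.

Lemma dotvNl a b : dotv (- a) b = - dotv a b.
Proof. by rewrite -scaleN1r dotvZl mulN1r. Qed.

Lemma dotvNr a b : dotv a (- b) = - dotv a b.
Proof. by rewrite dotvC dotvNl dotvC. Qed.

Lemma dotv0l a : dotv 0 a = 0.
Proof. by rewrite -(scale0r (0 : V)) dotvZl mul0r. Qed.

Lemma dotv0r a : dotv a 0 = 0.
Proof. by rewrite dotvC dotv0l. Qed.

Definition dotv_lin := (dotvDl, dotvDr, dotvZl, dotvZr, dotvNl, dotvNr, dotv0l, dotv0r).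

Lemma dotv_suml (I : Type) (r : seq I) (P : pred I) (F : I -> V) b :
  dotv (\sum_(i <- r | P i) F i) b = \sum_(i <- r | P i) dotv (F i) b.
Proof. by elim/big_ind2 : _ => [|x1 y1 x2 y2 <- <-|//]; rewrite ?dotv0l ?dotvDl. Qed.

Lemma dotv_ge0 a : 0 <= dotv a a.
Proof. by rewrite dotvE sumr_ge0// => i _; rewrite -expr2 sqr_ge0. Qed.

Lemma dotv_eq0 a : (dotv a a == 0) = (a == 0).
Proof.
apply/idP/idP => [|/eqP->]; last by rewrite dotv0l.
rewrite dotvE psumr_eq0; last by move=> i _; rewrite -expr2 sqr_ge0.
move=> /allP a0; apply/eqP/rowP => i; rewrite mxE.
by have := a0 i; rewrite mem_index_enum mulf_eq0 orbb => /(_ isT)/eqP.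
Qed.

Lemma dotv_gt0 a : (0 < dotv a a) = (a != 0).
Proof. by rewrite lt0r dotv_ge0 andbT dotv_eq0. Qed.

Lemma dotv_eq0P a : (forall v, dotv a v = 0) -> a = 0.
Proof. by move=> a0; apply/eqP; rewrite -dotv_eq0 a0. Qed.

Lemma dotv_evec a i : dotv a (evec i) = a 0 i.
Proof.
rewrite dotvE (bigD1 i)//= big1 ?addr0; first by rewrite mxE !eqxx mulr1.
by move=> j ji; rewrite mxE (negbTE ji) andbF mulr0.
Qed.

Lemma row_sum_evec a : a = \sum_i a 0 i *: evec i.
Proof. exact: row_sum_delta. Qed.

Lemma dotv_cs a b : dotv a b ^+ 2 <= dotv a a * dotv b b.
Proof.
have [->|b0] := eqVneq b 0; first by rewrite !dotv0r expr0n/= mulr0.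
have bb : 0 < dotv b b by rewrite dotv_gt0.
have := dotv_ge0 (dotv b b *: a - dotv a b *: b).
rewrite !dotv_lin (dotvC b a).
rewrite (_ : _ + _ = dotv b b * (dotv a a * dotv b b - dotv a b ^+ 2)); last by ring.
by rewrite pmulr_rge0// subr_ge0.
Qed.

Lemma enorm_sqr a : enorm a ^+ 2 = dotv a a.
Proof. by rewrite sqr_sqrtr// dotv_ge0. Qed.

Lemma enorm_ge0 a : 0 <= enorm a.
Proof. exact: sqrtr_ge0. Qed.

Lemma dotv_le_enorm a b : `|dotv a b| <= enorm a * enorm b.
Proof.
rewrite -ler_sqr ?nnegrE ?mulr_ge0 ?enorm_ge0//.
by rewrite exprMn !enorm_sqr real_normK ?num_real// dotv_cs.
Qed.

Lemma normr_coord a i : `|a 0 i| <= `|a|.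
Proof.
have /mapP[j Hj ->] : `|a 0 i| \in [seq `|a x.1 x.2| | x : 'I_1 * 'I_n].
  by apply/mapP; exists (0, i) => //=; rewrite mem_enum.
by rewrite [leRHS]/Num.norm /= mx_normrE; apply/bigmax_geP; right => /=; exists j.
Qed.

Lemma norm_le_coord a k : 0 <= k -> (forall i, `|a 0 i| <= k) -> `|a| <= k.
Proof.
move=> k0 ak; rewrite [leLHS]/Num.norm /= mx_normrE; apply/bigmax_leP; split => //.
by move=> [i j] _ /=; rewrite ord1.
Qed.

(** The norm of ['rV[R]_n], which defines the balls of the topology, is the sup norm, whereas the
    geometry uses the Euclidean length; this comparison and [dotv_le_norm] pass from one to the
    other. *)
Lemma norm_le_enorm a : `|a| <= enorm a.
Proof.
apply: norm_le_coord => [|i]; first exact: enorm_ge0.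
rewrite -ler_sqr ?nnegrE ?enorm_ge0// enorm_sqr real_normK ?num_real//.
rewrite dotvE (bigD1 i)//= -expr2 lerDl sumr_ge0// => j _.
by rewrite -expr2 sqr_ge0.
Qed.

Lemma dotv_le_norm a b : `|dotv a b| <= n%:R * `|a| * `|b|.
Proof.
rewrite dotvE; apply: le_trans (ler_norm_sum _ _ _) _.
rewrite -mulrA -[X in X%:R]card_ord mulr_natl -sumr_const.
by apply: ler_sum => i _; rewrite normrM ler_pM ?normr_coord.
Qed.

Definition bil v M w : R := dotv (v *m M) w.

Lemma bilE v M w : bil v M w = \sum_j \sum_i v 0 i * M i j * w 0 j.
Proof. by rewrite /bil dotvE; apply: eq_bigr => j _; rewrite mxE mulr_suml. Qed.

Lemma bilDl a b M w : bil (a + b) M w = bil a M w + bil b M w.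
Proof. by rewrite /bil mulmxDl dotvDl. Qed.
Lemma bilDr a M v w : bil a M (v + w) = bil a M v + bil a M w.
Proof. exact: dotvDr. Qed.
Lemma bilZl k a M w : bil (k *: a) M w = k * bil a M w.
Proof. by rewrite /bil -scalemxAl dotvZl. Qed.
Lemma bilZr k a M w : bil a M (k *: w) = k * bil a M w.
Proof. exact: dotvZr. Qed.
Lemma bilNl a M w : bil (- a) M w = - bil a M w.
Proof. by rewrite /bil mulNmx dotvNl. Qed.
Lemma bilNr a M w : bil a M (- w) = - bil a M w.
Proof. exact: dotvNr. Qed.
Lemma bilDm a M N w : bil a (M + N) w = bil a M w + bil a N w.
Proof. by rewrite /bil mulmxDr dotvDl. Qed.
Lemma bilZm a k M w : bil a (k *: M) w = k * bil a M w.
Proof. by rewrite /bil -scalemxAr dotvZl. Qed.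
Lemma bil0m a w : bil a 0 w = 0.
Proof. by rewrite /bil mulmx0 dotv0l. Qed.
Lemma bil_scalar a k w : bil a k%:M w = k * dotv a w.
Proof. by rewrite /bil mul_mx_scalar dotvZl. Qed.

Lemma bil_evec M i j : bil (evec i) M (evec j) = M i j.
Proof. by rewrite /bil dotv_evec -rowE mxE. Qed.

Lemma bil_rank1 a v w b : bil a (v^T *m w) b = dotv a v * dotv w b.
Proof.
by rewrite /bil mulmxA [a *m _]mx11_scalar mul_scalar_mx dotvZl.
Qed.

Lemma tr_rank1 v w : \tr (v^T *m w) = dotv v w.
Proof.
by rewrite /mxtrace dotvE; apply: eq_bigr => i _; rewrite mxE big_ord1 !mxE.
Qed.

(* The trace of M against the coefficient matrix I + (p - 2) g g^T / |g|^2 of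
   the normalised p-Laplacian. *)
Definition ptr p g M : R := \tr M + (p - 2) * bil g M g / dotv g g.

Lemma ptrD p g M N : ptr p g (M + N) = ptr p g M + ptr p g N.
Proof. by rewrite /ptr mxtraceD bilDm; ring. Qed.
Lemma ptrZ p g k M : ptr p g (k *: M) = k * ptr p g M.
Proof. by rewrite /ptr mxtraceZ bilZm; ring. Qed.
Lemma ptr_rank1 p g v :
  ptr p g (v^T *m v) = dotv v v + (p - 2) * dotv g v ^+ 2 / dotv g g.
Proof. by rewrite /ptr tr_rank1 bil_rank1 (dotvC v g) expr2. Qed.
Lemma ptr_scalar p g k : g != 0 -> ptr p g k%:M = k * (n%:R + p - 2).
Proof.
move=> g0; rewrite /ptr mxtrace_scalar bil_scalar -mulr_natr.
have ? : dotv g g != 0 by rewrite dotv_eq0.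
by field.
Qed.

(* Summing over the orthogonal projections of the standard basis onto the
   complement of g isolates tr M - bil g M g / |g|^2. *)
Lemma ptr_le0 p g M : 1 < p -> g != 0 -> (forall v, bil v M v <= 0) -> ptr p g M <= 0.
Proof.
move=> p1 g0 Mneg.
have s0 : 0 < dotv g g by rewrite dotv_gt0.
have sN0 : dotv g g != 0 by rewrite gt_eqF.
have proj : \tr M - bil g M g / dotv g g <= 0.
  have -> : \tr M - bil g M g / dotv g g =
      \sum_i bil (evec i - (g 0 i / dotv g g) *: g) M (evec i - (g 0 i / dotv g g) *: g).
    under eq_bigr => i _ do
      rewrite !(bilDl, bilDr, bilNl, bilNr, bilZl, bilZr, bil_evec).
    pose c i := M i i - (dotv g g)^-1 * bil (g 0 i *: evec i) M g
      - (dotv g g)^-1 * bil g M (g 0 i *: evec i)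
      + (dotv g g)^-2 * bil g M g * (g 0 i * g 0 i).
    rewrite (eq_bigr c); last by move=> i _; rewrite /c bilZl bilZr; field.
    rewrite /c !big_split/= !sumrN -!mulr_sumr -dotvE.
    rewrite -(dotv_suml _ _ (fun i => (g 0 i *: evec i) *m M)) -mulmx_suml.
    have -> : \sum_i bil g M (g 0 i *: evec i) = bil g M g.
      rewrite [X in _ = bil g M X](row_sum_evec g) /bil dotvC dotv_suml.
      by apply: eq_bigr => i _; rewrite dotvC.
    by rewrite -row_sum_evec -/(bil g M g) -/(mxtrace M); field.
  by apply: sumr_le0 => i _; exact: Mneg.
rewrite /ptr (_ : _ + _ = (\tr M - bil g M g / dotv g g)
  + (p - 1) * (bil g M g / dotv g g)); last by field.
rewrite -[leRHS]addr0 lerD// mulr_ge0_le0 ?subr_ge0 ?(ltW p1)//.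
by rewrite mulr_le0_ge0// ?invr_ge0 ?ltW.
Qed.

(** The coefficient matrix I + (p - 2) g g^T / |g|^2 has eigenvalues 1 and p - 1, both below p. *)
Lemma ptr_rank1_le p g v : 1 < p -> g != 0 -> ptr p g (v^T *m v) <= p * dotv v v.
Proof.
move=> p1 g0; rewrite ptr_rank1.
have s0 : 0 < dotv g g by rewrite dotv_gt0.
have : dotv g v ^+ 2 / dotv g g <= dotv v v.
  by rewrite ler_pdivrMr// mulrC dotv_cs.
have : 0 <= dotv g v ^+ 2 / dotv g g by rewrite divr_ge0 ?sqr_ge0 ?ltW.
rewrite -mulrA; set t := _ / _ => t0 tv; nra.
Qed.

(** The smaller eigenvalue is the ellipticity constant; it makes the barrier of [hopf] a strict
    subsolution. *)
Lemma ptr_rank1_ge p g v : 1 < p -> g != 0 ->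
  Num.min 1 (p - 1) * dotv v v <= ptr p g (v^T *m v).
Proof.
move=> p1 g0; rewrite ptr_rank1.
have s0 : 0 < dotv g g by rewrite dotv_gt0.
have : dotv g v ^+ 2 / dotv g g <= dotv v v.
  by rewrite ler_pdivrMr// mulrC dotv_cs.
have : 0 <= dotv g v ^+ 2 / dotv g g by rewrite divr_ge0 ?sqr_ge0 ?ltW.
rewrite -mulrA; set t := _ / _ => t0 tv.
case: (leP 1 (p - 1)) => hp; nra.
Qed.

End DotProduct.

(** * C^k functions, symmetry of second derivatives, and second order jets *)

Section Jets.
Variables (R : realType) (n : nat).
Local Notation V := 'rV[R]_n.
Implicit Types (f : V -> R) (x v w G : V) (M : 'M[R]_n).

Lemma Ck_continuous k (U : set V) f x : Ck k U f -> U x -> {for x, continuous f}.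
Proof. by case: k => [|k] /= => [cf Ux|[cf _] Ux]; exact: cf. Qed.

Lemma CkW k (U : set V) f : Ck k.+1 U f -> Ck k U f.
Proof.
elim: k f => [|k IH] f; first by case.
move=> [cf df]; split => // i; have [dfi Ci] := df i.
by split => //; exact: IH.
Qed.

Lemma Ck_partial k (U : set V) f i : Ck k.+1 U f -> Ck k U (partial i f).
Proof. by case=> _ /(_ i)[]. Qed.

(** The coordinate directions are added one at a time by [is_deriveDdir], each with a continuous
    partial derivative. *)
Lemma Ck1_is_derive (U : set V) f x v : open U -> Ck 1 U f -> U x ->
  is_derive x v f (dotv (grad f x) v).
Proof.
move=> oU [cf df].
rewrite [X in is_derive _ X](row_sum_evec v) dotvE.
under [X in is_derive _ _ _ X]eq_bigr => i _ do rewrite mxE.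
elim: (index_enum _) x => [|i r IH] x Ux.
  by rewrite !big_nil; exact: is_derive0.
rewrite !big_cons addrC [X in is_derive _ _ _ X]addrC.
apply: (@is_deriveDdir _ _ f (fun y => partial i f y * v 0 i)).
- exact: IH.
- near=> y; rewrite mulrC; apply: is_deriveZdir; apply: derivableP.
  by apply: (df i).1; near: y; exact: open_nbhs_nbhs.
- have c := (df i).2 _ Ux; exact: (cvgMr_tmp c).
Unshelve. all: by end_near. Qed.

Lemma partial_deriv f x i d : is_derive x (evec i) f d -> partial i f x = d.
Proof. by move=> [_ <-]. Qed.

Lemma near_line (P : V -> Prop) x v :
  (\forall y \near x, P y) -> \forall t \near (0 : R), P (x + t *: v).
Proof.
move=> /nbhs_ballP[r /= r0 rP].
apply: filterS (near0_normM_lt (normr_ge0 v) r0) => t tr.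
by apply: rP; rewrite -ball_normE /ball_ /= opprD addrA subrr add0r normrN normrZ.
Qed.

(** The second difference [dd] is symmetric in i and j. Two mean value steps show that h^-2 times it
    tends to the iterated partial derivative in either order, so the two limits coincide. *)
Lemma schwarz (U : set V) f x i j : open U -> Ck 2 U f -> U x ->
  partial i (partial j f) x = partial j (partial i f) x.
Proof.
move=> oU C2 Ux.
pose dd t := f (x + t *: evec i + t *: evec j) - f (x + t *: evec i)
  - (f (x + t *: evec j) - f x).
suff main a b (t : R -> R) : (forall h, t h = f (x + h *: evec a + h *: evec b)
    - f (x + h *: evec a) - (f (x + h *: evec b) - f x)) ->
    h^-2 * t h @[h --> 0^'] --> partial b (partial a f) x.
  have cij : h^-2 * dd h @[h --> 0^'] --> partial j (partial i f) x by exact: main.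
  have cji : h^-2 * dd h @[h --> 0^'] --> partial i (partial j f) x.
    apply: main => h; rewrite /dd (addrAC x) !opprB; ring.
  exact: cvg_unique cji cij.
move=> tE; apply/cvgrPdist_lt => e e0.
have Ca : Ck 1 U (partial a f) by exact: Ck_partial.
have cab : {for x, continuous (partial b (partial a f))}.
  by apply: Ck_continuous Ux; exact: (Ck_partial b Ca).
have : \forall y \near x, U y /\
    `|partial b (partial a f) x - partial b (partial a f) y| < e.
  apply: filterI; first exact: open_nbhs_nbhs.
  by move/cvgrPdist_lt : cab; apply.
move=> /nbhs_ballP[r /= r0 rP].
have C0 : 0 <= `|evec a : V| + `|evec b : V| by rewrite addr_ge0.
rewrite near_withinE; apply: filterS (near0_normM_lt C0 r0) => h hr h0.
have inb t1 t2 : 0 <= t1 <= 1 -> 0 <= t2 <= 1 ->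
    ball x r (x + t1 *: (h *: evec a) + t2 *: (h *: evec b)).
  move=> /andP[t10 t11] /andP[t20 t21].
  rewrite -ball_normE /ball_ /= -addrA opprD addrA subrr add0r normrN.
  apply: le_lt_trans (ler_normD _ _) _; apply: le_lt_trans hr.
  by rewrite mulrDr; apply: lerD; rewrite -normrZ [leLHS]normrZ ger0_norm// ler_piMl.
have one : 0 <= (1 : R) <= 1 by rewrite ler01 lexx.
have zero : 0 <= (0 : R) <= 1 by rewrite ler01 lexx.
pose F y := f (y + h *: evec b) - f y.
pose F' y := h * partial a f (y + h *: evec b) - h * partial a f y.
have [t1 /andP[t10 t11] e1] : exists2 t : R, 0 < t < 1 &
    F (x + h *: evec a) - F x = F' (x + t *: (h *: evec a)).
  apply: mean_value_line => t1 t101; rewrite /F /F'.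
  apply: is_deriveB; apply: is_deriveZdir.
    have dsh (y z : V) d : is_derive (y + z) (evec a) f d ->
        is_derive y (evec a) (fun w => f (w + z)) d.
      move=> /is_derive_line df; apply/is_derive_line.
      by under eq_fun do rewrite -addrA.
    apply: dsh; apply: derivableP; apply: (C2.2 a).1.
    by have [] := rP _ (inb t1 1 t101 one); rewrite scale1r.
  apply: derivableP; apply: (C2.2 a).1.
  by have [] := rP _ (inb t1 0 t101 zero); rewrite scale0r addr0.
have t101 : 0 <= t1 <= 1 by rewrite !ltW.
have [t2 /andP[t20 t21] e2] := @mean_value_line _ _ (partial a f)
    (fun y => h * partial b (partial a f) y) (x + t1 *: (h *: evec a))
    (h *: evec b) (fun t t01 => is_deriveZdir _
      (derivableP ((Ca.2 b).1 _ (rP _ (inb t1 t t101 t01)).1))).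
have -> : t h = F (x + h *: evec a) - F x by rewrite tE.
rewrite e1 /F' -mulrBr e2 !mulrA (_ : h ^- 2 * h * h = 1); last by field.
by rewrite mul1r; apply: (rP _ (inb _ _ _ _)).2; rewrite ?ltW.
Qed.

Definition hess f x : 'M[R]_n := \matrix_(i, j) partial j (partial i f) x.

(* f has gradient G and Hessian M at x, tested along each fixed direction. *)
Definition D2 f x G M := {for x, continuous f} /\ forall v, exists f' : V -> R,
  [/\ (\forall y \near x, is_derive y v f (f' y)), f' x = dotv G v
    & is_derive x v f' (bil v M v)].

Lemma D2_eq f x G M G' M' : D2 f x G M -> G = G' -> M = M' -> D2 f x G' M'.
Proof. by move=> ? <- <-. Qed.

Lemma Ck2_D2 (U : set V) f x : open U -> Ck 2 U f -> U x ->
  D2 f x (grad f x) (hess f x).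
Proof.
move=> oU C2 Ux; split; first exact: Ck_continuous C2 Ux.
move=> v; exists (fun y => dotv (grad f y) v); split => //.
  near=> y; apply: (@Ck1_is_derive U) => //; first exact: CkW.
  by near: y; exact: open_nbhs_nbhs.
have -> : (fun y => dotv (grad f y) v) = \sum_i (v 0 i *: partial i f).
  apply/funext => y; rewrite dotvE fct_sumE; apply: eq_bigr => i _.
  by rewrite mxE mulrC.
have -> : bil v (hess f x) v = \sum_i (v 0 i *: dotv (grad (partial i f) x) v).
  rewrite bilE exchange_big/=; apply: eq_bigr => i _.
  rewrite dotvE scaler_sumr; apply: eq_bigr => j _.
  by rewrite !mxE /GRing.scale/= mulrA.
apply: is_derive_sum => i; apply: is_deriveZ.
by apply: (@Ck1_is_derive U) => //; exact: Ck_partial.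
Unshelve. all: by end_near. Qed.

Lemma D2D f g x Gf Gg Mf Mg : D2 f x Gf Mf -> D2 g x Gg Mg ->
  D2 (fun y => f y + g y) x (Gf + Gg) (Mf + Mg).
Proof.
move=> [cf df] [cg dg]; split; first exact: (cvgD cf cg).
move=> v; have [f' [nf ef hf]] := df v; have [g' [ng eg hg]] := dg v.
exists (fun y => f' y + g' y); split.
- by apply: filterS2 nf ng => y dfy dgy; exact: is_deriveD.
- by rewrite ef eg dotvDl.
- by rewrite bilDm; exact: is_deriveD.
Unshelve. all: by end_near. Qed.

Lemma D2_cst (c : R) x : D2 (fun=> c) x 0 0.
Proof.
split; first exact: (@cst_continuous _ _ c x).
move=> v; exists (fun=> 0); split.
- by apply: filterE => y; exact: is_derive_cst.
- by rewrite dotv0l.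
- by rewrite bil0m; exact: is_derive_cst.
Unshelve. all: by end_near. Qed.

Lemma D2Z (c : R) f x G M : D2 f x G M -> D2 (fun y => c * f y) x (c *: G) (c *: M).
Proof.
move=> [cf df]; split; first exact: (cvgMl_tmp cf).
move=> v; have [f' [nf ef hf]] := df v.
exists (fun y => c * f' y); split.
- by apply: filterS nf => y dfy; exact: is_deriveZ.
- by rewrite ef dotvZl.
- by rewrite bilZm; exact: is_deriveZ.
Unshelve. all: by end_near. Qed.

Lemma D2_sum (I : finType) (f : I -> V -> R) x (G : I -> V) (M : I -> 'M[R]_n) :
  (forall i, D2 (f i) x (G i) (M i)) ->
  D2 (fun y => \sum_i f i y) x (\sum_i G i) (\sum_i M i).
Proof.
move=> df; elim: (index_enum _) => [|i r IH].
  under [X in D2 X]eq_fun do rewrite big_nil.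
  by rewrite !big_nil; exact: D2_cst.
under [X in D2 X]eq_fun do rewrite big_cons.
by rewrite !big_cons; exact: D2D.
Qed.

Lemma D2_comp (h h' : R -> R) (d2 : R) f x G M :
  (\forall t \near f x, is_derive (t : R) 1 h (h' t)) -> is_derive (f x) 1 h' d2 ->
  D2 f x G M ->
  D2 (h \o f) x (h' (f x) *: G) (d2 *: (G^T *m G) + h' (f x) *: M).
Proof.
move=> nh dh' [cf df].
have ch (k : R -> R) (t d : R) : is_derive t 1 k d -> {for t, continuous k}.
  by move=> [dk _]; apply/differentiable_continuous; rewrite -derivable1_diffP.
split; first by apply: continuous_comp => //; exact: ch (nbhs_singleton nh).
move=> v; have [f' [nf ef hf]] := df v.
exists (fun y => h' (f y) * f' y); split.
- by apply: filterS2 nf (cf _ nh) => y dfy dhy; exact: is_derive_comp1.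
- by rewrite ef dotvZl.
- rewrite bilDm !bilZm bil_rank1 (dotvC v) -ef.
  have dfx := nbhs_singleton nf.
  apply: is_derive_eq; first exact: (is_deriveM (is_derive_comp1 dh' dfx) hf).
  by rewrite /GRing.scale/=; ring.
Unshelve. all: by end_near. Qed.

End Jets.

(** If d were positive, the difference quotients of f' at 0 would be positive, so f' > 0 just to the
    right of 0, and the mean value theorem would lift f above its maximum. The second derivative is
    needed at 0 only. *)
Lemma second_derivative_test (R : realType) (f f' : R -> R) (d : R) :
  (\forall t \near (0 : R), is_derive (t : R) 1 f (f' t)) ->
  is_derive (0 : R) 1 f' d -> (\forall t \near (0 : R), f t <= f 0) ->
  f' 0 = 0 /\ d <= 0.
Proof.
move=> nf df' nmax.
have /nbhs_ballP[r /= r0 rP] : \forall t \near (0 : R),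
    is_derive (t : R) 1 f (f' t) /\ f t <= f 0 by exact: filterI.
have rP' t : -r < t < r -> is_derive (t : R) 1 f (f' t) /\ f t <= f 0.
  by move=> tr; apply: rP; rewrite -ball_normE /ball_ /= sub0r normrN ltr_norml.
have f'0 : f' 0 = 0.
  have h0 : 0 \in `]-r, r[%R by rewrite in_itv/= oppr_lt0 r0.
  have [_ e0] : is_derive (0 : R) 1 f 0.
    apply: (@derive1_at_max _ f (- r) r 0) => //; first by rewrite ge0_cp// ltW.
      by move=> t; rewrite in_itv/= => /rP'[[]].
    by move=> t; rewrite in_itv/= => /rP'[].
  by have [|[_ <-] _] := rP' 0; first by rewrite oppr_lt0 r0.
split => //; rewrite leNgt; apply/negP => d0.
have [dc _] := df'; have := dc; rewrite /derivable => /cvg_ex[l cl].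
have dl : d = l by case: df' => _ <-; exact: cvg_lim.
have : \forall h \near 0^', 0 < h^-1 * f' h.
  have /cvgrPdist_lt/(_ _ d0) := cl.
  apply: filterS => h /=; rewrite -dl addr0 [_%:A]mulr1 f'0 subr0 /GRing.scale/=.
  by rewrite ltr_norml => /andP[_]; rewrite gtrBl.
move=> /nbhs_ballP[e /= e0 eP].
pose b := Num.min e r / 2.
have er : 0 < Num.min e r by rewrite lt_min e0.
have b0 : 0 < b by rewrite divr_gt0.
have bm : b < Num.min e r by rewrite ltr_pdivrMr// ltr_pMr// ltr1n.
have [be br] : b < e /\ b < r by move: bm; rewrite lt_min => /andP.
have [||c] := @MVT _ f f' 0 b b0.
- move=> t; rewrite in_itv/= => /andP[t0 tb]; apply: (rP' t _).1.
  by rewrite (lt_trans _ t0) ?oppr_lt0//= (lt_trans tb).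
- apply: derivable_within_continuous => t; rewrite in_itv/= => /andP[t0 tb].
  have [|[]//] := rP' t.
  by rewrite (lt_le_trans _ t0) ?oppr_lt0//= (le_lt_trans tb).
rewrite in_itv/= => /andP[c0 cb] fb.
have : 0 < c^-1 * f' c.
  apply: eP; last by rewrite gt_eqF.
  by rewrite -ball_normE /ball_ /= sub0r normrN gtr0_norm// (lt_trans cb).
rewrite pmulr_rgt0 ?invr_gt0// => f'c.
have [|_] := rP' b; first by rewrite br (lt_trans _ b0)// oppr_lt0.
by apply/negP; rewrite -ltNge -subr_gt0 fb mulr_gt0// subr0.
Qed.

Lemma for_continuous_sum (R : realType) (T : topologicalType) (I : Type) (r : seq I)
    (f : I -> T -> R) (x : T) : (forall i, {for x, continuous (f i)}) ->
  {for x, continuous (fun y => \sum_(i <- r) f i y)}.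
Proof.
move=> cf; elim: r => [|i r IH].
  have -> : (fun y => \sum_(i <- [::]) f i y) = fun=> 0.
    by apply/funext => y; rewrite big_nil.
  exact: (@cst_continuous _ _ (0 : R) x).
have -> : (fun y => \sum_(j <- i :: r) f j y) = f i + (fun y => \sum_(j <- r) f j y).
  by apply/funext => y; rewrite big_cons.
exact: (continuousD (cf i) IH).
Qed.

Section JetMaximum.
Variables (R : realType) (n : nat).
Local Notation V := 'rV[R]_n.
Implicit Types (f : V -> R) (x v w G : V) (M : 'M[R]_n).

Lemma D2_max f x G M : D2 f x G M -> (\forall y \near x, f y <= f x) ->
  G = 0 /\ forall v, bil v M v <= 0.
Proof.
move=> [_ df] fmax.
have aux v : dotv G v = 0 /\ bil v M v <= 0.
  have [f' [nf <- hf]] := df v.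
  have := @second_derivative_test _ (fun t => f (x + t *: v))
    (fun t => f' (x + t *: v)) (bil v M v).
  rewrite scale0r addr0; apply.
  - apply: filterS (near_line v nf) => t; exact: is_derive_line_at.
  - by apply: is_derive_line_at; rewrite scale0r addr0.
  - exact: (near_line v fmax).
by split => [|v]; [apply: dotv_eq0P => v; have [] := aux v|have [] := aux v].
Qed.

Lemma D2_cst_near f x G M : D2 f x G M -> (\forall y \near x, f y = f x) ->
  G = 0 /\ forall v, bil v M v = 0.
Proof.
move=> df fc.
have [G0 Mle] := D2_max df (filterS (fun y e => eq_ind_r (fun z => z <= f x) (lexx _) e) fc).
split => // v; apply/eqP; rewrite eq_le Mle/=.
have [|_ /(_ v)] := D2_max (D2Z (-1) df).
  by apply: filterS fc => y ->.
by rewrite bilZm mulN1r oppr_le0.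
Qed.

Lemma enorm_triangle (a b : V) : enorm (a + b) <= enorm a + enorm b.
Proof.
rewrite -ler_sqr ?nnegrE ?addr_ge0 ?enorm_ge0// enorm_sqr sqrrD !enorm_sqr.
rewrite !dotv_lin (dotvC b a).
have := ler_norm (dotv a b); have := dotv_le_enorm a b.
set A := dotv a a; set B := dotv b b; set C := dotv a b; set E := enorm a * enorm b.
by rewrite -mulr_natr; lra.
Qed.

Lemma continuous_coord i x : {for x, continuous (fun y : V => y 0 i)}.
Proof. exact: coord_continuous. Qed.

Lemma continuous_dotv_sub y x : {for x, continuous (fun z : V => dotv (z - y) (z - y))}.
Proof.
rewrite (_ : (fun z : V => _) = (fun z => \sum_i (z 0 i - y 0 i) * (z 0 i - y 0 i))); last first.
  by apply/funext => z; rewrite dotvE; apply: eq_bigr => i _; rewrite !mxE.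
apply: for_continuous_sum => i.
have c := continuousB (@continuous_coord i x) (@cst_continuous _ _ (y 0 i) x).
exact: (continuousM c c).
Qed.

Lemma compact_eball (y : V) (r : R) : compact [set x | dotv (x - y) (x - y) <= r].
Proof.
apply: bounded_closed_compact.
  exists (`|y| + Num.sqrt r); split; first exact: num_real.
  move=> b hb x /= xr; apply: le_trans (ltW hb).
  rewrite -[x](subrK y) addrC; apply: le_trans (ler_normD _ _) _.
  rewrite lerD2l; apply: le_trans (norm_le_enorm _) _.
  exact: ler_wsqrtr.
have c : continuous (fun z : V => dotv (z - y) (z - y)).
  by move=> z; exact: continuous_dotv_sub.
by have /continuous_closedP/(_ _ (@closed_le _ r)) := c.
Qed.

Lemma D2_sqdist y x :
  D2 (fun z : V => dotv (z - y) (z - y)) x (2 *: (x - y)) (2%:M).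
Proof.
split; first exact: continuous_dotv_sub.
have lin v w z : is_derive z v (fun z' => dotv (z' - y) w) (dotv v w).
  apply/is_derive_cvg; apply: cvg_near_cst.
  rewrite near_withinE; apply: filterE => h h0.
  by rewrite !dotv_lin; field.
move=> v; exists (fun z => 2 * dotv (z - y) v); split.
- apply: filterE => z; apply/is_derive_cvg.
  rewrite (_ : (fun h => _) = (fun h => h^-1 * (h * (h * dotv v v + 2 * dotv (z - y) v)))); last first.
    apply/funext => h; rewrite -addrA !(dotvDl (h *: v)) !(dotvDr _ (h *: v)).
    by rewrite !dotvZl !dotvZr (dotvC _ v); congr (_ * _); ring.
  have c : h * dotv v v + 2 * dotv (z - y) v @[h --> 0^'] --> 2 * dotv (z - y) v.
    rewrite -[X in _ --> X]add0r -[X in _ --> X + _](mul0r (dotv v v)).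
    apply: cvgD; last exact: cvg_cst.
    by apply: cvgMr_tmp; exact: cvg_within.
  apply: cvg_trans c; apply: near_eq_cvg; rewrite near_withinE; apply: filterE => h h0.
  by rewrite mulrA mulVf// mul1r.
- by rewrite dotvZl.
- by rewrite bil_scalar; apply: is_deriveZ; exact: lin.
Qed.

End JetMaximum.

(** * The P-function *)

(** Dictionary: s = |grad u|^2, sg = s^(p/2 - 1), t and q are the trace of the Hessian and its value
    on grad u, h2 = |Hess u grad u|^2, N2 = |Hess u|^2, while X and Y carry the third derivatives.
    The first equation is the PDE times s, solved for t; the second is its derivative along grad u,
    solved for X. After both substitutions Y and h2 cancel. *)
Lemma Pfunction_identity (R : realType) (p s sg q h2 N2 X Y t f f' : R) :
  p != 0 -> s != 0 -> sg != 0 ->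
  sg * (s * t + (p - 2) * q) + f * s = 0 ->
  ((2 * q * t + s * X) + (p - 2) * (2 * h2 + Y)) * sg
    + (s * t + (p - 2) * q) * ((p - 2) * sg / s * q) + f' * s * s + f * (2 * q) = 0 ->
  (p - 1) / p * ((p / 2) * (p / 2 - 1) * (sg / s) * (4 * (h2 + (p - 2) * q ^+ 2 / s))
    + p / 2 * sg * (2 * (N2 + X) + (p - 2) * (2 * (h2 + Y)) / s))
    + f' * (s + (p - 2) * s ^+ 2 / s) + f * (t + (p - 2) * q / s)
    + p * f / (sg * s) * ((p - 1) * sg * q + f * s)
  = (p - 1) / sg * ((p - 1) * sg * (q / s) + f) ^+ 2
    + (p - 1) * sg * (N2 - q ^+ 2 / s ^+ 2).
Proof.
move=> p0 s0 sg0 e1 e2.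
have et : t = - (p - 2) * q / s - f / sg.
  have : t = (sg * (s * t + (p - 2) * q) + f * s) / (s * sg)
    - (p - 2) * q / s - f / sg by field; rewrite ?s0 ?sg0.
  by rewrite e1 mul0r => ->; ring.
have eX : X = - (2 * q * t + (p - 2) * (2 * h2 + Y)
   + (s * t + (p - 2) * q) * ((p - 2) / s * q) + (f' * s * s + f * (2 * q)) / sg) / s.
  have : X = (((2 * q * t + s * X) + (p - 2) * (2 * h2 + Y)) * sg
    + (s * t + (p - 2) * q) * ((p - 2) * sg / s * q) + f' * s * s + f * (2 * q))/ (s * sg)
   - (2 * q * t + (p - 2) * (2 * h2 + Y)
   + (s * t + (p - 2) * q) * ((p - 2) / s * q) + (f' * s * s + f * (2 * q)) / sg) / s.
     by field; rewrite ?s0 ?sg0.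
  by rewrite e2 mul0r sub0r mulNr.
rewrite eX et; field.
by rewrite ?p0 ?s0 ?sg0.
Qed.

Section PFunction.
Variables (R : realType) (n : nat) (p : R) (u : 'rV[R]_n -> R) (U : set 'rV[R]_n).
Variables F f f' : R -> R.
Local Notation V := 'rV[R]_n.
Implicit Types (x y v w : V).
Hypotheses (p1 : 1 < p) (oU : open U) (C3 : Ck 3 U u).
Hypothesis dF : forall s : R, is_derive s 1 F (f s).
Hypothesis df : forall s : R, is_derive s 1 f (f' s).

Definition gsq x := dotv (grad u x) (grad u x).
Definition sigma x := gsq x `^ (p / 2 - 1).
Definition Pf x := (p - 1) / p * gsq x `^ (p / 2) + F (u x).
Definition hesssq x := \sum_i dotv (row i (hess u x)) (row i (hess u x)).
Definition gHg x := bil (grad u x) (hess u x) (grad u x).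
Definition gradP x := ((p - 1) * sigma x) *: (grad u x *m hess u x) + f (u x) *: grad u x.

Lemma gsq_ge0 x : 0 <= gsq x. Proof. exact: dotv_ge0. Qed.

Lemma gsqE x : gsq x = \sum_i partial i u x ^+ 2.
Proof. by rewrite /gsq dotvE; apply: eq_bigr => i _; rewrite !mxE. Qed.

Lemma sigma_gt0 x : 0 < gsq x -> 0 < sigma x.
Proof. exact: powR_gt0. Qed.

Lemma sigma_gsq x : 0 < gsq x -> sigma x * gsq x = gsq x `^ (p / 2).
Proof.
move=> s0; rewrite -[X in _ * X](powRr1 (ltW s0)) /sigma -powRD.
  by rewrite subrK.
by rewrite (gt_eqF s0) implybT.
Qed.

Lemma sigma_div x : 0 < gsq x -> gsq x `^ (p / 2 - 1 - 1) = sigma x / gsq x.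
Proof.
move=> s0; apply: (mulIf (lt0r_neq0 s0)); rewrite divfK ?lt0r_neq0//.
rewrite -[X in _ * X](powRr1 (ltW s0)) -powRD ?subrK//.
by rewrite (gt_eqF s0) implybT.
Qed.

Lemma C2u : Ck 2 U u. Proof. exact: CkW. Qed.
Lemma C1u : Ck 1 U u. Proof. exact: CkW C2u. Qed.
Lemma C2p i : Ck 2 U (partial i u). Proof. exact: Ck_partial. Qed.
Lemma C1p i : Ck 1 U (partial i u). Proof. exact: CkW (C2p i). Qed.
Lemma C1pp i j : Ck 1 U (partial j (partial i u)). Proof. exact: Ck_partial (C2p i). Qed.

Lemma hess_sym x i j : U x -> hess u x i j = hess u x j i.
Proof. by move=> Ux; rewrite !mxE; apply: schwarz C2u Ux. Qed.

Lemma row_hess x i : row i (hess u x) = grad (partial i u) x.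
Proof. by apply/rowP => j; rewrite !mxE. Qed.

Lemma grad_partial_dot x i v : dotv (grad (partial i u) x) v = \sum_j hess u x i j * v 0 j.
Proof. by rewrite dotvE; apply: eq_bigr => j _; rewrite !mxE. Qed.

Lemma grad_hess_coord x i : U x ->
  dotv (grad (partial i u) x) (grad u x) = (grad u x *m hess u x) 0 i.
Proof.
move=> Ux; rewrite grad_partial_dot mxE; apply: eq_bigr => j _.
by rewrite hess_sym// mulrC.
Qed.

Lemma third_sym x i j k : U x ->
  hess (partial k u) x i j = partial k (partial j (partial i u)) x.
Proof.
move=> Ux; rewrite mxE.
have -> : partial j (partial i (partial k u)) x = partial j (partial k (partial i u)) x.
  apply: near_eq_derive; near=> y; apply: (schwarz _ _ oU C2u).
  by near: y; exact: open_nbhs_nbhs.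
exact: (schwarz _ _ oU (C2p i) Ux).
Unshelve. all: by end_near. Qed.

Definition hess_gsq x : 'M[R]_n :=
  \sum_k (2 *: ((grad (partial k u) x)^T *m grad (partial k u) x)
          + (2 * partial k u x) *: hess (partial k u) x).

Lemma D2_gsq x : U x -> D2 gsq x (2 *: (grad u x *m hess u x)) (hess_gsq x).
Proof.
move=> Ux.
have -> : gsq = fun y => \sum_k ((fun t : R => t ^+ 2) \o partial k u) y.
  by apply/funext => y; rewrite gsqE.
have -> : 2 *: (grad u x *m hess u x) = \sum_k (2 * partial k u x) *: grad (partial k u) x.
  apply/rowP => j; rewrite mxE summxE mxE mulr_sumr; apply: eq_bigr => k _.
  by rewrite !mxE mulrA.
apply: D2_sum => k.
have dsq (t : R) : is_derive t 1 (fun t : R => t ^+ 2) (2 * t).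
  have -> : (fun t : R => t ^+ 2) = @id R * @id R by apply/funext => z; rewrite expr2.
  have d1 : is_derive t 1 (@id R) 1 by exact: is_derive_id.
  apply: is_derive_eq (is_deriveM d1 d1) _.
  by rewrite /GRing.scale/=; ring.
apply: (@D2_comp _ _ (fun t : R => t ^+ 2) (fun t => 2 * t) 2).
- exact: filterE.
- rewrite -[X in is_derive _ _ _ X]mulr1.
  exact: (@is_deriveZ _ _ _ (@id R) 2 _ 1 1 (is_derive_id _ _)).
- exact: Ck2_D2 (C2p k) Ux.
Qed.

Definition hessP x : 'M[R]_n :=
  ((p - 1) / p) *: ((p / 2 * (p / 2 - 1) * gsq x `^ (p / 2 - 2)) *:
      ((2 *: (grad u x *m hess u x))^T *m (2 *: (grad u x *m hess u x)))
    + (p / 2 * sigma x) *: hess_gsq x)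
  + (f' (u x) *: ((grad u x)^T *m grad u x) + f (u x) *: hess u x).

Lemma D2_Pf x : U x -> 0 < gsq x -> D2 Pf x (gradP x) (hessP x).
Proof.
move=> Ux s0; have p0 : p != 0 by rewrite gt_eqF// (lt_trans ltr01).
rewrite (_ : gradP x = ((p - 1) / p) *: ((p / 2 * sigma x) *: (2 *: (grad u x *m hess u x)))
    + f (u x) *: grad u x); last first.
  by rewrite /gradP !scalerA; congr (_ *: _ + _); field.
have dFu : D2 (F \o u) x (f (u x) *: grad u x)
    (f' (u x) *: ((grad u x)^T *m grad u x) + f (u x) *: hess u x).
  apply: (@D2_comp _ _ F f) => //; last exact: Ck2_D2 C2u Ux.
  exact: filterE.
have n1 : \forall t \near gsq x, is_derive (t : R) 1 (@powR R ^~ (p / 2))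
    (p / 2 * t `^ (p / 2 - 1)).
  near=> t; apply: is_derive1_powR.
  by near: t; exact: lt_nbhsr.
have n2 : is_derive (gsq x) 1 (fun t : R => p / 2 * t `^ (p / 2 - 1))
    (p / 2 * (p / 2 - 1) * gsq x `^ (p / 2 - 2)).
  rewrite -[X in is_derive _ _ _ X]mulrA; apply: is_deriveZ.
  rewrite (_ : p / 2 - 2 = p / 2 - 1 - 1); last by ring.
  exact: is_derive1_powR.
exact: (D2D (D2Z ((p - 1) / p) (D2_comp n1 n2 (D2_gsq Ux))) dFu).
Unshelve. all: by end_near. Qed.

(** The nondivergence form of the equation, multiplied by [gsq u x] to clear the division by |grad
    u|^2. *)
Definition pde_at x :=
  sigma x * (gsq x * \tr (hess u x) + (p - 2) * gHg x) + f (u x) * gsq x = 0.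

Lemma is_derive_gHg x v : U x -> is_derive x v gHg
  (\sum_j \sum_i (dotv (grad (partial i u) x) v * hess u x i j * partial j u x
     + partial i u x * dotv (grad (partial j (partial i u)) x) v * partial j u x
     + partial i u x * hess u x i j * dotv (grad (partial j u) x) v)).
Proof.
move=> Ux.
have -> : gHg = fun y => \sum_j \sum_i
    (partial i u y * partial j (partial i u) y * partial j u y).
  apply/funext => y; rewrite /gHg bilE; apply: eq_bigr => j _.
  by apply: eq_bigr => i _; rewrite !mxE.
apply: is_derive_bigsum => j; apply: is_derive_bigsum => i.
have di k : is_derive x v (partial k u) (dotv (grad (partial k u) x) v).
  exact: Ck1_is_derive (C1p k) Ux.
have dij : is_derive x v (partial j (partial i u))
  (dotv (grad (partial j (partial i u)) x) v).
  exact: Ck1_is_derive (C1pp i j) Ux.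
apply: is_derive_eq (is_derive_mul (is_derive_mul (di i) dij) (di j)) _.
by rewrite mulrDl [hess u x i j]mxE.
Qed.

Lemma is_derive_tr_hess x v : U x -> is_derive x v (fun y => \tr (hess u y))
  (\sum_i dotv (grad (partial i (partial i u)) x) v).
Proof.
move=> Ux.
have -> : (fun y => \tr (hess u y)) = fun y => \sum_i partial i (partial i u) y.
  by apply/funext => y; apply: eq_bigr => i _; rewrite mxE.
by apply: is_derive_bigsum => i; exact: Ck1_is_derive (C1pp i i) Ux.
Qed.

Lemma is_derive_gsq x v : U x -> is_derive x v gsq (2 * dotv (grad u x *m hess u x) v).
Proof.
move=> Ux; have [_ /(_ v)[g' [ng eg _]]] := D2_gsq Ux.
by have := nbhs_singleton ng; rewrite eg dotvZl.
Qed.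

Lemma is_derive_sigma x v : U x -> 0 < gsq x ->
  is_derive x v sigma ((p - 2) * sigma x / gsq x * dotv (grad u x *m hess u x) v).
Proof.
move=> Ux s0.
apply: is_derive_eq
  (is_derive_comp1 (is_derive1_powR (p / 2 - 1) s0) (is_derive_gsq v Ux)) _.
have s0' : gsq x != 0 by rewrite gt_eqF.
by rewrite sigma_div//; field.
Qed.

Lemma is_derive_fu x v : U x -> is_derive x v (f \o u) (f' (u x) * dotv (grad u x) v).
Proof. by move=> Ux; apply: is_derive_comp1 => //; exact: Ck1_is_derive C1u Ux. Qed.

(** The terms X, Y, h2 of [Pfunction_identity]; [Xt] and [Yt] are the trace, and the value on grad
    u, of the derivative of the Hessian along grad u. *)
Let Xt x := \sum_k partial k u x * \tr (hess (partial k u) x).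
Let Yt x := \sum_k partial k u x * bil (grad u x) (hess (partial k u) x) (grad u x).
Let h2 x := dotv (grad u x *m hess u x) (grad u x *m hess u x).

(** The left side of the equation vanishes near x, so its derivative along grad u is 0. This
    direction produces precisely the third order terms that occur in the Hessian of |grad u|^2. *)
Lemma pde_derive x : U x -> 0 < gsq x -> (\forall y \near x, pde_at y) ->
  ((2 * gHg x * \tr (hess u x) + gsq x * Xt x) + (p - 2) * (2 * h2 x + Yt x)) * sigma x
    + (gsq x * \tr (hess u x) + (p - 2) * gHg x) * ((p - 2) * sigma x / gsq x * gHg x)
    + f' (u x) * gsq x * gsq x + f (u x) * (2 * gHg x) = 0.
Proof.
move=> Ux s0 npde.
have ds := is_derive_gsq (grad u x) Ux; have dt := is_derive_tr_hess (grad u x) Ux.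
have dq := is_derive_gHg (grad u x) Ux; have dsg := is_derive_sigma (grad u x) Ux s0.
have dfu := is_derive_fu (grad u x) Ux.
have [_ dE] := is_derive_add (is_derive_mul dsg (is_derive_add (is_derive_mul ds dt)
  (is_derive_scale (p - 2) dq))) (is_derive_mul dfu ds).
have [_ d0] : is_derive x (grad u x) (fun y => sigma y * (gsq y * \tr (hess u y)
    + (p - 2) * gHg y) + (f \o u) y * gsq y) 0.
  apply: near_eq_is_derive (is_derive_cst 0 x (grad u x)).
  by apply: filterS npde => y ->.
rewrite d0 in dE; clear d0; rewrite [RHS]dE; clear dE.
have -> : \sum_i dotv (grad (partial i (partial i u)) x) (grad u x) = Xt x.
  rewrite /Xt; under [RHS]eq_bigr => k _ do rewrite /mxtrace mulr_sumr.
  rewrite exchange_big; apply: eq_bigr => i _; rewrite dotvE; apply: eq_bigr => k _.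
  by rewrite third_sym// !mxE mulrC.
have -> : \sum_j \sum_i (dotv (grad (partial i u) x) (grad u x) * hess u x i j * partial j u x
     + partial i u x * dotv (grad (partial j (partial i u)) x) (grad u x) * partial j u x
     + partial i u x * hess u x i j * dotv (grad (partial j u) x) (grad u x))
   = 2 * h2 x + Yt x.
  under eq_bigr => j _ do rewrite !big_split/=.
  (* The derivative of gHg has three groups of terms: the middle one differentiates the Hessian and
     gives [Yt], the outer two differentiate a gradient factor and give [h2] each. *)
  rewrite !big_split/= [X in _ + X + _](_ : _ = Yt x); last first.
    rewrite /Yt; under [RHS]eq_bigr => k _ do rewrite bilE mulr_sumr.
    rewrite [RHS]exchange_big; apply: eq_bigr => j _.
    under [RHS]eq_bigr => k _ do rewrite mulr_sumr.
    rewrite [RHS]exchange_big; apply: eq_bigr => i _.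
    rewrite dotvE mulr_sumr mulr_suml; apply: eq_bigr => k _.
    by rewrite third_sym// !mxE; ring.
  rewrite [X in X + _ + _](_ : _ = h2 x); last first.
    rewrite exchange_big /h2 dotvE; apply: eq_bigr => i _.
    rewrite -[X in _ = _ * X](grad_hess_coord i Ux) [X in _ = _ * X]grad_partial_dot mulr_sumr.
    by apply: eq_bigr => j _; rewrite grad_hess_coord// mulrA [grad u x 0 j]mxE.
  rewrite [X in _ + X](_ : _ = h2 x); last first.
    rewrite /h2 dotvE; apply: eq_bigr => j _.
    rewrite [X in X * _]mxE mulr_suml; apply: eq_bigr => i _.
    by rewrite grad_hess_coord// [grad u x 0 i]mxE.
  by ring.
rewrite -[dotv (_ *m _) (grad u x)]/(gHg x) -[dotv (grad u x) (grad u x)]/(gsq x) /=.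
by ring.
Qed.

Lemma tr_sum (I : finType) (A : I -> 'M[R]_n) : \tr (\sum_i A i) = \sum_i \tr (A i).
Proof. exact: raddf_sum. Qed.

Lemma bil_summ (I : finType) (A : I -> 'M[R]_n) v w :
  bil v (\sum_i A i) w = \sum_i bil v (A i) w.
Proof. by rewrite /bil mulmx_sumr dotv_suml. Qed.

Lemma tr_hess_gsq x : \tr (hess_gsq x) = 2 * (hesssq x + Xt x).
Proof.
rewrite /hess_gsq tr_sum mulrDr !mulr_sumr -big_split; apply: eq_bigr => k _.
by rewrite mxtraceD !mxtraceZ tr_rank1 row_hess mulrA.
Qed.

Lemma bil_hess_gsq x : U x -> bil (grad u x) (hess_gsq x) (grad u x) = 2 * (h2 x + Yt x).
Proof.
move=> Ux; rewrite /hess_gsq bil_summ mulrDr [h2 x]dotvE !mulr_sumr -big_split.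
apply: eq_bigr => k _.
by rewrite bilDm !bilZm bil_rank1 (dotvC (grad u x)) grad_hess_coord//; congr (_ + _); rewrite -mulrA.
Qed.

Lemma gradP_dot x : dotv (grad u x) (gradP x) =
  (p - 1) * sigma x * gHg x + f (u x) * gsq x.
Proof. by rewrite /gradP dotvDr !dotvZr dotvC. Qed.

(** By [gradP_dot], the quantity squared in the first term on the right is grad u . grad P / |grad
    u|^2; the second term is the squared distance of Hess u from rank one, see [hesssq_rank1]. *)
Lemma ptr_hessP x : U x -> 0 < gsq x -> (\forall y \near x, pde_at y) ->
  ptr p (grad u x) (hessP x)
    + p * f (u x) / (sigma x * gsq x) * dotv (grad u x) (gradP x)
  = (p - 1) / sigma x * ((p - 1) * sigma x * (gHg x / gsq x) + f (u x)) ^+ 2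
    + (p - 1) * sigma x * (hesssq x - gHg x ^+ 2 / gsq x ^+ 2).
Proof.
move=> Ux s0 npde.
have p0 : p != 0 by rewrite gt_eqF// (lt_trans ltr01).
have s0' : gsq x != 0 by rewrite gt_eqF.
have sg0 : sigma x != 0 by rewrite gt_eqF// sigma_gt0.
rewrite -(Pfunction_identity (hesssq x) p0 s0' sg0 (nbhs_singleton npde) (pde_derive Ux s0 npde)).
rewrite /hessP !(ptrD, ptrZ) !ptr_rank1 gradP_dot -/(gsq x) !dotvZl !dotvZr -/(h2 x).
rewrite (dotvC (grad u x) (_ *m _)) -[dotv (_ *m _) (grad u x)]/(gHg x).
rewrite {1 2}/ptr tr_hess_gsq bil_hess_gsq// -/(gsq x) -/(gHg x).
rewrite (_ : gsq x `^ (p / 2 - 2) = sigma x / gsq x); last first.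
  rewrite (_ : p / 2 - 2 = p / 2 - 1 - 1); last by ring.
  exact: sigma_div.
rewrite addrA; congr (_ + _ + _ + _).
by field; rewrite ?s0' ?p0.
Qed.

End PFunction.

(** Where S vanishes the power need not be differentiable, and positivity of a gives the continuity
    directly: S < e^(1/a) implies S^a < e. *)
Lemma for_continuous_powR (R : realType) (T : topologicalType) (S : T -> R) (x : T) (a : R) :
  0 < a -> (forall y, 0 <= S y) -> {for x, continuous S} ->
  {for x, continuous (fun y => S y `^ a)}.
Proof.
move=> a0 S0 cS; have := S0 x; rewrite le_eqVlt => /predU1P[Sx|Sx]; last first.
  apply: (@continuous_comp _ _ _ S (@powR R ^~ a)) => //.
  have [dp _] := is_derive1_powR a Sx.
  by apply/differentiable_continuous; rewrite -derivable1_diffP.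
apply/cvgrPdist_lt => e e0; rewrite -Sx powR0 ?gt_eqF//.
have e1 : 0 < e `^ a^-1 by rewrite powR_gt0.
move/cvgrPdist_lt : cS => /(_ _ e1); apply: filterS => y.
rewrite -Sx !sub0r !normrN ger0_norm// ger0_norm ?powR_ge0// => Sy.
rewrite -[e](powRr1 (ltW e0)) -(mulVf (lt0r_neq0 a0)) powRrM.
by rewrite gt0_ltr_powR// ?nnegrE ?powR_ge0.
Qed.

Lemma closure_le_for (R : realType) (T : topologicalType) (A : set T) (E : T -> R) q (c : R) :
  closure A q -> {for q, continuous E} -> (\forall y \near q, A y -> E y <= c) ->
  E q <= c.
Proof.
move=> Aq cE AE; rewrite leNgt; apply/negP => cEq.
have : \forall y \near q, (A y -> E y <= c) /\ c < E y.
  apply: filterI => //; apply: (cE [set t | c < t]).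
  exact: lt_nbhsr.
by move=> /Aq[y [Ay [/(_ Ay)]]]; rewrite leNgt => /negP.
Qed.

Lemma closure_eq0_for (R : realType) (T : topologicalType) (A : set T) (E : T -> R) q :
  closure A q -> {for q, continuous E} -> (\forall y \near q, A y -> E y = 0) ->
  E q = 0.
Proof.
move=> Aq cE AE; apply/eqP; rewrite eq_le; apply/andP; split.
  by apply: (closure_le_for Aq cE); apply: filterS AE => y /[apply] ->.
rewrite -oppr_le0; apply: (closure_le_for Aq (continuousN cE)).
by apply: filterS AE => y /[apply] ->; rewrite oppr0.
Qed.

Lemma for_continuous_mul (R : realType) (T : topologicalType) (a b : T -> R) (x : T) :
  {for x, continuous a} -> {for x, continuous b} -> {for x, continuous (fun y => a y * b y)}.
Proof. exact: continuousM. Qed.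

Lemma for_continuous_add (R : realType) (T : topologicalType) (a b : T -> R) (x : T) :
  {for x, continuous a} -> {for x, continuous b} -> {for x, continuous (fun y => a y + b y)}.
Proof. exact: continuousD. Qed.

Lemma is_derive_continuous (R : realType) (h : R -> R) (t d : R) : is_derive t 1 h d -> {for t, continuous h}.
Proof. by move=> [dh _]; apply/differentiable_continuous; rewrite -derivable1_diffP. Qed.

(** * The equation at noncritical points, and the subsolution property of P *)

Section PLaplaceEquation.
Variables (R : realType) (n : nat) (p : R) (u : 'rV[R]_n -> R) (U : set 'rV[R]_n).
Variables F f f' : R -> R.
Local Notation V := 'rV[R]_n.
Implicit Types (x y v w : V).
Hypotheses (p1 : 1 < p) (oU : open U) (C3 : Ck 3 U u).
Hypothesis dF : forall s : R, is_derive s 1 F (f s).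
Hypothesis df : forall s : R, is_derive s 1 f (f' s).

Lemma plap_fieldE x i : plap_field p u x 0 i = sigma p u x * partial i u x.
Proof.
rewrite !mxE; congr (_ * _); rewrite /enorm -powR12_sqrt ?dotv_ge0// -powRrM.
by rewrite /sigma; congr (_ `^ _); field.
Qed.

Lemma divergence_plap x : U x -> 0 < gsq u x ->
  divergence (plap_field p u) x * gsq u x =
  sigma p u x * (gsq u x * \tr (hess u x) + (p - 2) * gHg u x).
Proof.
move=> Ux s0; have s0' : gsq u x != 0 by rewrite gt_eqF.
rewrite /divergence.
rewrite (eq_bigr (fun i => (p - 2) * sigma p u x / gsq u x
    * ((grad u x *m hess u x) 0 i * (grad u x) 0 i) + sigma p u x * hess u x i i)).
  by rewrite big_split/= -!mulr_sumr -dotvE -/(bil _ _ _) -/(gHg u x) -/(mxtrace _); field.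
move=> i _; apply: partial_deriv.
rewrite (_ : (fun y => _) = fun y => sigma p u y * partial i u y); last first.
  by apply/funext => y; exact: plap_fieldE.
apply: is_derive_eq (is_derive_mul (is_derive_sigma p oU C3 (evec i) Ux s0)
  (Ck1_is_derive (evec i) oU (C1p C3 i) Ux)) _.
by rewrite !dotv_evec [grad u x 0 i]mxE [grad _ x 0 i]mxE [hess u x i i]mxE !mulrA.
Qed.

(** The right side is the squared Frobenius distance from Hess u to its orthogonal projection on the
    line spanned by g g^T, with g = grad u; the coefficient of that projection is gHg / |g|^4. It
    yields both the inequality and the equality case. *)
Lemma hesssq_rank1 x : 0 < gsq u x ->
  hesssq u x - gHg u x ^+ 2 / gsq u x ^+ 2 = \sum_i \sum_j
   (hess u x i j - gHg u x / gsq u x ^+ 2 * (grad u x 0 i * grad u x 0 j)) ^+ 2.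
Proof.
move=> s0; have s0' : gsq u x != 0 by rewrite gt_eqF.
set c := gHg u x / gsq u x ^+ 2; set g := grad u x; set H := hess u x.
have e1 i : \sum_j (H i j - c * (g 0 i * g 0 j)) ^+ 2 =
   dotv (row i H) (row i H) - 2 * c * (\sum_j g 0 i * H i j * g 0 j)
   + c ^+ 2 * gsq u x * (g 0 i * g 0 i).
  rewrite /gsq !dotvE !mulr_sumr mulr_suml -sumrB -big_split/=.
  by apply: eq_bigr => j _; rewrite !mxE -/(g 0 j); ring.
under eq_bigr => i _ do rewrite e1.
rewrite !big_split/= sumrN -!mulr_sumr -/(hesssq u x) -dotvE -/(gsq u x).
rewrite exchange_big -bilE -/(gHg u x) /c.
by field.
Qed.

Lemma hesssq_ge x : 0 < gsq u x -> 0 <= hesssq u x - gHg u x ^+ 2 / gsq u x ^+ 2.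
Proof.
move=> s0; rewrite hesssq_rank1//; apply: sumr_ge0 => i _; apply: sumr_ge0 => j _.
exact: sqr_ge0.
Qed.

Lemma Pf_elliptic x : U x -> 0 < gsq u x -> (\forall y \near x, pde_at p u f y) ->
  0 <= ptr p (grad u x) (hessP p u f f' x)
    + p * f (u x) / (sigma p u x * gsq u x) * dotv (grad u x) (gradP p u f x).
Proof.
move=> Ux s0 npde; rewrite (ptr_hessP p1 oU C3 df Ux s0 npde).
have sg0 := sigma_gt0 p s0.
have p10 : 0 <= p - 1 by rewrite subr_ge0 ltW.
apply: addr_ge0; apply: mulr_ge0; rewrite ?sqr_ge0 ?hesssq_ge//.
  by rewrite divr_ge0// ltW.
by rewrite mulr_ge0// ltW.
Qed.

Lemma continuous_gsq x : U x -> {for x, continuous (gsq u)}.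
Proof. by move=> Ux; have [] := D2_gsq oU C3 Ux. Qed.

Lemma near_gsq_gt0 x : U x -> 0 < gsq u x -> \forall y \near x, 0 < gsq u y.
Proof.
move=> Ux s0; have c : gsq u @ x --> gsq u x := continuous_gsq Ux.
by apply: (c [set t | 0 < t]); exact: lt_nbhsr.
Qed.

Lemma continuous_sigma x : U x -> 0 < gsq u x -> {for x, continuous (sigma p u)}.
Proof.
move=> Ux s0; apply: (@continuous_comp _ _ _ (gsq u) (@powR R ^~ (p / 2 - 1))).
  exact: continuous_gsq.
have [dp _] := is_derive1_powR (p / 2 - 1) s0.
by apply/differentiable_continuous; rewrite -derivable1_diffP.
Qed.

Lemma continuous_gHg x : U x -> {for x, continuous (gHg u)}.
Proof.
move=> Ux; rewrite (_ : gHg u = fun y => \sum_j \sum_i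
    (partial i u y * partial j (partial i u) y * partial j u y)); last first.
  apply/funext => y; rewrite /gHg bilE; apply: eq_bigr => j _.
  by apply: eq_bigr => i _; rewrite !mxE.
apply: for_continuous_sum => j; apply: for_continuous_sum => i.
apply: for_continuous_mul; first apply: for_continuous_mul.
- exact: Ck_continuous (C1p C3 i) Ux.
- exact: Ck_continuous (C1pp C3 i j) Ux.
- exact: Ck_continuous (C1p C3 j) Ux.
Qed.

Lemma continuous_tr_hess x : U x -> {for x, continuous (fun y => \tr (hess u y))}.
Proof.
move=> Ux; rewrite (_ : (fun y => _) = fun y => \sum_i partial i (partial i u) y); last first.
  by apply/funext => y; apply: eq_bigr => i _; rewrite mxE.
by apply: for_continuous_sum => i; exact: Ck_continuous (C1pp C3 i i) Ux.
Qed.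

Lemma continuous_u x : U x -> {for x, continuous u}.
Proof. exact: Ck_continuous C3. Qed.

Lemma continuous_Pf x : U x -> {for x, continuous (Pf p u F)}.
Proof.
move=> Ux; apply: for_continuous_add.
  apply: for_continuous_mul; first exact: (@cst_continuous _ _ _ x).
  apply: for_continuous_powR; [by rewrite divr_gt0// (lt_trans ltr01)|exact: gsq_ge0|].
  exact: continuous_gsq.
by apply: continuous_comp; [exact: continuous_u|exact: is_derive_continuous (dF _)].
Qed.

(** The equation is given in the open domain only; continuity of the second derivatives of u carries
    it to the boundary, where the curvature is computed. *)
Lemma pde_closure (A : set V) q : closure A q -> U q -> 0 < gsq u q ->
  (forall x, A x -> 0 < gsq u x -> pde_at p u f x) -> pde_at p u f q.
Proof.
move=> Aq Uq s0 pdeA; rewrite /pde_at.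
apply: (closure_eq0_for (E := fun x => sigma p u x * (gsq u x * \tr (hess u x)
  + (p - 2) * gHg u x) + f (u x) * gsq u x) Aq); last first.
  by apply: filterS (near_gsq_gt0 Uq s0) => y sy Ay; exact: pdeA.
apply: for_continuous_add; apply: for_continuous_mul.
- exact: continuous_sigma.
- apply: for_continuous_add; apply: for_continuous_mul.
  + exact: continuous_gsq.
  + exact: continuous_tr_hess.
  + exact: (@cst_continuous _ _ _ q).
  + exact: continuous_gHg.
- by apply: continuous_comp; [exact: continuous_u|exact: is_derive_continuous (df _)].
- exact: continuous_gsq.
Qed.

End PLaplaceEquation.

Lemma near_right0 (R : realType) (P : R -> Prop) :
  (\forall t \near 0^', P t) -> \forall t \near (0 : R), 0 < t -> P t.
Proof.
rewrite near_withinE; apply: filterS => t Pt t0.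
by apply: Pt; rewrite gt_eqF.
Qed.

Lemma is_derive_ge0_right (R : realType) (V : normedModType R) (f : V -> R) x v (d : R) :
  is_derive x v f d -> (\forall t \near (0 : R), 0 < t -> f x <= f (x + t *: v)) ->
  0 <= d.
Proof.
move=> /is_derive_cvg/cvgrPdist_lt cd nf; rewrite leNgt; apply/negP => d0.
have nd0 : 0 < - d by rewrite oppr_gt0.
have := near_right0 (cd _ nd0) => nd.
have : \forall t \near (0 : R), (0 < t -> f x <= f (x + t *: v)) /\
    (0 < t -> `|d - t^-1 * (f (t *: v + x) - f x)| < - d) by exact: filterI.
move=> /nbhs_ballP[r /= r0 rP].
have r20 : 0 < r / 2 by rewrite divr_gt0.
have [|fx ] := rP (r / 2).
  by rewrite -ball_normE /ball_ /= sub0r normrN gtr0_norm// ltr_pdivrMr// ltr_pMr// ltr1n.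
move=> /(_ r20); have := fx r20; rewrite (addrC x) => fx'.
rewrite ltr_norml => /andP[].
set w := (X in d - X) => hw _.
have : 0 <= w by rewrite mulr_ge0 ?invr_ge0 ?subr_ge0// ltW.
lra.
Qed.

Lemma is_derive_lt0_right (R : realType) (V : normedModType R) (f : V -> R) x v (d : R) :
  is_derive x v f d -> d < 0 ->
  \forall t \near (0 : R), 0 < t -> f (x + t *: v) < f x.
Proof.
move=> /is_derive_cvg/cvgrPdist_lt cd d0.
have nd0 : 0 < - d by rewrite oppr_gt0.
apply: filterS (near_right0 (cd _ nd0)) => t ht t0.
have := ht t0; rewrite (addrC _ x) ltr_norml => /andP[hw _].
have : t^-1 * (f (x + t *: v) - f x) < 0 by lra.
by rewrite pmulr_rlt0 ?invr_gt0// subr_lt0.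
Qed.

(** * The gradient of u on the boundary *)

Section OverdeterminedBoundary.
Variables (R : realType) (n : nat) (kappa : R) (u : 'rV[R]_n -> R).
Variables Om U : set 'rV[R]_n.
Local Notation V := 'rV[R]_n.
Implicit Types (x y v w q : V).
Hypotheses (oU : open U) (C1u : Ck 1 U u) (dom : C1_domain Om) (cU : closure Om `<=` U).
Hypotheses (k0 : 0 < kappa) (upos : forall x, Om x -> 0 < u x).
Hypothesis u0 : forall q, bd Om q -> u q = 0.
Hypothesis unu : forall q nu, bd Om q -> ext_normal Om q nu ->
  dotv (grad u q) nu = - kappa.

Lemma bd_closure q : bd Om q -> closure Om q. Proof. by case. Qed.
Lemma bd_U q : bd Om q -> U q. Proof. by move=> [/cU]. Qed.

(** [local_defining] does not assert [rho q = 0]. Approximation from inside gives [rho q <= 0],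
    which suffices: rho strictly decreases along v, hence becomes negative. *)
Lemma defining_inward q r rho v : bd Om q -> local_defining Om q r rho ->
  dotv (grad rho q) v < 0 -> \forall t \near (0 : R), 0 < t -> Om (q + t *: v).
Proof.
move=> bq [r0 [C1r [_ Ome]]] gv.
have ob : open (ball q r) by exact: ball_open.
have bqr : ball q r q by exact: ballxx.
have rq : rho q <= 0.
  apply: (closure_le_for (bd_closure bq) (Ck_continuous C1r bqr)).
  near=> y => Oy; apply: ltW.
  have : (Om `&` ball q r) y by split => //; near: y; exact: nbhsx_ballx.
  by rewrite Ome => -[].
have dr := Ck1_is_derive v ob C1r bqr.
have nb : \forall t \near (0 : R), ball q r (q + t *: v).
  by apply: near_line; exact: nbhsx_ballx.
apply: filterS2 (is_derive_lt0_right dr gv) nb => t ht bt t0.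
suff : (Om `&` ball q r) (q + t *: v) by case.
by rewrite Ome; split => //=; exact: lt_le_trans (ht t0) rq.
Unshelve. all: by end_near. Qed.

(* Directions entering Om cannot decrease u, so the tangential part of grad u
   vanishes on the boundary. *)
Lemma grad_bd q r rho : bd Om q -> local_defining Om q r rho ->
  grad u q = - kappa *: ((enorm (grad rho q))^-1 *: grad rho q).
Proof.
move=> bq ld; set nu := _ *: grad rho q.
have bqr : ball q r q by apply: ballxx; case: ld.
have gr0 : 0 < enorm (grad rho q).
  rewrite sqrtr_gt0 dotv_gt0; case: ld => _ [_ [gn _]]; exact: gn.
have nn : dotv nu nu = 1.
  rewrite /nu dotvZl dotvZr -enorm_sqr; field; exact: lt0r_neq0.
have gnu : dotv (grad u q) nu = - kappa by apply: unu => //; exists r, rho.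
have grE : grad rho q = enorm (grad rho q) *: nu.
  by rewrite /nu scalerA mulfV ?scale1r ?lt0r_neq0.
clearbody nu.
have [tau guE] : exists tau, grad u q = tau - kappa *: nu.
  by exists (grad u q + kappa *: nu); rewrite addrK.
have taunu : dotv tau nu = 0.
  by move: gnu; rewrite guE dotvDl dotvNl dotvZl nn; lra.
(* The tangential direction - tau is only borderline. Tilting it inward by - e nu makes it
   admissible; the derivative of u along it, e kappa - |tau|^2, is then nonnegative for every e >
   0. *)
have key e : 0 < e -> dotv tau tau <= e * kappa.
  move=> e0; pose v := - tau - e *: nu.
  have rv : dotv (grad rho q) v < 0.
    rewrite grE dotvZl pmulr_rlt0// /v dotvDr !dotvNr dotvZr nn (dotvC nu) taunu.
    by rewrite mulr1 oppr0 sub0r oppr_lt0.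
  have := is_derive_ge0_right (Ck1_is_derive v oU C1u (bd_U bq)).
  have -> : dotv (grad u q) v = e * kappa - dotv tau tau.
    rewrite guE /v !(dotvDl, dotvDr, dotvNl, dotvNr, dotvZl, dotvZr) nn (dotvC nu) taunu.
    by ring.
  rewrite subr_ge0; apply.
  by apply: filterS (defining_inward bq ld rv) => t ht t0; rewrite u0//; exact/ltW/upos/ht.
have tau0 : tau = 0.
  apply/eqP; rewrite -dotv_eq0 eq_le dotv_ge0 andbT leNgt; apply/negP => t0.
  have := key (dotv tau tau / kappa / 2); rewrite !divr_gt0// => /(_ isT).
  rewrite (_ : _ * kappa = dotv tau tau / 2); last by field; exact: lt0r_neq0.
  lra.
by rewrite guE tau0 sub0r scaleNr.
Qed.

Lemma gsq_bd q : bd Om q -> gsq u q = kappa ^+ 2.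
Proof.
move=> bq; have [_ [_ [_ /(_ _ bq)[r [rho ld]]]]] := dom.
have gr0 : 0 < enorm (grad rho q).
  rewrite sqrtr_gt0 dotv_gt0; case: ld => r0 [_ [gn _]]; exact/gn/ballxx.
rewrite /gsq (grad_bd bq ld) !dotvZl !dotvZr -enorm_sqr; field.
exact: lt0r_neq0.
Qed.

Lemma enorm_grad_bd q : bd Om q -> enorm (grad u q) = kappa.
Proof. by move=> bq; rewrite /enorm -/(gsq u q) gsq_bd// sqrtr_sqr gtr0_norm. Qed.

Lemma ext_normal_grad q : bd Om q ->
  ext_normal Om q (- (enorm (grad u q))^-1 *: grad u q).
Proof.
move=> bq; have [_ [_ [_ /(_ _ bq)[r [rho ld]]]]] := dom.
exists r, rho; split => //; rewrite enorm_grad_bd// (grad_bd bq ld) scalerA.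
by rewrite (_ : _ * _ = 1) ?scale1r//; field; exact: lt0r_neq0.
Qed.

Lemma inward_grad q v : bd Om q -> 0 < dotv (grad u q) v ->
  \forall t \near (0 : R), 0 < t -> Om (q + t *: v).
Proof.
move=> bq gv; have [_ [_ [_ /(_ _ bq)[r [rho ld]]]]] := dom.
apply: (defining_inward bq ld); move: gv; rewrite (grad_bd bq ld) scalerA dotvZl.
have gr0 : 0 < enorm (grad rho q).
  rewrite sqrtr_gt0 dotv_gt0; case: ld => r0 [_ [gn _]]; exact/gn/ballxx.
by rewrite nmulr_rgt0// mulNr oppr_lt0 divr_gt0.
Qed.

End OverdeterminedBoundary.

(** * The gradient estimate *)

Section PenalizedMaximum.
Variables (R : realType) (n : nat) (p : R) (u : 'rV[R]_n -> R) (U : set 'rV[R]_n).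
Variables F f f' : R -> R.
Local Notation V := 'rV[R]_n.
Implicit Types (x y v w : V).
Hypotheses (p1 : 1 < p) (oU : open U) (C3 : Ck 3 U u).
Hypothesis dF : forall s : R, is_derive s 1 F (f s).
Hypothesis df : forall s : R, is_derive s 1 f (f' s).

(** Here c is the inverse square of the cutoff radius; the shape [1 + - c * _] is the one to which
    [D2D] and [D2Z] apply. *)
Definition cutoff (c : R) x0 x : R := 1 + - c * dotv (x - x0) (x - x0).

Lemma D2_cutoff c x0 x : D2 (cutoff c x0) x ((- c * 2) *: (x - x0)) (- c * 2)%:M.
Proof.
apply: D2_eq (D2D (D2_cst 1 x) (D2Z (- c) (D2_sqdist x0 x))) _ _ => //=.
- by rewrite add0r scalerA.
- by rewrite add0r scale_scalar_mx.
Qed.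

Lemma D2_ln (h : V -> R) x G M : 0 < h x -> D2 h x G M ->
  D2 (@ln R \o h) x ((h x)^-1 *: G) (- (h x) ^- 2 *: (G^T *m G) + (h x)^-1 *: M).
Proof.
move=> hx; apply: (@D2_comp _ _ (@ln R) (fun t => t^-1)).
  near=> t; apply: is_derive1_ln; near: t; exact: lt_nbhsr.
have d1 : is_derive (h x) 1 (@id R) 1 by exact: is_derive_id.
apply: is_derive_eq (is_deriveV _ d1) _; first exact: lt0r_neq0.
by rewrite /GRing.scale/= mulr1.
Unshelve. all: by end_near. Qed.

Lemma D2_expw (eps lam : R) x : U x ->
  D2 ((fun t => eps * expR (lam * t)) \o u) x
    ((lam * (eps * expR (lam * u x))) *: grad u x)
    ((lam ^+ 2 * (eps * expR (lam * u x))) *: ((grad u x)^T *m grad u x)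
     + (lam * (eps * expR (lam * u x))) *: hess u x).
Proof.
move=> Ux; have de (t : R) : is_derive t 1 (fun t : R => eps * expR (lam * t))
    (lam * (eps * expR (lam * t))).
  have d1 : is_derive t 1 (fun t : R => lam * t) lam.
    by rewrite -[X in is_derive _ _ _ X]mulr1; apply: is_derive_scale; exact: is_derive_id.
  have d2 := is_derive1_comp (is_derive_expR (lam * t)) d1.
  by apply: is_derive_eq (is_derive_scale eps d2) _; ring.
apply: (@D2_comp _ _ (fun t => eps * expR (lam * t)) (fun t => lam * (eps * expR (lam * t)))).
- exact: filterE.
- by rewrite expr2 -[X in is_derive _ _ _ X]mulrA; apply: is_derive_scale; exact: de.
- exact: Ck2_D2 (C2u C3) Ux.
Qed.

(* The second order conditions at the maximum, with T1, T2, T3 the elliptic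
   traces of the rank one and Hessian terms, r = f / |grad u|^p and gb, E, b2
   the products of grad u and of the logarithmic gradient b of the cutoff. *)
Lemma penalized_scalar (s r P psi w1 w2 T1 T2 T3 gb E b2 k c d K1 delta mu N : R) :
  0 <= s -> 0 < P -> 0 < psi -> psi <= 1 -> 0 <= w1 -> 1 <= k -> 0 < c -> 0 <= N ->
  0 < K1 -> 0 < delta -> `|r| <= K1 ->
  (- P ^- 2 * T1 + P^-1 * T2) + ((w2 * ((p - 1) * s) + w1 * (- (r * s)))
     + k * (- psi ^- 2 * T3 + psi^-1 * ((- c * 2) * (N + p - 2)))) <= 0 ->
  T1 <= p * (P ^+ 2 * E) -> 0 <= T2 + p * r * (- P * (w1 * s + gb)) ->
  T3 <= p * (c ^+ 2 * 4 * d) -> b2 = k ^+ 2 * psi ^- 2 * (c ^+ 2 * 4 * d) ->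
  E = w1 ^+ 2 * s + 2 * w1 * gb + b2 -> gb ^+ 2 <= s * b2 ->
  0 <= d -> c * d <= 1 ->
  mu <= (p - 1) * w2 - 2 * p * w1 ^+ 2 - (p + 1) * K1 * w1 - p * K1 * delta ->
  mu * (s * psi ^+ 2) <=
  ((3 * p + p * K1 / (4 * delta)) * (4 * k ^+ 2) + 2 * k * (N + p)) * c.
Proof.
move=> s0 P0 psi0 psi1 w10 k1 c0 N0 K10 de0 rK H hT1 hT2 hT3 b2E EE gbs d0 cd hmu.
have p0 : 0 < p by apply: lt_trans p1.
have PV : P != 0 by exact: lt0r_neq0.
have psiV : psi != 0 by exact: lt0r_neq0.
have k0 : 0 < k by apply: lt_le_trans k1.
have cd0 : 0 <= c ^+ 2 * 4 * d.
  by apply: (mulr_ge0 _ d0); apply: mulr_ge0 => //; exact: sqr_ge0.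
have psi2V : 0 <= psi ^- 2 by rewrite invr_ge0 sqr_ge0.
have b20 : 0 <= b2.
  by rewrite b2E; apply: (mulr_ge0 _ cd0); apply: (mulr_ge0 (sqr_ge0 _)).
have H1 : P ^- 2 * T1 <= p * E.
  by rewrite ler_pdivrMl ?exprn_gt0//; move: hT1; rewrite mulrCA.
have H2 : p * r * (w1 * s + gb) <= P^-1 * T2.
  by rewrite ler_pdivlMl//; move: hT2; rewrite !mulNr mulrN subr_ge0 (mulrCA _ P).
(* The assumption 1 <= k replaces k by k^2, so that this error too is expressed by b2 = |b|^2. *)
have H3 : k * (psi ^- 2 * T3) <= p * b2.
  have h : psi ^- 2 * T3 <= psi ^- 2 * (p * (c ^+ 2 * 4 * d)).
    by rewrite ler_pM2l// invr_gt0 exprn_gt0.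
  apply: le_trans (_ : k ^+ 2 * (psi ^- 2 * (p * (c ^+ 2 * 4 * d))) <= _); last first.
    by rewrite b2E le_eqVlt; apply/orP; left; apply/eqP; ring.
  apply: le_trans (_ : k * (psi ^- 2 * (p * (c ^+ 2 * 4 * d))) <= _).
    by rewrite ler_pM2l.
  apply: ler_wpM2r; last by rewrite expr2 ler_pMl.
  by apply: (mulr_ge0 psi2V); apply: (mulr_ge0 (ltW p0)).
(* This is |w1 g + b|^2 <= 2 |w1 g|^2 + 2 |b|^2 in terms of scalars, with Cauchy-Schwarz available
   as gb^2 <= s b2. The case b2 = 0 is separate because the other one multiplies by b2. *)
have H4 : E <= 2 * w1 ^+ 2 * s + 2 * b2.
  suff : 2 * w1 * gb <= w1 ^+ 2 * s + b2 by rewrite EE; lra.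
  have [b0|b0] := eqVneq b2 0.
    have -> : gb = 0.
      by apply/eqP; rewrite -sqrf_eq0 eq_le sqr_ge0 andbT; move: gbs; rewrite b0 mulr0.
    by rewrite mulr0 b0 addr0 mulr_ge0// exprn_ge0.
  have bp : 0 < b2 by rewrite lt0r b0.
  rewrite -(ler_pM2r bp).
  have h1 : w1 ^+ 2 * gb ^+ 2 <= w1 ^+ 2 * (s * b2).
    by rewrite ler_wpM2l// exprn_ge0.
  have h2 := sqr_ge0 (w1 * gb - b2).
  rewrite sqrrB exprMn in h2.
  move: h1 h2; rewrite -mulr_natr !expr2 => h1 h2.
  lra.
(* Weighted Young inequality for sqrt(s b2). The weight delta stays free, so that the part
   proportional to s can be absorbed into mu. *)
have H5 : `|gb| <= delta * s + b2 / (4 * delta).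
  have hn : gb ^+ 2 <= (delta * s + b2 / (4 * delta)) ^+ 2.
    apply: le_trans gbs _; rewrite -subr_ge0.
    rewrite (_ : _ - _ = (delta * s - b2 / (4 * delta)) ^+ 2) ?sqr_ge0//.
    by field; exact: lt0r_neq0.
  rewrite -ler_sqr ?nnegrE//; last first.
    by rewrite addr_ge0// ?mulr_ge0 ?invr_ge0 ?mulr_ge0// ltW.
  by rewrite real_normK ?num_real.
have [rlo rhi] : - K1 <= r /\ r <= K1 by move: rK; rewrite ler_norml => /andP.
have H6 : - (p * r * gb) <= p * K1 * (delta * s + b2 / (4 * delta)).
  apply: le_trans (ler_norm _) _; rewrite normrN !normrM (gtr0_norm p0) -!mulrA.
  by rewrite ler_pM2l// ler_pM.
have H7 : - ((p - 1) * r * (w1 * s)) <= (p + 1) * K1 * w1 * s.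
  have ws : 0 <= w1 * s by rewrite mulr_ge0.
  have h : - r * (w1 * s) <= K1 * (w1 * s) by rewrite ler_wpM2r//; lra.
  have : (p - 1) * (- r * (w1 * s)) <= (p - 1) * (K1 * (w1 * s)).
    by rewrite ler_wpM2l// subr_ge0 ltW.
  have : 0 <= K1 * (w1 * s) by rewrite mulr_ge0// ltW.
  lra.
have H8 : k * (psi^-1 * (c * 2 * (N + p - 2))) <= k * (psi^-1 * (c * 2 * (N + p))).
  rewrite ler_pM2l// ler_pM2l ?invr_gt0// ler_pM2l ?mulr_gt0//; lra.
have main : mu * s <= (3 * p + p * K1 / (4 * delta)) * b2
    + k * (psi^-1 * (c * 2 * (N + p))).
  apply: le_trans (ler_wpM2r s0 hmu) _.
  have H4' : p * E <= p * (2 * w1 ^+ 2 * s + 2 * b2) by rewrite ler_pM2l.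
  have e6 : p * K1 * (delta * s + b2 / (4 * delta)) =
    p * K1 * delta * s + p * K1 / (4 * delta) * b2 by field; exact: lt0r_neq0.
  rewrite e6 in H6; clear e6.
  rewrite !mulNr !mulrN in H.
  move: (P ^- 2 * T1) (P^-1 * T2) (psi ^- 2 * T3) (p * K1 / (4 * delta)) psi^-1
    H H1 H2 H3 H4' H6 H7 H8 => a1 a2 a3 a4 ipsi H H1 H2 H3 H4' H6 H7 H8.
  lra.
have b2c : b2 * psi ^+ 2 <= 4 * k ^+ 2 * c.
  rewrite b2E (_ : _ * psi ^+ 2 = 4 * k ^+ 2 * c * (c * d)); last by field.
  by rewrite ler_piMr//; apply: (mulr_ge0 _ (ltW c0)); apply: mulr_ge0; rewrite ?sqr_ge0.
have psi20 : 0 < psi ^+ 2 by rewrite exprn_gt0.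
(* Multiplication by psi^2 removes the negative powers of psi: b2 psi^2 is bounded by a multiple of
   c, and psi <= 1 handles the other term. *)
rewrite mulrA; apply: le_trans (ler_wpM2r (ltW psi20) main) _.
rewrite [leLHS]mulrDl [leRHS]mulrDl; apply: lerD.
  rewrite -[leLHS]mulrA -[leRHS]mulrA; apply: ler_wpM2l => //.
  have := ltW p0; have : 0 <= p * K1 / (4 * delta).
    by apply: mulr_ge0; [apply: mulr_ge0; exact: ltW|rewrite invr_ge0 mulr_ge0// ltW].
  lra.
rewrite (_ : _ * psi ^+ 2 = 2 * k * (N + p) * c * psi); last by field.
apply: ler_piMr => //; apply: (mulr_ge0 _ (ltW c0)); apply: mulr_ge0.
  by rewrite mulr_ge0// ltW.
by rewrite addr_ge0// ltW.
Qed.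

(** Logarithms turn the penalised product into a sum of jets. The first order condition reads grad P
    = - P (lam w grad u + b), with b the logarithmic gradient of the cutoff, and removes grad P
    everywhere; the equation replaces the elliptic trace of Hess u by - f / sigma. What remains is
    [penalized_scalar]. *)
Lemma penalized_max_bound x0 x (eps lam c K1 delta mu : R) (k : nat) :
  let w := eps * expR (lam * u x) in let psi := cutoff c x0 x in
  U x -> 0 < gsq u x -> (\forall y \near x, pde_at p u f y) -> 0 < Pf p u F x ->
  0 < psi -> 0 < eps -> 0 < lam -> (0 < k)%N -> 0 < c -> 0 < K1 -> 0 < delta ->
  `|f (u x)| <= K1 * (sigma p u x * gsq u x) ->
  mu <= (p - 1) * (lam ^+ 2 * w) - 2 * p * (lam * w) ^+ 2
        - (p + 1) * K1 * (lam * w) - p * K1 * delta ->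
  (\forall y \near x, ln (Pf p u F y) + (eps * expR (lam * u y) + k%:R * ln (cutoff c x0 y))
    <= ln (Pf p u F x) + (w + k%:R * ln psi)) ->
  mu * (gsq u x * psi ^+ 2) <=
  ((3 * p + p * K1 / (4 * delta)) * (4 * k%:R ^+ 2) + 2 * k%:R * (n%:R + p)) * c.
Proof.
move=> w psi Ux s0 npde P0 psi0 e0 l0 k0 c0 K10 de0 hf hmu hmax.
have s0' : gsq u x != 0 by rewrite gt_eqF.
have sg0 := sigma_gt0 p s0; have sg0' : sigma p u x != 0 by rewrite gt_eqF.
have g0 : grad u x != 0 by rewrite -dotv_gt0.
have w0 : 0 < w by rewrite mulr_gt0// expR_gt0.
pose b : V := (k%:R * (psi^-1 * (- c * 2))) *: (x - x0).
have DD := D2D (D2_ln P0 (D2_Pf p1 oU C3 dF df Ux s0)) (D2D (D2_expw eps lam Ux)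
  (D2Z k%:R (D2_ln psi0 (D2_cutoff c x0 x)))).
have [G0 Mneg] := D2_max DD hmax.
have ell := Pf_elliptic p1 oU C3 df Ux s0 npde.
have neg := ptr_le0 p1 g0 Mneg; clear DD Mneg.
move: (hessP p u f f' x) ell neg => hP ell.
have ptrg : ptr p (grad u x) ((grad u x)^T *m grad u x) = (p - 1) * gsq u x.
  by rewrite ptr_rank1 -/(gsq u x); field.
rewrite !(ptrD, ptrZ) (ptr_scalar _ _ g0) ptrg.
set T1 := ptr p _ ((gradP p u f x)^T *m gradP p u f x).
set T2 := ptr p _ hP.
set T3 := ptr p _ (_ ^T *m _).
have ptrH : ptr p (grad u x) (hess u x) = - (f (u x) / (sigma p u x * gsq u x) * gsq u x).
  have := nbhs_singleton npde; rewrite /pde_at => pd.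
  rewrite /ptr -/(gsq u x) -/(gHg u x).
  apply: (mulfI s0'); apply: (mulfI sg0').
  rewrite (_ : sigma p u x * (gsq u x * (\tr (hess u x) + (p - 2) * gHg u x / gsq u x)) =
    sigma p u x * (gsq u x * \tr (hess u x) + (p - 2) * gHg u x)); last by field.
  move/eqP: pd; rewrite addr_eq0 => /eqP ->.
  by field; rewrite ?s0' ?sg0'.
rewrite ptrH => H.
set r := f (u x) / _ in H.
have GPE : gradP p u f x = - Pf p u F x *: ((lam * w) *: grad u x + b).
  move/eqP: G0; rewrite addr_eq0 => /eqP G0.
  apply: (scalerI (invr_neq0 (lt0r_neq0 P0))); rewrite G0 [RHS]scalerA mulrN mulVf ?lt0r_neq0//.
  by rewrite scaleN1r /b !scalerA /psi; congr (- (_ + _ *: _)); ring.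
pose d := dotv (x - x0) (x - x0).
have dG : dotv ((- c * 2) *: (x - x0)) ((- c * 2) *: (x - x0)) = c ^+ 2 * 4 * d.
  by rewrite dotvZl dotvZr -/d; ring.
have b2E : dotv b b = k%:R ^+ 2 * psi ^- 2 * (c ^+ 2 * 4 * d).
  by rewrite /b dotvZl dotvZr -/d; field; exact: lt0r_neq0.
clearbody b.
apply: (@penalized_scalar (gsq u x) r (Pf p u F x) psi (lam * w) (lam ^+ 2 * w)
  T1 T2 T3 (dotv (grad u x) b)
  (dotv ((lam * w) *: grad u x + b) ((lam * w) *: grad u x + b)) (dotv b b)
  k%:R c d K1 delta mu n%:R) => //.
- exact: ltW.
- by rewrite /psi /cutoff mulNr gerBl mulr_ge0 ?dotv_ge0 ?ltW.
- by rewrite mulr_ge0 ?ltW.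
- by rewrite ler1n.
- rewrite /r normrM normfV (gtr0_norm (mulr_gt0 sg0 s0)) ler_pdivrMr//.
  exact: mulr_gt0.
- apply: le_trans (ptr_rank1_le _ p1 g0) _.
  by rewrite GPE dotvZl dotvZr [X in p * X <= _]mulrA mulrNN -expr2.
- move: ell; by rewrite GPE dotvZr dotvDr dotvZr -/(gsq u x) -(mulrA p).
- by apply: le_trans (ptr_rank1_le _ p1 g0) _; rewrite dG.
- rewrite !(dotvDl, dotvDr, dotvZl, dotvZr) (dotvC b) -/(gsq u x); ring.
- exact: dotv_cs.
- exact: dotv_ge0.
- by move: psi0; rewrite /psi /cutoff mulNr subr_gt0 => /ltW.
Qed.
End PenalizedMaximum.

(** * The global bound of P by its boundary value *)

Section ModicaEstimate.
Variables (R : realType) (n : nat) (p kappa : R) (u : 'rV[R]_n -> R).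
Variables Om U : set 'rV[R]_n.
Variables F f f' : R -> R.
Local Notation V := 'rV[R]_n.
Implicit Types (x y v w q : V).
Hypotheses (p1 : 1 < p) (oU : open U) (C3 : Ck 3 U u).
Hypothesis dF : forall s : R, is_derive s 1 F (f s).
Hypothesis df : forall s : R, is_derive s 1 f (f' s).
Hypotheses (oOm : open Om) (cU : closure Om `<=` U) (k0 : 0 < kappa).
Hypothesis upos : forall x, Om x -> 0 < u x.
Hypothesis u0 : forall q, bd Om q -> u q = 0.
Hypothesis gq : forall q, bd Om q -> gsq u q = kappa ^+ 2.
Hypothesis hdiv : forall x, Om x -> divergence (plap_field p u) x + f (u x) = 0.
Hypothesis Fle0 : forall s, F s <= 0.

Definition Pbd : R := (p - 1) / p * kappa `^ p + F 0.

Lemma sub_OmU x : Om x -> U x. Proof. by move=> /subset_closure/cU. Qed.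

Lemma pde_Om x : Om x -> 0 < gsq u x -> pde_at p u f x.
Proof.
move=> Ox s0; rewrite /pde_at -(divergence_plap p oU C3 (sub_OmU Ox) s0) -mulrDl.
by rewrite hdiv// mul0r.
Qed.

Lemma near_pde x : Om x -> 0 < gsq u x -> \forall y \near x, pde_at p u f y.
Proof.
move=> Ox s0; near=> y; apply: pde_Om.
  by near: y; exact: open_nbhs_nbhs.
by near: y; exact: (near_gsq_gt0 oU C3 (sub_OmU Ox) s0).
Unshelve. all: by end_near. Qed.

Lemma Pf_bd q : bd Om q -> Pf p u F q = Pbd.
Proof.
move=> bq; rewrite /Pf gq// u0// /Pbd; congr (_ * _ + _).
have -> : kappa ^+ 2 = kappa `^ 2%:R by rewrite powR_mulrn// ltW.
by rewrite -powRrM; congr (_ `^ _); field.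
Qed.

Lemma Pf_gsq_gt0 x : 0 < Pf p u F x -> 0 < gsq u x.
Proof.
move=> P0; rewrite lt0r gsq_ge0 andbT; apply/eqP => s0; move: P0.
have p0 : 0 < p by apply: lt_trans p1.
rewrite /Pf s0 powR0 ?mulr0 ?add0r; first by rewrite ltNge Fle0.
by rewrite gt_eqF// divr_gt0.
Qed.

Lemma continuous_cutoff c x0 x : {for x, continuous (cutoff c x0)}.
Proof. by case: (D2_cutoff c x0 x). Qed.

Lemma bounded_on_itv (M : R) : 0 <= M -> exists2 K, 0 <= K & forall s, 0 <= s <= M -> `|f s| <= K.
Proof.
move=> M0; have [||s0 _ hs0] := @EVT_max _ (fun s => `|f s|) 0 M => //.
  apply: continuous_subspaceT => s; apply: continuous_comp.
    exact: is_derive_continuous (df s).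
  exact: (@norm_continuous _ R^o).
by exists `|f s0| => // s hs; apply: hs0; rewrite in_itv.
Qed.

Lemma modica_bound (M : R) x0 : (forall x, Om x -> `|u x| <= M) -> 0 <= Pbd ->
  Om x0 -> Pf p u F x0 <= Pbd.
Proof.
move=> uM Pbd0 Ox0; rewrite leNgt; apply/negP => Pgt.
set Px0 := Pf p u F x0 in Pgt *.
have Px00 : 0 < Px0 by apply: le_lt_trans Pgt.
have p0 : 0 < p by apply: lt_trans p1.
have p10 : 0 < p - 1 by rewrite subr_gt0.
have M0 : 0 <= M by apply: le_trans (uM _ Ox0).
have [Kf Kf0 hKf] := bounded_on_itv M0.
(* [Y0] will bound |grad u|^p psi^k from below at the maximum point; the 2 pays for a factor exp(w)
   <= 2. Then [K1] converts the bound on f(u) into |f(u)| <= K1 |grad u|^p there. *)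
pose Y0 := p * Px0 / (2 * (p - 1)).
have Y00 : 0 < Y0 by rewrite /Y0 divr_gt0// mulr_gt0.
pose K1 := (Kf + 1) / Y0.
have K10 : 0 < K1 by rewrite divr_gt0// ltr_wpDl.
(* Makes (p - 1) lam exceed the first order coefficient (p + 1) K1 by 2; at most 1 of this excess is
   consumed by 2 p lam w. *)
pose lam := ((p + 1) * K1 + 2) / (p - 1).
have lam0 : 0 < lam by rewrite divr_gt0// addr_gt0// mulr_gt0// addr_gt0.
have lamE : (p - 1) * lam = (p + 1) * K1 + 2 by rewrite /lam; field; exact: lt0r_neq0.
(* The bound th on w meets three demands: th <= 1/2, so that exp(w) <= 2; Pbd exp(th) < Px0, which
   excludes a maximum on the boundary; 2 p lam th <= 1, for the term quadratic in w. *)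
pose th0 := Num.min 2^-1 ((Px0 - Pbd) / (2 * Px0)).
pose th := Num.min th0 (2 * p * lam)^-1.
have pl0 : 0 < 2 * p * lam by rewrite mulr_gt0// mulr_gt0.
have th0P : 0 < th.
  rewrite lt_min; apply/andP; split; last by rewrite invr_gt0.
  rewrite lt_min; apply/andP; split; first by rewrite invr_gt0.
  by rewrite divr_gt0 ?subr_gt0 ?mulr_gt0.
have [th12 thP thl] : [/\ th <= 2^-1, th * Px0 < Px0 - Pbd & 2 * p * lam * th <= 1].
  have hth0 : th <= th0 by rewrite ge_min lexx.
  split.
  - by apply: le_trans hth0 _; rewrite ge_min lexx.
  - have : th <= (Px0 - Pbd) / (2 * Px0).
      by apply: le_trans hth0 _; rewrite ge_min lexx orbT.
    rewrite ler_pdivlMr ?mulr_gt0// => h; have : 0 < Px0 - Pbd by rewrite subr_gt0.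
    lra.
  - have : th <= (2 * p * lam)^-1 by rewrite ge_min lexx orbT.
    by rewrite -[X in th <= X]mulr1 ler_pdivlMl.
have eth : expR th <= (1 - th)^-1.
  have th1 : 0 < 1 - th by lra.
  rewrite -[expR th]invrK lef_pV2 ?posrE ?invr_gt0 ?expR_gt0// -expRN.
  by apply: le_trans (expR_ge1Dx _).
have eth2 : expR th <= 2.
  apply: le_trans eth _; rewrite -[leRHS]invrK lef_pV2 ?posrE ?invr_gt0//; lra.
(* With 0 <= u <= M this normalisation gives eps <= w <= th. *)
pose eps := th * expR (- (lam * M)).
have eps0 : 0 < eps by rewrite mulr_gt0// expR_gt0.
pose w (x : V) := eps * expR (lam * u x).
have uM' x : Om x -> 0 <= u x <= M.
  by move=> Ox; rewrite ltW ?upos//=; apply: le_trans (uM _ Ox); exact: ler_norm.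
have wth t : t <= M -> eps * expR (lam * t) <= th.
  move=> tM; rewrite /eps -mulrA -expRD -[leRHS]mulr1 ler_pM2l// -expR0 ler_expR.
  by rewrite addrC subr_le0 ler_pM2l.
have weps t : 0 <= t -> eps <= eps * expR (lam * t).
  by move=> t0; rewrite ler_pMr// -expR0 ler_expR mulr_ge0// ltW.
(* Solves p K1 delta = mu, so that the Young error takes exactly half of the gain lam eps = 2 mu. *)
pose delta := lam * eps / (2 * p * K1).
have delta0 : 0 < delta.
  by apply: divr_gt0; [apply: mulr_gt0|apply: mulr_gt0 => //; apply: mulr_gt0].
pose mu := lam * eps / 2.
have mu0 : 0 < mu by apply: divr_gt0 => //; exact: mulr_gt0.
(* Since 0 < psi <= 1, k >= p gives psi^k <= (psi^2)^(p/2), and the lower bound [Y0] passes to |grad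
   u|^2 psi^2. *)
have [k pk] : exists k : nat, p <= k%:R.
  by exists (Num.truncn p).+1; exact/ltW/truncnS_gt.
have kpos : (0 < k)%N by rewrite -(ltr0n R); apply: lt_le_trans pk.
pose C := (3 * p + p * K1 / (4 * delta)) * (4 * k%:R ^+ 2) + 2 * k%:R * (n%:R + p).
have C0 : 0 <= C.
  have h1 : 0 <= p * K1 / (4 * delta).
    by apply: divr_ge0; apply: mulr_ge0 => //; exact: ltW.
  have h2 : 0 <= 3 * p + p * K1 / (4 * delta) by move: (ltW p0) h1; lra.
  have h3 : 0 <= n%:R + p by rewrite addr_ge0// ltW.
  apply: addr_ge0; first by apply: mulr_ge0 => //; rewrite mulr_ge0// sqr_ge0.
  by apply: mulr_ge0 => //; apply: mulr_ge0.
pose Z := Y0 `^ (2 / p).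
have Z0 : 0 < Z by rewrite powR_gt0.
(* The maximum conditions will give mu |grad u|^2 psi^2 <= C c, against |grad u|^2 psi^2 >= Z. As
   mu, Z and C do not involve c, a small c is contradictory. *)
pose c := mu * Z / (C + 1).
have C10 : 0 < C + 1 by rewrite ltr_wpDl.
have c0 : 0 < c by apply: divr_gt0 => //; exact: mulr_gt0.
have Cc : C * c < mu * Z.
  rewrite /c mulrA ltr_pdivrMr// mulrC ltr_pM2l; last exact: mulr_gt0.
  by rewrite ltrDl.
(* The cutoff is nonnegative exactly on this ball, so the maximum is sought on a compact set. *)
pose K := [set x | dotv (x - x0) (x - x0) <= c^-1] `&` closure Om.
pose Psi x := Pf p u F x * expR (w x) * cutoff c x0 x ^+ k.
have Kx0 : K x0.
  by split; [rewrite /= subrr dotv0l invr_ge0 ltW|exact: subset_closure].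
have cPsi x : U x -> {for x, continuous Psi}.
  move=> Ux; apply: for_continuous_mul; first apply: for_continuous_mul.
  - exact: (continuous_Pf p1 oU C3 dF Ux).
  - apply: (@continuous_comp _ _ _ w (@expR R)); last exact: continuous_expR.
    by case: (D2_expw oU C3 eps lam Ux).
  - apply: (@continuous_comp _ _ _ (cutoff c x0) (fun t : R => t ^+ k)).
      exact: continuous_cutoff.
    exact: exprn_continuous.
have [x1] : exists2 x1, x1 \in K & forall t, t \in K -> Psi t <= Psi x1.
  apply: EVT_max_rV; first by exists x0.
    by apply: compact_closedI; [exact: compact_eball|exact: closed_closure].
  by apply: continuous_in_subspaceT => x; rewrite inE => -[_ /cU]; exact: cPsi.
rewrite inE => -[/= x1c x1cl] x1max.
have psi1 : cutoff c x0 x1 <= 1.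
  by rewrite /cutoff mulNr gerBl mulr_ge0 ?dotv_ge0 ?ltW.
have psi0 : 0 <= cutoff c x0 x1.
  by rewrite /cutoff mulNr subr_ge0 -ler_pdivlMl// mulr1.
have Psi0 : Px0 <= Psi x1.
  apply: le_trans (x1max x0 _); last by rewrite inE.
  rewrite /Psi /cutoff subrr dotv0l mulr0 addr0 expr1n mulr1 ler_pMr//.
  by rewrite -expR0 ler_expR mulr_ge0 ?expR_ge0// ltW.
have Psi1 : 0 < Psi x1 by apply: lt_le_trans Psi0.
have u1 : 0 <= u x1 <= M.
  have [/uM'//|nO] := pselect (Om x1).
  by rewrite u0 ?lexx//; split => // /interior_subset.
have ew : expR (w x1) <= expR th.
  by rewrite ler_expR wth//; case/andP: u1.
have psik0 : cutoff c x0 x1 ^+ k != 0.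
  by apply/eqP => h; move: Psi1; rewrite /Psi h mulr0 ltxx.
have psi0' : 0 < cutoff c x0 x1.
  rewrite lt0r psi0 andbT; apply: contra psik0 => /eqP ->.
  by rewrite expr0n gtn_eqF.
have psik1 : cutoff c x0 x1 ^+ k <= 1 by rewrite exprn_ile1.
have psikp : 0 < cutoff c x0 x1 ^+ k by rewrite exprn_gt0.
have P1 : 0 < Pf p u F x1.
  by move: Psi1; rewrite /Psi pmulr_lgt0// pmulr_lgt0// expR_gt0.
have Ox1 : Om x1.
  apply: contrapT => nO.
  have bx : bd Om x1 by split => // /interior_subset.
  have : Psi x1 <= Pbd * expR th.
    rewrite /Psi Pf_bd// -[leRHS]mulr1; apply: ler_pM => //.
    - by rewrite mulr_ge0// expR_ge0.
    - exact: ltW.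
    - exact: ler_wpM2l.
  rewrite leNgt => /negP; apply; apply: lt_le_trans Psi0.
  apply: le_lt_trans (ler_wpM2l Pbd0 eth) _.
  by rewrite ltr_pdivrMr; lra.
have s1 := Pf_gsq_gt0 P1.
have Ux1 := sub_OmU Ox1.
have key : Y0 <= gsq u x1 `^ (p / 2) * cutoff c x0 x1 ^+ k.
  have h1 : Px0 <= Pf p u F x1 * cutoff c x0 x1 ^+ k * 2.
    apply: le_trans Psi0 _; rewrite /Psi mulrAC ler_pM2l ?mulr_gt0//.
    exact: le_trans ew eth2.
  have h2 : Pf p u F x1 <= (p - 1) / p * gsq u x1 `^ (p / 2).
    by rewrite /Pf gerDl Fle0.
  have h3 : Pf p u F x1 * cutoff c x0 x1 ^+ k <=
      (p - 1) / p * gsq u x1 `^ (p / 2) * cutoff c x0 x1 ^+ k by rewrite ler_pM2r.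
  have h4 : Px0 <= (p - 1) / p * (gsq u x1 `^ (p / 2) * cutoff c x0 x1 ^+ k) * 2.
    by move: h1 h3; rewrite [in X in _ -> _ -> X]mulrA; lra.
  rewrite /Y0 ler_pdivrMr ?mulr_gt0// mulrC -ler_pdivlMr//.
  apply: le_trans h4 _; rewrite le_eqVlt; apply/orP; left; apply/eqP; field.
  exact: lt0r_neq0.
have sY : Y0 <= sigma p u x1 * gsq u x1.
  rewrite (sigma_gsq p s1); apply: le_trans key _.
  by rewrite ler_piMr// powR_ge0.
have := @penalized_max_bound _ n p u U F f f' p1 oU C3 dF df x0 x1 eps lam c K1 delta mu k
  Ux1 s1 (near_pde Ox1 s1) P1 psi0' eps0 lam0 kpos c0 K10 delta0.
have hf : `|f (u x1)| <= K1 * (sigma p u x1 * gsq u x1).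
  apply: le_trans (hKf _ u1) _; apply: le_trans (_ : K1 * Y0 <= _); last by rewrite ler_pM2l.
  by rewrite /K1 divfK ?lt0r_neq0// lerDl.
move=> /(_ hf) pmb.
have hmu : mu <= (p - 1) * (lam ^+ 2 * w x1) - 2 * p * (lam * w x1) ^+ 2
        - (p + 1) * K1 * (lam * w x1) - p * K1 * delta.
  have e : p * K1 * delta = mu.
    by rewrite /delta /mu; field; rewrite ?(lt0r_neq0 p0) ?(lt0r_neq0 K10).
  rewrite e.
  have hw : w x1 <= th by apply: wth; case/andP: u1.
  have hw' : eps <= w x1 by apply: weps; case/andP: u1.
  have h1 : 2 * p * lam * w x1 <= 1.
    by apply: le_trans thl; rewrite ler_pM2l.
  have lw0 : 0 < lam * w x1 by rewrite mulr_gt0//; apply: lt_le_trans hw'.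
  have -> : (p - 1) * (lam ^+ 2 * w x1) - 2 * p * (lam * w x1) ^+ 2
        - (p + 1) * K1 * (lam * w x1) =
     (lam * w x1) * ((p - 1) * lam - 2 * p * lam * w x1 - (p + 1) * K1) by ring.
  rewrite lamE.
  have h2 : lam * w x1 * 1 <= (lam * w x1) *
      ((p + 1) * K1 + 2 - 2 * p * lam * w x1 - (p + 1) * K1).
    by rewrite ler_pM2l//; lra.
  have h3 : lam * eps <= lam * w x1 by rewrite ler_pM2l.
  rewrite /mu; move: h2; rewrite mulr1 => h2.
  by apply: le_trans (lerB h2 (lexx _)); lra.
have lnPsi y : 0 < Pf p u F y -> 0 < cutoff c x0 y ->
    ln (Psi y) = ln (Pf p u F y) + (w y + k%:R * ln (cutoff c x0 y)).
  move=> Py cy; rewrite /Psi lnM ?posrE ?exprn_gt0 ?mulr_gt0 ?expR_gt0//.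
  by rewrite lnM ?posrE ?expR_gt0// expRK lnXn// mulr_natl addrA.
have hmax : \forall y \near x1, ln (Pf p u F y) + (eps * expR (lam * u y)
    + k%:R * ln (cutoff c x0 y)) <= ln (Pf p u F x1) + (w x1 + k%:R * ln (cutoff c x0 x1)).
  have nP : \forall y \near x1, 0 < Pf p u F y.
    have cP : Pf p u F @ x1 --> Pf p u F x1 := continuous_Pf p1 oU C3 dF Ux1.
    by apply: (cP [set t | 0 < t]); exact: lt_nbhsr.
  have nc : \forall y \near x1, 0 < cutoff c x0 y.
    have cc : cutoff c x0 @ x1 --> cutoff c x0 x1 := @continuous_cutoff c x0 x1.
    by apply: (cc [set t | 0 < t]); exact: lt_nbhsr.
  have nO : \forall y \near x1, Om y by exact: open_nbhs_nbhs.
  near=> y.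
  have Py : 0 < Pf p u F y by near: y.
  have cy : 0 < cutoff c x0 y by near: y.
  have Oy : Om y by near: y.
  rewrite -/(w y) -lnPsi// -lnPsi// ler_ln ?posrE//; last first.
    by rewrite /Psi mulr_gt0 ?exprn_gt0// mulr_gt0// expR_gt0.
  apply: x1max; rewrite inE; split; last exact: subset_closure.
  by move: cy; rewrite /cutoff mulNr subr_gt0 -ltr_pdivlMl// mulr1 => /ltW.
have := pmb hmu hmax; rewrite -/C => fin.
have lt1 : gsq u x1 * cutoff c x0 x1 ^+ 2 < Z.
  by rewrite -(ltr_pM2l mu0); apply: le_lt_trans fin Cc.
have sp0 : 0 <= gsq u x1 * cutoff c x0 x1 ^+ 2 by rewrite mulr_ge0 ?sqr_ge0// ltW.
have : Z <= gsq u x1 * cutoff c x0 x1 ^+ 2; last by rewrite leNgt lt1.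
have Ys : Y0 <= (gsq u x1 * cutoff c x0 x1 ^+ 2) `^ (p / 2).
  apply: le_trans key _; rewrite powRM ?sqr_ge0 ?gsq_ge0// ler_wpM2l ?powR_ge0//.
  have -> : cutoff c x0 x1 ^+ 2 = cutoff c x0 x1 `^ 2%:R by rewrite powR_mulrn.
  rewrite -powRrM (_ : 2%:R * (p / 2) = p); last by field.
  by rewrite -powR_mulrn//; apply: ger_powR => //; rewrite psi0' psi1.
have e1 : gsq u x1 * cutoff c x0 x1 ^+ 2 =
    ((gsq u x1 * cutoff c x0 x1 ^+ 2) `^ (p / 2)) `^ (2 / p).
  rewrite -powRrM (_ : p / 2 * (2 / p) = 1) ?powRr1//.
  by field; exact: lt0r_neq0.
rewrite e1; apply: ge0_ler_powR => //; rewrite ?nnegrE ?powR_ge0//; last exact: ltW.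
by rewrite divr_ge0// ltW.
Unshelve. all: by end_near. Qed.
End ModicaEstimate.

(** * Maximum principles *)

Section HopfLemma.
Variables (R : realType) (n : nat) (p : R).
Local Notation V := 'rV[R]_n.
Implicit Types (x y q : V).
Hypothesis p1 : 1 < p.

Definition sqdist y x : R := dotv (x - y) (x - y).

Lemma sqdist_ge0 y x : 0 <= sqdist y x. Proof. exact: dotv_ge0. Qed.

Lemma D2_barrier (al : R) y x :
  D2 (fun x => expR (- al * sqdist y x)) x
    (- al * expR (- al * sqdist y x) *: (2 *: (x - y)))
    (al ^+ 2 * expR (- al * sqdist y x) *: ((2 *: (x - y))^T *m (2 *: (x - y)))
      + (- al * expR (- al * sqdist y x)) *: (2%:M)).
Proof.
have de (t : R) : is_derive t 1 (fun t : R => expR (- al * t)) (- al * expR (- al * t)).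
  have d1 : is_derive t 1 (fun t : R => - al * t) (- al).
    by rewrite -[X in is_derive _ _ _ X]mulr1; apply: is_derive_scale; exact: is_derive_id.
  by rewrite mulrC; exact: (is_derive1_comp (is_derive_expR (- al * t)) d1).
apply: (@D2_comp _ _ (fun t => expR (- al * t)) (fun t => - al * expR (- al * t))).
- exact: filterE.
- by apply: is_derive_eq (is_derive_scale (- al) (de _)) _; ring.
- exact: D2_sqdist.
Qed.

(** The comparison runs over the whole closed ball instead of an annulus: Q = P + e h is shown to
    stay below its value on the sphere bound, P0 + e h0. On the half ball the choice of e does this,
    elsewhere a large al does. The drift only needs |b| |g| <= K. *)
Lemma hopf (P : V -> R) (g : V -> V) y q (r P0 K d : R) :
  0 < r -> 0 <= K -> sqdist y q = r ^+ 2 -> P q = P0 ->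
  (forall x, sqdist y x <= r ^+ 2 -> {for x, continuous P} /\ P x <= P0) ->
  (forall x, sqdist y x < r ^+ 2 -> P x < P0 /\ g x != 0 /\ exists G M b,
    [/\ D2 P x G M, 0 <= ptr p (g x) M + b * dotv (g x) G &
        b ^+ 2 * dotv (g x) (g x) <= K ^+ 2]) ->
  is_derive q (y - q) P d -> d < 0.
Proof.
move=> r0 K0 qr Pq Pcl Pin dq.
have p0 : 0 < p by apply: lt_trans p1.
have r20 : 0 < r ^+ 2 by rewrite exprn_gt0.
pose c1 := Num.min 1 (p - 1).
have c10 : 0 < c1 by rewrite lt_min ltr01 subr_gt0.
(* Outside the half ball T >= 4 c1 |x - y|^2 > c1 r^2, so al T exceeds the trace term 2 (n + p - 2)
   plus the drift term 2 K r. *)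
pose al := (2 * (n%:R + p) + 2 * K * r + 1) / (c1 * r ^+ 2).
have num0 : 0 < 2 * (n%:R + p) + 2 * K * r + 1.
  have : 0 <= K * r by rewrite mulr_ge0// ltW.
  have : 0 <= n%:R :> R by [].
  lra.
have al0 : 0 < al by apply: divr_gt0 => //; exact: mulr_gt0.
have alE : al * c1 * r ^+ 2 = 2 * (n%:R + p) + 2 * K * r + 1.
  by rewrite /al; field; rewrite ?(lt0r_neq0 r0) ?(lt0r_neq0 c10).
pose h x := expR (- al * sqdist y x).
pose h0 := expR (- al * r ^+ 2).
have h00 : 0 < h0 by exact: expR_gt0.
have h1 x : h x <= 1.
  by rewrite -expR0 ler_expR mulNr oppr_le0 mulr_ge0 ?sqdist_ge0// ltW.
have yball : sqdist y y <= r ^+ 2 / 4 by rewrite /sqdist subrr dotv0l; lra.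
have [xm xm1 xm2] : exists2 xm, xm \in [set x | sqdist y x <= r ^+ 2 / 4] &
    forall t, t \in [set x | sqdist y x <= r ^+ 2 / 4] -> P t <= P xm.
  apply: EVT_max_rV; [by exists y|exact: compact_eball|].
  apply: continuous_in_subspaceT => x; rewrite inE/= => xr.
  by apply: (Pcl x _).1; apply: le_trans xr _; lra.
have Pm : P xm < P0.
  move: xm1; rewrite inE/= => xm1; apply: (Pin xm _).1; apply: le_lt_trans xm1 _; lra.
(* On the half ball P <= P0 - e and h <= 1, whence Q <= P0 there. *)
pose e := P0 - P xm.
have e0 : 0 < e by rewrite subr_gt0.
pose Q x := P x + e * h x.
have DQ x G M : D2 P x G M -> D2 Q x _ _ := fun D => D2D D (D2Z e (D2_barrier al y x)).
have [x1 x1K x1max] : exists2 x1, x1 \in [set x | sqdist y x <= r ^+ 2] &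
    forall t, t \in [set x | sqdist y x <= r ^+ 2] -> Q t <= Q x1.
  apply: EVT_max_rV; [exists y; rewrite /=; lra|exact: compact_eball|].
  apply: continuous_in_subspaceT => x; rewrite inE/= => xr.
  have ch : {for x, continuous (fun z => e * h z)} by case: (D2Z e (D2_barrier al y x)).
  exact: (for_continuous_add (Pcl x xr).1 ch).
have Qle : Q x1 <= P0 + e * h0.
  rewrite leNgt; apply/negP => Qgt.
  move: x1K; rewrite inE/= => x1K.
  have x1r : sqdist y x1 < r ^+ 2.
    rewrite lt_neqAle x1K andbT; apply/eqP => E; move: Qgt; rewrite /Q /h E -/h0.
    by rewrite ltrD2r ltNge (Pcl x1 x1K).2.
  have x1r4 : r ^+ 2 / 4 < sqdist y x1.
    rewrite ltNge; apply/negP => xr; have := xm2 x1; rewrite inE/= => /(_ xr) Px.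
    have : e * h x1 <= e * 1 by rewrite ler_pM2l.
    have : 0 < e * h0 by rewrite mulr_gt0.
    by move: Qgt; rewrite /Q /e; lra.
  have [_ [g0 [G [M [b [DP ell bK]]]]]] := Pin x1 x1r.
  have nmax : \forall z \near x1, Q z <= Q x1.
    have c : sqdist y @ x1 --> sqdist y x1 := @continuous_dotv_sub _ _ y x1.
    have : \forall z \near x1, sqdist y z < r ^+ 2.
      by apply: (c [set t | t < r ^+ 2]); exact: lt_nbhsl.
    by apply: filterS => z zr; apply: x1max; rewrite inE/= ltW.
  have [G0 Mneg] := D2_max (DQ _ _ _ DP) nmax.
  have := ptr_le0 p1 g0 Mneg.
  rewrite ptrD ptrZ ptrD !ptrZ ptr_scalar//.
  have rk := ptr_rank1_ge (2 *: (x1 - y)) p1 g0.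
  rewrite dotvZl dotvZr -/(sqdist y x1) -/c1 in rk.
  set T := ptr p _ (_ *m _) in rk *; set T2 := ptr p _ M in ell *.
  set E := expR _.
  have E0 : 0 < E by exact: expR_gt0.
  have GE : G = (e * al * E * 2) *: (x1 - y).
    move/eqP: G0; rewrite addr_eq0 => /eqP ->; rewrite !scalerA -scaleNr -/E.
    by congr (_ *: _); ring.
  rewrite GE dotvZr in ell.
  set a := b * dotv (g x1) (x1 - y).
  have aK : `|a| <= K * r.
    rewrite -ler_sqr ?nnegrE ?mulr_ge0// ?(ltW r0)// real_normK ?num_real//.
    rewrite /a exprMn exprMn.
    apply: le_trans (_ : b ^+ 2 * (dotv (g x1) (g x1) * sqdist y x1) <= _).
      by rewrite ler_wpM2l ?sqr_ge0// dotv_cs.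
    rewrite mulrA; apply: ler_pM => //; last exact: sqdist_ge0.
    by rewrite mulr_ge0 ?sqr_ge0 ?dotv_ge0.
  have ell' : - (e * al * E * 2 * (K * r)) <= T2.
    have : e * al * E * 2 * a <= e * al * E * 2 * (K * r).
      rewrite ler_pM2l; first exact: le_trans (ler_norm _) aK.
      by rewrite mulr_gt0// mulr_gt0// mulr_gt0.
    have -> : e * al * E * 2 * a = b * (e * al * E * 2 * dotv (g x1) (x1 - y)).
      by rewrite /a; ring.
    by move: ell; lra.
  have pos : 0 < e * al * E by rewrite mulr_gt0// mulr_gt0.
  have lowT : 2 * (n%:R + p) + 2 * K * r + 1 < al * T.
    rewrite -alE -mulrA ltr_pM2l//; apply: lt_le_trans rk.
    by rewrite ltr_pM2l//; lra.
  rewrite leNgt => /negP; apply.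
  have -> : T2 + e * (al ^+ 2 * E * T + - al * E * (2 * (n%:R + p - 2))) =
    T2 + e * al * E * (al * T - 2 * (n%:R + p - 2)) by ring.
  have : 0 < e * al * E * (al * T - 2 * (n%:R + p - 2) - 2 * K * r).
    by rewrite mulr_gt0//; lra.
  by move: ell'; lra.
(* Q is maximal at q, so its derivative towards y is at most 0; the barrier contributes 2 e al h0
   r^2 > 0 to it, which forces d < 0. *)
have dQ : is_derive q (y - q) (fun x => - 1 * Q x)
    (- 1 * (d + e * (- al * h0 * (2 * - r ^+ 2)))).
  apply: is_derive_scale; apply: is_derive_add => //; apply: is_derive_scale.
  have [_ /(_ (y - q))[h' [nh hq _]]] := D2_barrier al y q.
  have := nbhs_singleton nh; rewrite hq qr -/h0 dotvZl dotvZl.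
  rewrite (_ : dotv (q - y) (y - q) = - r ^+ 2)//.
  by rewrite -(opprB q y) dotvNr -qr.
have := is_derive_ge0_right dQ.
have -> : (- 1 * (d + e * (- al * h0 * (2 * - r ^+ 2)))) =
  - d - e * al * h0 * 2 * r ^+ 2 by ring.
have pos : 0 < e * al * h0 * 2 * r ^+ 2.
  by rewrite mulr_gt0// mulr_gt0// mulr_gt0// mulr_gt0.
move=> H; suff : 0 <= - d - e * al * h0 * 2 * r ^+ 2 by lra.
apply: H; near=> t => t0.
have t1 : t < 1 by near: t; exact: lt_nbhsl.
rewrite !mulN1r lerN2 [leRHS]/Q /h qr -/h0 Pq; apply: le_trans Qle.
apply: x1max; rewrite inE/= /sqdist.
have -> : q + t *: (y - q) - y = (1 - t) *: (q - y).
  by rewrite scalerBl scale1r -(opprB q y) scalerN addrAC.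
rewrite dotvZl dotvZr -/(sqdist y q) qr mulrA ler_piMl ?(ltW r20)//.
by rewrite mulr_ile1//; lra.
Unshelve. all: by end_near. Qed.

End HopfLemma.

(** * Hopf's lemma for P and the strong maximum principle *)

Section StrongMaximumPrinciple.
Variables (R : realType) (n : nat) (p : R) (u : 'rV[R]_n -> R).
Variables Om U : set 'rV[R]_n.
Variables F f f' : R -> R.
Local Notation V := 'rV[R]_n.
Implicit Types (x y v w q z : V).
Hypotheses (p1 : 1 < p) (oU : open U) (C3 : Ck 3 U u).
Hypothesis dF : forall s : R, is_derive s 1 F (f s).
Hypothesis df : forall s : R, is_derive s 1 f (f' s).
Hypotheses (oOm : open Om) (OmU : Om `<=` U).
Hypothesis pdeOm : forall x, Om x -> 0 < gsq u x -> \forall y \near x, pde_at p u f y.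
Variable P0 : R.
Hypothesis PleP0 : forall x, Om x -> Pf p u F x <= P0.

(** The drift p f / (sigma |grad u|^2) is singular at critical points; since the closed ball is
    compact and free of them, its product with |grad u| has a finite maximum, which serves as K. *)
Lemma hopf_Pf y q (r : R) : 0 < r -> sqdist y q = r ^+ 2 -> Pf p u F q = P0 ->
  (forall x, sqdist y x <= r ^+ 2 -> [/\ U x, 0 < gsq u x & Pf p u F x <= P0]) ->
  (forall x, sqdist y x < r ^+ 2 -> Om x /\ Pf p u F x < P0) ->
  dotv (gradP p u f q) (y - q) < 0.
Proof.
move=> r0 qr Pq Pcl Pin.
pose b x := p * f (u x) / (sigma p u x * gsq u x).
have [K0 _ hK] : exists2 K0, K0 \in [set x | sqdist y x <= r ^+ 2] &
    forall t, t \in [set x | sqdist y x <= r ^+ 2] ->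
      b t ^+ 2 * gsq u t <= b K0 ^+ 2 * gsq u K0.
  apply: EVT_max_rV; [|exact: compact_eball|].
    by exists y; rewrite /= /sqdist subrr dotv0l sqr_ge0.
  apply: continuous_in_subspaceT => x; rewrite inE/= => /Pcl[Ux sx _].
  have cb : {for x, continuous b}.
    apply: for_continuous_mul; first apply: for_continuous_mul.
    - exact: (@cst_continuous _ _ _ x).
    - apply: (@continuous_comp _ _ _ u f); first exact: (continuous_u C3 Ux).
      exact: is_derive_continuous (df _).
    - have css := for_continuous_mul (@continuous_sigma _ _ p _ _ oU C3 _ Ux sx)
        (continuous_gsq oU C3 Ux).
      by apply: (continuousV _ css); rewrite mulf_neq0// gt_eqF// sigma_gt0.
  have c2 := for_continuous_mul (for_continuous_mul cb cb) (continuous_gsq oU C3 Ux).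
  have e : (fun t => b t ^+ 2 * gsq u t) = (fun t => b t * b t * gsq u t).
    by apply/funext => t; rewrite expr2.
  rewrite e; exact: c2.
have [Uq sq _] : [/\ U q, 0 < gsq u q & Pf p u F q <= P0] by apply: Pcl; rewrite qr.
have [_ /(_ (y - q))[P' [nP P'q _]]] := D2_Pf p1 oU C3 dF df Uq sq.
have := nbhs_singleton nP; rewrite P'q.
apply: (@hopf _ _ p p1 (Pf p u F) (grad u) y q r P0
  (Num.sqrt (b K0 ^+ 2 * gsq u K0))) => //.
- by move=> x /Pcl[Ux _ ?]; split => //; exact: (continuous_Pf p1 oU C3 dF Ux).
- move=> x xr; have [Ox Px] := Pin x xr.
  have [Ux sx _] := Pcl x (ltW xr).
  split => //; split; first by rewrite -dotv_gt0.
  exists (gradP p u f x), (hessP p u f f' x), (b x); split.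
  + exact: (D2_Pf p1 oU C3 dF df Ux sx).
  + exact: (Pf_elliptic p1 oU C3 df Ux sx (pdeOm Ox sx)).
  + have nn : 0 <= b K0 ^+ 2 * gsq u K0 by exact: mulr_ge0 (sqr_ge0 _) (gsq_ge0 _ _).
    by rewrite sqr_sqrtr//; apply: hK; rewrite inE/= ltW.
Qed.

Lemma near_sqdist z (P : V -> Prop) : (\forall x \near z, P x) ->
  exists2 rho : R, 0 < rho & forall x, sqdist z x <= rho ^+ 2 -> P x.
Proof.
move=> /nbhs_ballP[e /= e0 eP]; exists (e / 2); first by rewrite divr_gt0.
move=> x xr; apply: eP; rewrite -ball_normE /ball_ /= distrC.
apply: le_lt_trans (norm_le_enorm _) _; apply: (@le_lt_trans _ _ (e / 2)).
  have e20 : 0 <= e / 2 by rewrite divr_ge0// ltW.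
  by rewrite -ler_sqr ?nnegrE ?enorm_ge0// enorm_sqr.
by rewrite ltr_pdivrMr// ltr_pMr// ltr1n.
Qed.

Lemma sqdist_near z (rho : R) : 0 < rho -> \forall x \near z, sqdist z x <= rho ^+ 2.
Proof.
move=> rho0; have c : sqdist z @ z --> sqdist z z := @continuous_dotv_sub _ _ z z.
have : \forall x \near z, sqdist z x < rho ^+ 2.
  apply: (c [set t | t < rho ^+ 2]); apply: lt_nbhsl.
  by rewrite /sqdist subrr dotv0l exprn_gt0.
by apply: filterS => x /ltW.
Qed.

Lemma sqdistE z x : sqdist z x = enorm (x - z) ^+ 2.
Proof. by rewrite enorm_sqr. Qed.

Lemma enormN (a : V) : enorm (- a) = enorm a.
Proof. by rewrite /enorm dotvNl dotvNr opprK. Qed.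

(** If P y < P0 for some y near z, take the point q of the contact set S nearest to y. The ball
    around y through q touches S from outside, so Hopf's lemma gives a nonzero gradient at q,
    although q is an interior maximum of P. *)
Lemma strong_max z : Om z -> 0 < gsq u z -> Pf p u F z = P0 ->
  \forall x \near z, Pf p u F x = P0.
Proof.
move=> Oz sz Pz.
have [rho rho0 Prho] : exists2 rho : R, 0 < rho &
    forall x, sqdist z x <= rho ^+ 2 -> Om x /\ 0 < gsq u x.
  apply: near_sqdist; apply: filterI; first exact: open_nbhs_nbhs.
  exact: (near_gsq_gt0 oU C3 (OmU Oz) sz).
(* With |y - z| <= rho/4 the radius |q - y| is also at most rho/4, so the ball around y stays inside
   the ball of radius rho around z. *)
have rho40 : 0 < rho / 4 by rewrite divr_gt0.
apply: filterS (sqdist_near z rho40) => y; rewrite sqdistE ler_sqr ?nnegrE ?enorm_ge0 ?(ltW rho40)//.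
move=> yz; apply/eqP; rewrite eq_le; apply/andP; split.
  apply: PleP0; apply: (Prho y _).1; rewrite sqdistE ler_sqr ?nnegrE ?enorm_ge0 ?(ltW rho0)//.
  by apply: le_trans yz _; lra.
rewrite leNgt; apply/negP => Py.
pose S := [set x | sqdist z x <= rho ^+ 2 /\ P0 <= Pf p u F x].
have Sz : S z by split; [rewrite /sqdist subrr dotv0l sqr_ge0|rewrite Pz].
have Scl : closed S.
  move=> x Sx.
  have xr : sqdist z x <= rho ^+ 2.
    apply: (closure_le_for Sx (@continuous_dotv_sub _ _ z x)).
    by apply: filterE => t [].
  split => //; have [Ox _] := Prho x xr.
  rewrite -lerN2.
  apply: (closure_le_for Sx (continuousN (continuous_Pf p1 oU C3 dF (OmU Ox)))).
  by apply: filterE => t [_]; rewrite lerN2.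
have Scpt : compact S.
  apply: (subclosed_compact Scl (@compact_eball _ _ z (rho ^+ 2))).
  by move=> x [].
have [q qS qmin] : exists2 q, q \in S & forall t, t \in S -> sqdist y q <= sqdist y t.
  apply: EVT_min_rV => //; first by exists z.
  by apply: continuous_in_subspaceT => x _; exact: continuous_dotv_sub.
move: qS; rewrite inE => -[qr Pq].
have [Oq sq] := Prho q qr.
have Pq0 : Pf p u F q = P0 by apply/eqP; rewrite eq_le Pq PleP0.
pose r := enorm (q - y).
have r0 : 0 < r.
  rewrite lt0r enorm_ge0 andbT; apply/eqP => r0.
  have : dotv (q - y) (q - y) == 0 by rewrite -enorm_sqr -/r r0 expr0n.
  rewrite dotv_eq0 subr_eq0 => /eqP qy.
  by move: Py; rewrite -qy Pq0 ltxx.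
have rle : r <= rho / 4.
  apply: le_trans yz; rewrite -ler_sqr ?nnegrE ?enorm_ge0//.
  by rewrite -!sqdistE (le_trans (qmin z _)) ?inE// !sqdistE -enormN opprB.
have inb x : sqdist y x <= r ^+ 2 -> sqdist z x <= rho ^+ 2.
  rewrite !sqdistE !ler_sqr ?nnegrE ?enorm_ge0 ?(ltW r0) ?(ltW rho0)// => xr.
  rewrite -(subrK y x) -addrA; apply: le_trans (enorm_triangle _ _) _.
  by apply: le_trans (lerD xr yz) _; lra.
have : dotv (gradP p u f q) (y - q) < 0.
  apply: (@hopf_Pf y q r) => //; first by rewrite sqdistE.
    by move=> x /inb/Prho[Ox sx]; split => //; [exact: OmU|exact: PleP0].
  move=> x xr; have [Ox sx] := Prho x (inb x (ltW xr)); split => //.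
  rewrite lt_neqAle PleP0// andbT; apply/eqP => Px.
  have : x \in S by rewrite inE; split; [exact/inb/ltW|rewrite Px].
  by move=> /qmin; rewrite leNgt [X in _ < X]sqdistE -/r xr.
have nmax : \forall x \near q, Pf p u F x <= Pf p u F q.
  by rewrite Pq0; near=> x; apply: PleP0; near: x; exact: open_nbhs_nbhs.
have [-> _] := D2_max (D2_Pf p1 oU C3 dF df (OmU Oq) sq) nmax.
by rewrite dotv0l ltxx.
Unshelve. all: by end_near. Qed.

End StrongMaximumPrinciple.

(** * Propagation of zeros through a connected set *)

Section Gronwall.
Variables (R : realType) (n : nat).
Local Notation V := 'rV[R]_n.
Implicit Types (x y v z : V).

Lemma connected_open_closed (Om B : set V) : connected Om -> B !=set0 -> B `<=` Om ->
  (forall x, B x -> \forall y \near x, B y) ->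
  (forall x, Om x -> closure B x -> B x) -> forall x, Om x -> B x.
Proof.
move=> cOm B0 BOm Bo Bc.
suff -> : B = Om by [].
apply: cOm => //.
  exists B; first by rewrite openE => x Bx; exact: Bo.
  by rewrite eqEsubset; split => [x Bx|x []//]; split => //; exact: BOm.
exists (closure B); first exact: closed_closure.
rewrite eqEsubset; split => [x Bx|x [Ox]]; last exact: Bc.
by split; [exact: BOm|exact: subset_closure].
Qed.

(** The zero set is closed in [Om]. It is open because along a segment x + t v issuing from a zero
    the function exp(- L t) h^2, with L = 2 K |v|, is nonincreasing in the mean value sense and
    starts at 0. *)
Lemma gronwall_zero (Om : set V) (h : V -> R) z :
  open Om -> connected Om -> Ck 1 Om h -> Om z -> h z = 0 ->
  (forall x, Om x -> h x = 0 -> exists K, 0 <= K /\ \forall y \near x,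
     forall v, `|dotv (grad h y) v| <= K * `|h y| * `|v|) ->
  forall x, Om x -> h x = 0.
Proof.
move=> oOm cOm C1h Oz hz hK.
suff H x : Om x -> (Om `&` [set x | h x = 0]) x by move=> x /H[].
move: x; apply: (connected_open_closed cOm).
- by exists z.
- by move=> y [].
- move=> x [Ox hx]; have [K [K0 nK]] := hK x Ox hx.
have : \forall y \near x, Om y /\ forall v, `|dotv (grad h y) v| <= K * `|h y| * `|v|.
  by apply: filterI => //; exact: open_nbhs_nbhs.
move=> /nbhs_ballP[e /= e0 eP]; apply/nbhs_ballP; exists e => //= y yb.
split; first exact: (eP y yb).1.
pose v := y - x; pose L : R := 2 * K * `|v|.
have inb (t : R) : 0 <= t <= 1 -> ball x e (x + t *: v).
  move=> /andP[t0 t1]; rewrite -ball_normE /ball_ /= opprD addrA subrr add0r normrN.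
  move: yb; rewrite -ball_normE /ball_ /= distrC -/v; apply: le_lt_trans.
  by rewrite normrZ ger0_norm// ler_piMl.
pose ph (t : R) : R := h (x + t *: v); pose ph' (t : R) : R := dotv (grad h (x + t *: v)) v.
pose G (t : R) : R := expR (- L * t) * (ph t * ph t).
pose G' (t : R) : R := - L * expR (- L * t) * (ph t * ph t) + expR (- L * t) * (ph' t * ph t + ph t * ph' t).
have dG (t : R) : 0 <= t <= 1 -> is_derive t 1 G (G' t).
  move=> t01; apply: is_derive_mul.
    have d1 : is_derive t 1 (fun t : R => - L * t) (- L).
      by rewrite -[X in is_derive _ _ _ X]mulr1; apply: is_derive_scale; exact: is_derive_id.
    by rewrite mulrC; exact: (is_derive1_comp (is_derive_expR (- L * t)) d1).
  have dph : is_derive t 1 ph (ph' t).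
    apply: is_derive_line_at; apply: (Ck1_is_derive v oOm C1h).
    exact: (eP _ (inb t t01)).1.
  exact: is_derive_mul.
have [||c c01] := @MVT _ G G' 0 1 ltr01.
- by move=> t; rewrite in_itv/= => /andP[t0 t1]; apply: dG; rewrite !ltW.
- apply: derivable_within_continuous => t; rewrite in_itv/= => t01.
  by have [] := dG _ t01.
have c01' : 0 <= c <= 1 by move: c01; rewrite in_itv/= => /andP[? ?]; rewrite !ltW.
have G'c : G' c <= 0.
  have -> : G' c = expR (- L * c) * (2 * (ph' c * ph c) - L * (ph c * ph c)).
    by rewrite /G'; ring.
  rewrite pmulr_rle0 ?expR_gt0// subr_le0 /L -!mulrA ler_pM2l//.
  apply: le_trans (ler_norm _) _; rewrite normrM.
  have := (eP _ (inb c c01')).2 v; rewrite -/(ph' c) -/(ph c) => h1.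
  apply: le_trans (ler_wpM2r (normr_ge0 (ph c)) h1) _.
  rewrite -[X in _ <= K * (_ * X)]ger0_norm ?normrM -?expr2 ?sqr_ge0//.
  by rewrite le_eqVlt; apply/orP; left; apply/eqP; ring.
rewrite {2}/G /ph scale0r addr0 hx !mulr0 subr0 subr0 mulr1 => G1.
have : G 1 <= 0 by rewrite G1.
rewrite /G pmulr_rle0 ?expR_gt0// -expr2 /ph scale1r /v addrC subrK => h2.
by apply/eqP; rewrite -sqrf_eq0 eq_le h2 sqr_ge0.
- move=> y Oy cy; split => //; apply: (closure_eq0_for cy (Ck_continuous C1h Oy)).
  by apply: filterE => t [].
Qed.

End Gronwall.

Lemma for_continuous_near_eq (R : realType) (T : topologicalType) (a b : T -> R) (x : T) :
  (\forall y \near x, a y = b y) -> {for x, continuous a} -> {for x, continuous b}.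
Proof.
move=> ab ca; apply/cvgrPdist_lt => e e0; move/cvgrPdist_lt : ca => /(_ e e0) nd.
by rewrite -(nbhs_singleton ab); apply: filterS2 nd ab => y + <-.
Qed.

(** * Exit from an open set along a segment, and a second order Taylor bound *)

Section Segments.
Variables (R : realType) (n : nat).
Local Notation V := 'rV[R]_n.
Implicit Types (x y v w q z : V).

Lemma Ck1_intro (U : set V) (h : V -> R) (d : 'I_n -> V -> R) : open U ->
  (forall x, U x -> {for x, continuous h}) ->
  (forall i x, U x -> is_derive x (evec i) h (d i x)) ->
  (forall i x, U x -> {for x, continuous (d i)}) ->
  Ck 1 U h /\ forall i x, U x -> partial i h x = d i x.
Proof.
move=> oU ch dh cd.
have pe i x : U x -> partial i h x = d i x by move=> Ux; apply: partial_deriv; exact: dh.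
split => //; split => // i; split => [x Ux|x Ux]; first by have [] := dh i x Ux.
suff : {for x, continuous (partial i h)} by [].
apply: for_continuous_near_eq _ (cd i x Ux).
have nU : \forall y \near x, U y by exact: open_nbhs_nbhs.
by apply: filterS nU => y Uy; rewrite pe.
Qed.

Lemma closure_line (A : set V) x v (T : R) : 0 < T ->
  (forall s, 0 <= s < T -> A (x + s *: v)) -> closure A (x + T *: v).
Proof.
move=> T0 As B nB.
have : \forall t \near (0 : R), B (x + T *: v + t *: (- v)) by exact: near_line.
move=> /nbhs_ballP[e /= e0 eB].
pose t := Num.min (e / 2) T.
have t0 : 0 < t by rewrite lt_min T0 andbT divr_gt0.
have te : t < e.
  by rewrite gt_min ltr_pdivrMr// ltr_pMr// ltr1n.
have tT : t <= T by rewrite ge_min lexx orbT.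
exists (x + (T - t) *: v); split; first by apply: As; lra.
have := eB t; rewrite -addrA scalerN -scalerBl; apply.
by rewrite -ball_normE /ball_ /= sub0r normrN gtr0_norm.
Qed.

(** If the segment left [Om], its first exit point would lie on the boundary. The hypothesis is
    therefore requested only at times T before which the segment is inside. *)
Lemma ray_stays (Om : set V) x v : open Om -> Om x ->
  (forall T : R, 0 < T <= 1 -> (forall s, 0 <= s < T -> Om (x + s *: v)) ->
     ~ bd Om (x + T *: v)) -> Om (x + v).
Proof.
move=> oOm Ox nbd.
have step (T : R) : 0 <= T <= 1 -> (forall s, 0 <= s < T -> Om (x + s *: v)) ->
    Om (x + T *: v).
  move=> /andP[T0 T1] Os; have [->|Tn] := eqVneq T 0; first by rewrite scale0r addr0.
  have Tp : 0 < T by rewrite lt0r Tn.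
  apply: contrapT => nO; apply: (nbd T) => //; first by rewrite Tp.
  by split; [exact: closure_line|move=> /interior_subset].
pose S := [set t : R | 0 <= t <= 1 /\ forall s, 0 <= s <= t -> Om (x + s *: v)].
have S0 : S 0.
  split; first by rewrite lexx ler01.
  by move=> s; rewrite -eq_le => /eqP <-; rewrite scale0r addr0.
have hsS : has_sup S by split; [exists 0|exists 1 => t [/andP[]]].
pose T := sup S.
have T0 : 0 <= T by apply: sup_ubound => //; case: hsS.
have T1 : T <= 1 by apply: ge_sup; [exists 0|move=> t [/andP[]]].
have OT s : 0 <= s < T -> Om (x + s *: v).
  move=> /andP[s0 sT]; have [t St st] := sup_gt (ex_intro _ 0 S0) sT.
  by apply: St.2; rewrite s0 ltW.
have OmT : Om (x + T *: v) by apply: step => //; rewrite T0.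
have [T1e|T1n] := eqVneq T 1; first by move: OmT; rewrite T1e scale1r.
have T1l : T < 1 by rewrite lt_neqAle T1n.
have : \forall t \near (0 : R), Om (x + T *: v + t *: v).
  by apply: near_line; exact: open_nbhs_nbhs.
move=> /nbhs_ballP[e /= e0 eO].
pose t := Num.min (e / 2) (1 - T).
have t0 : 0 < t by rewrite lt_min subr_gt0 T1l andbT divr_gt0.
have te : t < e by rewrite gt_min ltr_pdivrMr// ltr_pMr// ltr1n.
have tT : t <= 1 - T by rewrite ge_min lexx orbT.
have : S (T + t).
  split; first by lra.
  move=> s /andP[s0 sT]; have [sT'|sT'] := ltP s T; first by apply: OT; rewrite s0.
  have := eO (s - T); rewrite -addrA -scalerDl [T + _]addrC subrK; apply.
  by rewrite -ball_normE /ball_ /= sub0r normrN ger0_norm ?subr_ge0//; lra.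
have ub := sup_ubound hsS.2.
by move=> /ub; rewrite -/T gerDl leNgt t0.
Qed.

(** One mean value step on u, then one on each partial derivative, with second derivatives bounded
    near q. *)
Lemma quadratic_lower_bound (U : set V) (u : V -> R) q : open U -> Ck 2 U u -> U q ->
  exists2 C : R, 0 < C & \forall x \near q,
    dotv (grad u q) (x - q) - C * dotv (x - q) (x - q) <= u x - u q.
Proof.
move=> oU C2 Uq.
have C1 := CkW C2.
pose B i x : R := dotv (grad (partial i u) x) (grad (partial i u) x).
have cB i : {for q, continuous (B i)}.
  have -> : B i = fun x => \sum_j partial j (partial i u) x * partial j (partial i u) x.
    by apply/funext => x; rewrite /B dotvE; apply: eq_bigr => j _; rewrite !mxE.
  apply: for_continuous_sum => j; apply: for_continuous_mul;
    exact: (Ck_continuous (Ck_partial j (Ck_partial i C2)) Uq).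
(* L exceeds every B i q and is at least 1, so L^2 exceeds them as well; L then bounds the rows of
   the Hessian near q. *)
pose L : R := \sum_i (B i q + 1) + 1.
have B0 i x : 0 <= B i x by exact: dotv_ge0.
have L1 : 1 <= L.
  by rewrite lerDr; apply: sumr_ge0 => i _; rewrite addr_ge0.
have nBi i : \forall x \near q, `|grad (partial i u) x| <= L.
  have c : B i @ q --> B i q := cB i.
  have : \forall x \near q, B i x < L ^+ 2.
    apply: (c [set t | t < L ^+ 2]); apply: lt_nbhsl.
    apply: (@lt_le_trans _ _ L); last by rewrite expr2 ler_pMl// (lt_le_trans ltr01).
    rewrite /L (bigD1 i)//=.
    have : 0 <= \sum_(j | j != i) (B j q + 1) by apply: sumr_ge0 => j _; rewrite addr_ge0.
    lra.
  apply: filterS => x Bx; apply: le_trans (norm_le_enorm _) _.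
  rewrite -ler_sqr ?nnegrE ?enorm_ge0 ?(le_trans ler01)// enorm_sqr.
  exact: ltW.
have nB : \forall x \near q, forall i, `|grad (partial i u) x| <= L :=
  filter_forall (nbhs_filter q) nBi.
(* Each factor n comes from one use of [dotv_le_norm]; the added 1 keeps C positive. *)
pose C : R := n%:R * (n%:R * L) + 1.
have nL0 : 0 <= n%:R * L by rewrite mulr_ge0// (le_trans ler01).
have C0 : 0 < C by rewrite ltr_wpDl// mulr_ge0.
exists C => //.
have : \forall x \near q, U x /\ forall i, `|grad (partial i u) x| <= L.
  by apply: filterI => //; exact: open_nbhs_nbhs.
move=> /nbhs_ballP[e /= e0 eP]; apply/nbhs_ballP; exists e => //= x xb.
have inb (t : R) : 0 <= t <= 1 -> ball q e (q + t *: (x - q)).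
  move=> /andP[t0 t1]; rewrite -ball_normE /ball_ /= opprD addrA subrr add0r normrN.
  move: xb; rewrite -ball_normE /ball_ /= distrC; apply: le_lt_trans.
  by rewrite normrZ ger0_norm// ler_piMl.
have [t /andP[t0 t1]] := @mean_value_line _ _ u (fun y => dotv (grad u y) (x - q)) q (x - q)
  (fun t t01 => Ck1_is_derive _ oU C1 (eP _ (inb t t01)).1).
rewrite [q + (x - q)]addrC subrK => ->.
set xi := q + t *: (x - q).
have gd : `|grad u xi - grad u q| <= n%:R * L * `|x - q|.
  apply: norm_le_coord => [|i]; first by rewrite mulr_ge0.
  rewrite !mxE.
  have Ci := Ck_partial i C2.
  have inb' (s : R) : 0 <= s <= 1 -> ball q e (q + s *: (t *: (x - q))).
    move=> /andP[s0 s1]; rewrite scalerA; apply: inb.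
    by rewrite mulr_ge0 ?(ltW t0)//= mulr_ile1// ltW.
  have [s /andP[s0 s1] ->] := @mean_value_line _ _ (partial i u)
    (fun y => dotv (grad (partial i u) y) (t *: (x - q))) q (t *: (x - q))
    (fun s s01 => Ck1_is_derive _ oU Ci (eP _ (inb' s s01)).1).
  have s01 : 0 <= s <= 1 by rewrite !ltW.
  apply: le_trans (dotv_le_norm _ _) _; apply: ler_pM => //.
  - by rewrite ler_wpM2l//; exact: (eP _ (inb' s s01)).2.
  - by rewrite normrZ gtr0_norm// ler_piMl// ltW.
have := dotv_le_norm (grad u xi - grad u q) (x - q).
have h2 : n%:R * `|grad u xi - grad u q| * `|x - q| <= C * dotv (x - q) (x - q).
  apply: le_trans (_ : n%:R * (n%:R * L * `|x - q|) * `|x - q| <= _).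
    by rewrite ler_wpM2r// ler_wpM2l.
  rewrite (_ : _ * `|x - q| = n%:R * (n%:R * L) * `|x - q| ^+ 2); last by ring.
  apply: ler_pM; [exact: mulr_ge0|exact: sqr_ge0|by rewrite lerDl|].
  by rewrite -enorm_sqr ler_sqr ?nnegrE ?enorm_ge0// norm_le_enorm.
rewrite dotvDl dotvNl => /ler_normlP[h1 _].
by move: h1 h2; lra.
Qed.

End Segments.

(** * Mean curvature of the boundary *)

Section BoundaryHopf.
Variables (R : realType) (n : nat) (p kappa : R) (u : 'rV[R]_n -> R).
Variables Om U : set 'rV[R]_n.
Variables F f f' : R -> R.
Local Notation V := 'rV[R]_n.
Implicit Types (x y v w q z : V).
Hypotheses (p1 : 1 < p) (oU : open U) (C3 : Ck 3 U u).
Hypothesis dF : forall s : R, is_derive s 1 F (f s).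
Hypothesis df : forall s : R, is_derive s 1 f (f' s).
Hypotheses (dom : C1_domain Om) (cU : closure Om `<=` U) (k0 : 0 < kappa).
Hypothesis upos : forall x, Om x -> 0 < u x.
Hypothesis u0 : forall q, bd Om q -> u q = 0.
Hypothesis unu : forall q nu, bd Om q -> ext_normal Om q nu ->
  dotv (grad u q) nu = - kappa.
Hypothesis pdeOm : forall x, Om x -> 0 < gsq u x -> pde_at p u f x.

Let oOm : open Om. Proof. by case: dom => _ []. Qed.
Let C1 : Ck 1 U u. Proof. exact: C1u C3. Qed.
Let gq q : bd Om q -> gsq u q = kappa ^+ 2.
Proof. exact: (gsq_bd oU C1 dom cU k0 upos u0 unu). Qed.
Let gq0 q : bd Om q -> 0 < gsq u q.
Proof. by move=> bq; rewrite gq// exprn_gt0. Qed.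

(** The inequality describes the open ball of radius r centred at q + (r / kappa) grad u q, tangent
    to the boundary at q. By the Taylor bound u > 0 on it, so it contains no boundary point; being
    convex and containing points of [Om] on the inward normal, it lies in [Om]. *)
Lemma interior_ball q : bd Om q -> exists2 r : R, 0 < r & forall x,
  kappa * dotv (x - q) (x - q) < 2 * r * dotv (grad u q) (x - q) -> Om x.
Proof.
move=> bq; have Uq : U q := cU bq.1.
have [C C0 nC] := quadratic_lower_bound oU (C2u C3) Uq.
have [rho rho0 hrho] := near_sqdist nC.
(* The first bound keeps the ball, of diameter 2 r, where the Taylor estimate holds; the second
   makes 2 r C <= kappa, so that the linear term dominates. *)
pose r := Num.min (rho / 2) (kappa / (2 * C)).
have r0 : 0 < r by rewrite lt_min !divr_gt0// mulr_gt0.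
have rrho : 2 * r <= rho.
  have : r <= rho / 2 by rewrite ge_min lexx.
  lra.
have rC : 2 * r * C <= kappa.
  have : r <= kappa / (2 * C) by rewrite ge_min lexx orbT.
  rewrite ler_pdivlMr ?mulr_gt0//; lra.
have ek : enorm (grad u q) = kappa.
  by rewrite /enorm -/(gsq u q) gq// sqrtr_sqr gtr0_norm.
have Bpos x : kappa * dotv (x - q) (x - q) < 2 * r * dotv (grad u q) (x - q) -> 0 < u x.
  move=> xB.
  have xr : sqdist q x <= rho ^+ 2.
    rewrite sqdistE ler_sqr ?nnegrE ?enorm_ge0 ?(ltW rho0)//; apply: le_trans rrho.
    have h1 : dotv (grad u q) (x - q) <= kappa * enorm (x - q).
      by rewrite -ek; apply: le_trans (ler_norm _) (dotv_le_enorm _ _).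
    have h2 : kappa * enorm (x - q) ^+ 2 < 2 * r * (kappa * enorm (x - q)).
      rewrite enorm_sqr; apply: lt_le_trans xB _.
      by rewrite ler_pM2l// mulr_gt0.
    have e0 : 0 < enorm (x - q).
      rewrite lt0r enorm_ge0 andbT; apply/eqP => e0.
      by move: h2; rewrite e0 expr0n/= !mulr0 ltxx.
    move: h2; rewrite (_ : 2 * r * _ = kappa * (2 * r * enorm (x - q))); last by ring.
    by rewrite ltr_pM2l// expr2 ltr_pM2r// => /ltW.
  have := hrho x xr; rewrite (u0 bq) subr0; apply: lt_le_trans.
  rewrite subr_gt0 -(ltr_pM2l (mulr_gt0 (ltr0n R 2) r0)); apply: le_lt_trans xB.
  by rewrite mulrA ler_wpM2r ?dotv_ge0.
exists r => // x xB.
have gg : dotv (grad u q) (grad u q) = kappa ^+ 2 by rewrite -/(gsq u q) gq.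
have ing : \forall t \near (0 : R), 0 < t -> Om (q + t *: grad u q).
  apply: (inward_grad oU C1 dom cU k0 upos u0 unu bq).
  by rewrite gg exprn_gt0.
have nk := near0_normM_lt (ltW k0) r0.
have : \forall t \near (0 : R), (0 < t -> Om (q + t *: grad u q)) /\ `|t| * kappa < r.
  exact: filterI.
move=> /nbhs_ballP[e /= e0 eP].
have e20 : 0 < e / 2 by rewrite divr_gt0.
have [|/(_ e20) Ox' ek2] := eP (e / 2).
  by rewrite -ball_normE /ball_ /= sub0r normrN gtr0_norm// ltr_pdivrMr// ltr_pMr// ltr1n.
rewrite gtr0_norm// in ek2.
set t := e / 2 in e20 Ox' ek2; pose x' := q + t *: grad u q.
suff : Om (x' + (x - x')) by rewrite addrC subrK.
apply: ray_stays => // T /andP[T0 T1] _ bT.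
suff : 0 < u (x' + T *: (x - x')) by rewrite u0// ltxx.
apply: Bpos.
have -> : x' + T *: (x - x') - q = (1 - T) *: (t *: grad u q) + T *: (x - q).
  rewrite /x'; apply/rowP => i; rewrite !mxE; ring.
move: (x - q) xB => W xB.
rewrite !(dotvDl, dotvDr, dotvZl, dotvZr) gg (dotvC W).
(* Convexity of the ball: on the segment, kappa times the squared distance to q is the convex
   combination of its end values minus kappa T (1 - T) |t grad u - W|^2. *)
have sq0 : 0 <= t ^+ 2 * kappa ^+ 2 - 2 * t * dotv (grad u q) W + dotv W W.
  have := dotv_ge0 (t *: grad u q - W).
  rewrite !(dotvDl, dotvDr, dotvZl, dotvZr, dotvNl, dotvNr) gg (dotvC W); lra.
move: (dotv W W) (dotv (grad u q) W) xB sq0 => X G xB sq0.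
have Z0 : kappa * (t ^+ 2 * kappa ^+ 2) < 2 * r * (t * kappa ^+ 2).
  rewrite (_ : kappa * _ = t * kappa * (t * kappa ^+ 2)); last by ring.
  rewrite ltr_pM2r; last by rewrite mulr_gt0// exprn_gt0.
  lra.
have TT : 0 <= kappa * (T * (1 - T) * (t ^+ 2 * kappa ^+ 2 - 2 * t * G + X)).
  apply: mulr_ge0; first exact: ltW.
  by apply: mulr_ge0 => //; apply: mulr_ge0; [exact: ltW|rewrite subr_ge0].
have Z1 : T * (kappa * X) < T * (2 * r * G) by rewrite ltr_pM2l.
have Z2 : (1 - T) * (kappa * (t ^+ 2 * kappa ^+ 2)) <= (1 - T) * (2 * r * (t * kappa ^+ 2)).
  by apply: ler_wpM2l; [rewrite subr_ge0|exact: ltW].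
lra.
Qed.

(** Shrinking the radius of the tangent ball puts its closure, except q, inside [Om], and near
    enough to q for grad u not to vanish. The direction from q to the centre is a positive multiple
    of grad u q. *)
Lemma boundary_hopf q : bd Om q ->
  (forall x, Om x -> Pf p u F x < Pf p u F q) ->
  dotv (grad u q) (gradP p u f q) < 0.
Proof.
move=> bq Plt; have Uq : U q := cU bq.1.
have [r r0 rP] := interior_ball bq.
have [rho rho0 hrho] : exists2 rho : R, 0 < rho &
    forall x, sqdist q x <= rho ^+ 2 -> U x /\ 0 < gsq u x.
  apply: near_sqdist; apply: filterI; first exact: open_nbhs_nbhs.
  exact: (near_gsq_gt0 oU C3 Uq (gq0 bq)).
pose r' := Num.min (r / 2) (rho / 2).
have r'0 : 0 < r' by rewrite lt_min !divr_gt0.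
have r'r : r' < r.
  have : r' <= r / 2 by rewrite ge_min lexx.
  lra.
have r'rho : 2 * r' <= rho.
  have : r' <= rho / 2 by rewrite ge_min lexx orbT.
  lra.
have kN : kappa != 0 by exact: lt0r_neq0.
have gg : dotv (grad u q) (grad u q) = kappa ^+ 2 by rewrite -/(gsq u q) gq.
pose y := q + (r' / kappa) *: grad u q.
have sE x : kappa * (sqdist y x - r' ^+ 2) =
    kappa * dotv (x - q) (x - q) - 2 * r' * dotv (grad u q) (x - q).
  rewrite /sqdist (_ : x - y = x - q - (r' / kappa) *: grad u q); last first.
    by rewrite /y opprD addrA.
  move: (x - q) => W.
  rewrite !(dotvDl, dotvDr, dotvZl, dotvZr, dotvNl, dotvNr) gg (dotvC W).
  by field.
have inB x : sqdist y x <= r' ^+ 2 -> x = q \/ Om x.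
  move=> xr; have [->|xq] := eqVneq x q; [by left|right; apply: rP].
  have X0 : 0 < dotv (x - q) (x - q) by rewrite dotv_gt0 subr_eq0.
  have h : kappa * dotv (x - q) (x - q) <= 2 * r' * dotv (grad u q) (x - q).
    by rewrite -subr_le0 -sE pmulr_rle0// subr_le0.
  have G0 : 0 < dotv (grad u q) (x - q).
    rewrite -(pmulr_rgt0 _ (mulr_gt0 (ltr0n R 2) r'0)).
    by apply: lt_le_trans h; rewrite mulr_gt0.
  by apply: le_lt_trans h _; rewrite ltr_pM2r// ltr_pM2l.
have qy : sqdist y q = r' ^+ 2.
  apply/eqP; rewrite -subr_eq0.
  have := sE q; rewrite subrr !dotv0r !mulr0 subrr => /eqP.
  by rewrite mulf_eq0 (negbTE kN).
have inrho x : sqdist y x <= r' ^+ 2 -> sqdist q x <= rho ^+ 2.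
  rewrite !sqdistE !ler_sqr ?nnegrE ?enorm_ge0 ?(ltW r'0) ?(ltW rho0)// => xr.
  have yq : enorm (y - q) = r'.
    rewrite -enormN opprB; apply/eqP; rewrite -(eqrXn2 (n := 2)) ?enorm_ge0 ?(ltW r'0)//.
    by rewrite -sqdistE qy.
  rewrite -(subrK y x) -addrA; apply: le_trans (enorm_triangle _ _) _.
  by rewrite yq; apply: le_trans (lerD xr (lexx _)) _; lra.
have := @hopf_Pf _ n p u Om U F f f' p1 oU C3 dF df _ (Pf p u F q) y q r' r'0 qy erefl.
have -> : y - q = (r' / kappa) *: grad u q by rewrite /y addrC addKr.
rewrite dotvZr pmulr_rlt0 ?divr_gt0// dotvC; apply.
- move=> x Ox sx; near=> z; apply: pdeOm; near: z; first exact: open_nbhs_nbhs.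
  exact: (near_gsq_gt0 oU C3 (cU (subset_closure Ox)) sx).
- move=> x xr; have [Ux sx] := hrho x (inrho x xr); split => //.
  by case: (inB x xr) => [->//|Ox]; exact/ltW/Plt.
- move=> x xr; case: (inB x (ltW xr)) => [xq|Ox]; last by split => //; exact: Plt.
  by exfalso; move: xr; rewrite xq qy ltxx.
Unshelve. all: by end_near. Qed.

End BoundaryHopf.

Section MeanCurvature.
Variables (R : realType) (n : nat) (p kappa : R) (u : 'rV[R]_n -> R).
Variables Om U : set 'rV[R]_n.
Variables f f' : R -> R.
Local Notation V := 'rV[R]_n.
Implicit Types (x y v w q z : V).
Hypotheses (p1 : 1 < p) (oU : open U) (C3 : Ck 3 U u).
Hypothesis df : forall s : R, is_derive s 1 f (f' s).
Hypotheses (dom : C1_domain Om) (cU : closure Om `<=` U) (k0 : 0 < kappa).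
Hypothesis upos : forall x, Om x -> 0 < u x.
Hypothesis u0 : forall q, bd Om q -> u q = 0.
Hypothesis unu : forall q nu, bd Om q -> ext_normal Om q nu ->
  dotv (grad u q) nu = - kappa.
Hypothesis pdeOm : forall x, Om x -> 0 < gsq u x -> pde_at p u f x.

Let C1 : Ck 1 U u. Proof. exact: C1u C3. Qed.

(** At exponent 1 the field of the p-Laplacian is the normalised gradient. The unit normal and its
    derivatives are thus covered by the lemmas on [plap_field] and [sigma]. *)
Lemma plap_field1 x : 0 < gsq u x ->
  plap_field 1 u x = (enorm (grad u x))^-1 *: grad u x.
Proof.
move=> s0; rewrite /plap_field (_ : 1 - 2 = -1); last by ring.
by rewrite powR_inv1// enorm_ge0.
Qed.

Definition dnormal (j i : 'I_n) x : R := - 1 *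
  ((1 - 2) * sigma 1 u x / gsq u x * (grad u x *m hess u x) 0 i * partial j u x
   + sigma 1 u x * hess u x j i).

Lemma is_derive_normal j i x : U x -> 0 < gsq u x ->
  is_derive x (evec i) (fun y => (- plap_field 1 u y) 0 j) (dnormal j i x).
Proof.
move=> Ux s0.
have -> : (fun y => (- plap_field 1 u y) 0 j) = fun y => - 1 * (sigma 1 u y * partial j u y).
  by apply/funext => y; rewrite [in LHS]mxE plap_fieldE mulN1r.
apply: is_derive_scale.
apply: is_derive_eq (is_derive_mul (is_derive_sigma 1 oU C3 (evec i) Ux s0)
  (Ck1_is_derive (evec i) oU (C1p C3 j) Ux)) _.
by rewrite !dotv_evec [grad _ x 0 i]mxE [hess u x j i]mxE.
Qed.

Lemma continuous_dnormal j i x : U x -> 0 < gsq u x -> {for x, continuous (dnormal j i)}.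
Proof.
move=> Ux s0.
have cs := @continuous_sigma _ _ 1 _ _ oU C3 _ Ux s0.
have cg := continuous_gsq oU C3 Ux.
have cp k : {for x, continuous (partial k u)} := Ck_continuous (C1p C3 k) Ux.
have cH a b : {for x, continuous (fun y => hess u y a b)}.
  have -> : (fun y => hess u y a b) = partial b (partial a u).
    by apply/funext => y; rewrite mxE.
  exact: Ck_continuous (C1pp C3 a b) Ux.
have cgH : {for x, continuous (fun y => (grad u y *m hess u y) 0 i)}.
  have -> : (fun y => (grad u y *m hess u y) 0 i) =
      fun y => \sum_k partial k u y * hess u y k i.
    by apply/funext => y; rewrite mxE; apply: eq_bigr => k _; rewrite mxE.
  by apply: for_continuous_sum => k; apply: for_continuous_mul; [exact: cp|exact: cH].
have cst c : {for x, continuous (fun=> c : R)} by exact: (@cst_continuous _ _ c x).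
have cgi : {for x, continuous (fun y => (gsq u y)^-1)}.
  by apply: (continuousV _ cg); rewrite gt_eqF.
apply: for_continuous_mul (cst _) _; apply: for_continuous_add.
  exact: (for_continuous_mul (for_continuous_mul (for_continuous_mul
    (for_continuous_mul (cst _) cs) cgi) cgH) (cp j)).
exact: (for_continuous_mul cs (cH j i)).
Qed.

(** The exterior normal extends to - grad u / |grad u|, whose divergence is a positive multiple of
    gHg - |grad u|^2 tr(Hess u). Multiplied by sigma and rewritten with the equation, which holds at
    q by [pde_closure], this is exactly grad u . grad P. *)
Lemma mean_curvature_lt0 q : (2 <= n)%N -> bd Om q ->
  dotv (grad u q) (gradP p u f q) < 0 ->
  exists h, mean_curvature Om q h /\ h < 0.
Proof.
move=> n2 bq gP; have Uq : U q := cU bq.1.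
have gqE x : bd Om x -> gsq u x = kappa ^+ 2.
  exact: (gsq_bd oU C1 dom cU k0 upos u0 unu).
have sq : 0 < gsq u q by rewrite gqE// exprn_gt0.
have : \forall x \near q, U x /\ 0 < gsq u x.
  by apply: filterI; [exact: open_nbhs_nbhs|exact: (near_gsq_gt0 oU C3 Uq sq)].
move=> /nbhs_ballP[r /= r0 rP].
have ob : open (ball q r) by exact: ball_open.
exists (divergence (fun x => - plap_field 1 u x) q / (n.-1)%:R); split.
  exists r, (fun x => - plap_field 1 u x); split => //; split; [|split; [|split => //]].
  - move=> j; apply: (@Ck1_intro _ _ _ _ (dnormal j) ob _ _ _).1.
    + move=> x /rP[Ux sx].
      have -> : (fun y => (- plap_field 1 u y) 0 j) =
          fun y => - 1 * (sigma 1 u y * partial j u y).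
        by apply/funext => y; rewrite [in LHS]mxE plap_fieldE mulN1r.
      have cst c : {for x, continuous (fun=> c : R)} by exact: (@cst_continuous _ _ c x).
      apply: for_continuous_mul (cst _) _; apply: for_continuous_mul.
        exact: (@continuous_sigma _ _ 1 _ _ oU C3 _ Ux sx).
      exact: Ck_continuous (C1p C3 j) Ux.
    + by move=> i x /rP[Ux sx]; exact: is_derive_normal.
    + by move=> i x /rP[Ux sx]; exact: continuous_dnormal.
  - move=> x /rP[Ux sx]; rewrite plap_field1// -scaleNr /enorm dotvZl dotvZr mulrA mulrNN.
    have e0 : 0 < Num.sqrt (dotv (grad u x) (grad u x)) by rewrite sqrtr_gt0.
    rewrite -[X in _ * X](sqr_sqrtr (dotv_ge0 _)).
    rewrite (_ : _ * _ = 1) ?sqrtr1//.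
    by field; exact: lt0r_neq0.
  - move=> x /rP[Ux sx] bx; rewrite plap_field1// -scaleNr.
    exact: (ext_normal_grad oU C1 dom cU k0 upos u0 unu).
rewrite pmulr_llt0; last by rewrite invr_gt0 ltr0n -ltnS prednK// ltnW.
have s0' : gsq u q != 0 by rewrite gt_eqF.
have -> : divergence (fun x => - plap_field 1 u x) q =
    sigma 1 u q / gsq u q * (gHg u q - gsq u q * \tr (hess u q)).
  rewrite /divergence (eq_bigr (fun i => (sigma 1 u q / gsq u q) *
     ((grad u q *m hess u q) 0 i * grad u q 0 i) + - sigma 1 u q * hess u q i i)).
    by rewrite big_split/= -!mulr_sumr -dotvE -/(bil _ _ _) -/(gHg u q) -/(mxtrace _); field.
  move=> i _; apply: partial_deriv; apply: is_derive_eq (is_derive_normal i i Uq sq) _.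
  by rewrite /dnormal [grad u q 0 i]mxE; ring.
rewrite pmulr_rlt0 ?divr_gt0 ?sigma_gt0// -(pmulr_rlt0 _ (sigma_gt0 p sq)).
have pd : pde_at p u f q := pde_closure oU C3 df bq.1 Uq sq pdeOm.
move: gP pd; rewrite gradP_dot /pde_at; lra.
Qed.

End MeanCurvature.

(** * The equality case *)

Section FlatPotential.
Variables (R : realType) (p : R) (F f f' : R -> R).
Hypothesis p1 : 1 < p.
Hypothesis dF : forall s : R, is_derive s 1 F (f s).
Hypothesis df : forall s : R, is_derive s 1 f (f' s).
Hypotheses (cf' : continuous f') (Fle0 : forall s, F s <= 0).
Hypothesis F2 : 2 < p -> forall u0, F u0 = 0 ->
  exists C delta, 0 < delta /\ forall s, `|s - u0| < delta -> `|F s| <= C * `|s - u0| `^ p.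

Lemma mean_value_1d (h h' : R -> R) (a b : R) : (forall s : R, is_derive s 1 h (h' s)) ->
  exists2 c : R, `|c - a| <= `|b - a| & h b - h a = h' c * (b - a).
Proof.
move=> dh.
have dv (t v : R) : is_derive (t : R) v h (v * h' t).
  by have := is_deriveZdir v (dh t); rewrite [_%:A]mulr1.
have [t /andP[t0 t1]] := @mean_value_line _ _ h (fun s => (b - a) * h' s) a (b - a)
  (fun t _ => dv _ _).
rewrite (addrC a) subrK => e; exists (a + t *: (b - a)).
  by rewrite addrC addKr normrZ gtr0_norm// ler_piMl// ltW.
by rewrite e mulrC.
Qed.

(** For p <= 2 no growth assumption is available. There u0 is a maximum of F, so f u0 = 0, and local
    boundedness of f' gives |F s| <= L |s - u0|^2. *)
Lemma F_flat (u0 : R) : F u0 = 0 -> exists C delta, [/\ 0 < delta, 0 <= C &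
  forall s, `|s - u0| < delta -> `|F s| <= C * `|s - u0| `^ p].
Proof.
move=> Fu; have [p2|p2] := ltP 2 p.
  have [C [delta [d0 hF]]] := F2 p2 Fu.
  exists `|C|, delta; split => // s sd; apply: le_trans (hF s sd) _.
  by apply: ler_wpM2r; [exact: powR_ge0|exact: ler_norm].
have f0 : f u0 = 0.
  have g1 : 0 <= - 1 * f u0.
    apply: (is_derive_ge0_right (is_derive_scale (- 1) (dF u0))).
    by apply: filterE => t _; rewrite Fu mulr0 mulN1r oppr_ge0 Fle0.
  have g2 : 0 <= - 1 * (- 1 * f u0).
    apply: (is_derive_ge0_right (is_derive_scale (- 1) (is_deriveZdir (- 1) (dF u0)))).
    by apply: filterE => t _; rewrite Fu mulr0 mulN1r oppr_ge0 Fle0.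
  lra.
pose L := `|f' u0| + 1.
have L0 : 0 <= L by rewrite addr_ge0.
have : \forall s \near u0, `|f' u0 - f' s| < 1.
  by have /cvgrPdist_lt/(_ _ ltr01) := @cf' u0.
move=> /nbhs_ballP[e /= e0 eP].
have fL s : `|s - u0| < e -> `|f' s| <= L.
  move=> se; have : `|f' u0 - f' s| < 1.
    by apply: eP; rewrite -ball_normE /ball_ /= distrC.
  move=> h; rewrite /L -[f' s](subrK (f' u0)) addrC; apply: le_trans (ler_normD _ _) _.
  by rewrite lerD2l distrC ltW.
(* The bound 1 makes |s - u0|^2 <= |s - u0|^p when p <= 2. *)
exists L, (Num.min e 1); split => //; first by rewrite lt_min e0/=.
move=> s; rewrite lt_min => /andP[se s1].
have [c1 c1s] := mean_value_1d u0 s dF; rewrite Fu subr0 => ->.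
have [c2 c2s] := mean_value_1d u0 c1 df; rewrite f0 subr0 => ->.
rewrite !normrM -mulrA; apply: ler_pM => //.
  by apply: fL; apply: le_lt_trans c2s (le_lt_trans c1s se).
apply: (@le_trans _ _ (`|s - u0| `^ 2%:R)).
  by rewrite powR_mulrn// expr2 ler_wpM2r.
have [->|sn] := eqVneq s u0.
  by rewrite subrr normr0 !powR0// gt_eqF// (lt_trans ltr01).
by apply: ger_powR => //; rewrite normr_gt0 subr_eq0 sn ltW.
Qed.

End FlatPotential.

Section FlatCase.
Variables (R : realType) (n : nat) (p : R) (u : 'rV[R]_n -> R).
Variables Om U : set 'rV[R]_n.
Variables F f f' : R -> R.
Local Notation V := 'rV[R]_n.
Implicit Types (x y v w q z : V).
Hypotheses (p1 : 1 < p) (oU : open U) (C3 : Ck 3 U u).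
Hypothesis dF : forall s : R, is_derive s 1 F (f s).
Hypothesis df : forall s : R, is_derive s 1 f (f' s).
Hypotheses (oOm : open Om) (cOm : connected Om) (cU : closure Om `<=` U).
Hypothesis upos : forall x, Om x -> 0 < u x.
Hypothesis u0 : forall q, bd Om q -> u q = 0.
Hypothesis npde : forall x, Om x -> 0 < gsq u x -> \forall y \near x, pde_at p u f y.
Hypothesis Fle0 : forall s, F s <= 0.
Hypothesis Fflat : forall u0 : R, F u0 = 0 -> exists C delta, [/\ 0 < delta, 0 <= C &
  forall s, `|s - u0| < delta -> `|F s| <= C * `|s - u0| `^ p].
Variable P0 : R.
Hypotheses (P0ge : 0 <= P0) (PleP0 : forall x, Om x -> Pf p u F x <= P0).
Variable q : V.
Hypothesis bq : bd Om q.

Let OmU x : Om x -> U x. Proof. by move=> /subset_closure/cU. Qed.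

(** At a critical point P0 = F(u x) <= 0 <= P0, so both vanish. Then P <= 0 together with the
    flatness of F at u x gives |grad u| <= D |u - u x| near every point of that level set, u is
    constant on [Om] by [gronwall_zero], and the boundary point q contradicts u > 0. *)
Lemma gsq_gt0_at_max x : Om x -> Pf p u F x = P0 -> 0 < gsq u x.
Proof.
move=> Ox Px; rewrite lt0r gsq_ge0 andbT; apply/eqP => s0.
have p0 : 0 < p by apply: lt_trans p1.
have p10 : 0 < p - 1 by rewrite subr_gt0.
have PF : P0 = F (u x).
  by rewrite -Px /Pf s0 powR0 ?mulr0 ?add0r// gt_eqF// divr_gt0.
have F0 : F (u x) = 0 by apply/eqP; rewrite eq_le Fle0 -PF P0ge.
have P00 : P0 = 0 by rewrite PF.
have [C [delta [d0 C0 hF]]] := Fflat F0.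
have dh i y : Om y -> is_derive y (evec i) (fun y => u y - u x) (partial i u y).
  move=> Oy; rewrite -[X in is_derive _ _ _ X]addr0.
  have d0' : is_derive y (evec i) (cst (- u x)) 0 by exact: is_derive_cst.
  exact: (is_derive_add (derivableP (((C1u C3).2 i).1 y (OmU Oy))) d0').
have ch y : Om y -> {for y, continuous (fun y => u y - u x)}.
  move=> Oy; apply: for_continuous_add; last exact: (@cst_continuous _ _ _ y).
  exact: (continuous_u C3 (OmU Oy)).
have [C1h ph] := @Ck1_intro _ _ Om (fun y => u y - u x) (fun i => partial i u) oOm ch dh
  (fun i y Oy => Ck_continuous (C1p C3 i) (OmU Oy)).
have hx : u x - u x = 0 by rewrite subrr.
have uc := @gronwall_zero _ n Om (fun y => u y - u x) x oOm cOm C1h Ox hx.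
suff H : forall y, Om y -> u y - u x = 0.
  have : u q - u x = 0.
    apply: (@closure_eq0_for _ _ Om (fun y => u y - u x) q bq.1).
      apply: for_continuous_add; last exact: (@cst_continuous _ _ _ q).
      exact: (continuous_u C3 (cU bq.1)).
    by apply: filterE => y; exact: H.
  by rewrite (u0 bq) sub0r => /eqP; rewrite oppr_eq0 gt_eqF// upos.
apply: uc => y Oy hy.
have uyx : u y = u x by apply/eqP; rewrite -subr_eq0 hy.
(* D is what remains of (p - 1)/p |grad u|^p <= C |u - u x|^p after taking p-th roots; the factor n
   is that of [dotv_le_norm]. *)
pose D := (C * p / (p - 1)) `^ p^-1.
exists (n%:R * D); split; first by rewrite mulr_ge0 ?powR_ge0.
have nu : \forall z \near y, `|u z - u x| < delta.
  have /cvgrPdist_lt/(_ _ d0) := continuous_u C3 (OmU Oy).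
  by apply: filterS => z; rewrite uyx distrC.
have nO : \forall z \near y, Om z by exact: open_nbhs_nbhs.
apply: filterS2 nu nO => z uz Oz v.
have -> : grad (fun y => u y - u x) z = grad u z.
  by apply/rowP => i; rewrite !mxE ph.
apply: le_trans (dotv_le_norm _ _) _; apply: ler_wpM2r => //.
rewrite -mulrA; apply: ler_wpM2l => //; apply: le_trans (norm_le_enorm _) _.
have := PleP0 Oz; rewrite P00 /Pf => hP.
have hFz := hF _ uz; rewrite ler0_norm// in hFz.
have h1 : gsq u z `^ (p / 2) <= C * p / (p - 1) * `|u z - u x| `^ p.
  have h2 : (p - 1) / p * gsq u z `^ (p / 2) <= C * `|u z - u x| `^ p by lra.
  have h3 : p / (p - 1) * ((p - 1) / p * gsq u z `^ (p / 2)) <=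
      p / (p - 1) * (C * `|u z - u x| `^ p).
    by apply: ler_wpM2l => //; rewrite divr_ge0// ltW.
  move: h3; rewrite mulrA (_ : p / (p - 1) * ((p - 1) / p) = 1) ?mul1r; last first.
    by field; rewrite ?(lt0r_neq0 p0) ?(lt0r_neq0 p10).
  by rewrite (_ : p / (p - 1) * _ = C * p / (p - 1) * `|u z - u x| `^ p)//; ring.
have Cp0 : 0 <= C * p / (p - 1) by rewrite divr_ge0 ?mulr_ge0// ltW.
have -> : enorm (grad u z) = (gsq u z `^ (p / 2)) `^ p^-1.
  rewrite -powRrM (_ : p / 2 * p^-1 = 2^-1); last by field; exact: lt0r_neq0.
  by rewrite powR12_sqrt ?gsq_ge0.
have -> : D * `|u z - u x| = (C * p / (p - 1) * `|u z - u x| `^ p) `^ p^-1.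
  rewrite powRM ?powR_ge0// -powRrM mulfV ?lt0r_neq0// powRr1//.
apply: ge0_ler_powR => //; rewrite ?nnegrE ?powR_ge0 ?invr_ge0 ?(ltW p0)//.
by apply: mulr_ge0 => //; exact: powR_ge0.
Qed.

(** [gsq_gt0_at_max] excludes critical points from the set where P = P0, so [strong_max] applies at
    each of its points and makes it open. *)
Lemma Pf_const z : Om z -> Pf p u F z = P0 -> forall x, Om x -> Pf p u F x = P0.
Proof.
move=> Oz Pz.
suff H x : Om x -> (Om `&` [set x | Pf p u F x = P0]) x by move=> x /H[].
move: x; apply: (connected_open_closed cOm); [by exists z|by move=> y []| |].
- move=> x [Ox Px].
  have nO : \forall y \near x, Om y by exact: open_nbhs_nbhs.
  have nP := strong_max p1 oU C3 dF df oOm (fun x => @OmU x) npde PleP0 Ox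
    (gsq_gt0_at_max Ox Px) Px.
  by apply: filterS2 nO nP => y.
- move=> x Ox cx; split => //=; apply/eqP; rewrite -subr_eq0; apply/eqP.
  apply: (@closure_eq0_for _ _ _ (fun x => Pf p u F x - P0) x cx).
    apply: for_continuous_add; last exact: (@cst_continuous _ _ _ x).
    exact: (continuous_Pf p1 oU C3 dF (OmU Ox)).
  by apply: filterE => y [_ /= ->]; rewrite subrr.
Qed.

Hypothesis Pcst : forall x, Om x -> Pf p u F x = P0.

Let gs0 x : Om x -> 0 < gsq u x.
Proof. by move=> Ox; apply: gsq_gt0_at_max => //; exact: Pcst. Qed.

(** For constant P the left side of [ptr_hessP] vanishes; both nonnegative terms on the right are
    then 0, and so is the distance of Hess u from rank one. *)
Lemma hess_rank_one x i j : Om x ->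
  hess u x i j = gHg u x / gsq u x ^+ 2 * (grad u x 0 i * grad u x 0 j).
Proof.
move=> Ox; have s0 := gs0 Ox; have Ux := OmU Ox.
have nc : \forall y \near x, Pf p u F y = Pf p u F x.
  have nO : \forall y \near x, Om y by exact: open_nbhs_nbhs.
  by apply: filterS nO => y Oy; rewrite !Pcst.
have [G0 M0] := D2_cst_near (D2_Pf p1 oU C3 dF df Ux s0) nc.
have g0 : grad u x != 0 by rewrite -dotv_gt0.
have := ptr_hessP p1 oU C3 df Ux s0 (npde Ox s0).
have sg0 := sigma_gt0 p s0.
have p10 : 0 < p - 1 by rewrite subr_gt0.
have -> : ptr p (grad u x) (hessP p u f f' x) = 0.
  apply/eqP; rewrite eq_le ptr_le0//=; last by move=> v; rewrite M0.
  have := @ptr_le0 _ _ p (grad u x) (-1 *: hessP p u f f' x) p1 g0.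
  rewrite ptrZ mulN1r oppr_le0; apply => v.
  by rewrite bilZm M0 mulr0.
rewrite G0 dotv0r mulr0 addr0 => /esym E.
have h1 : 0 <= (p - 1) / sigma p u x *
    ((p - 1) * sigma p u x * (gHg u x / gsq u x) + f (u x)) ^+ 2.
  by apply: mulr_ge0; [rewrite divr_ge0// ltW|exact: sqr_ge0].
have h2 := hesssq_ge s0.
have ps0 : 0 < (p - 1) * sigma p u x by rewrite mulr_gt0.
have h3 : hesssq u x - gHg u x ^+ 2 / gsq u x ^+ 2 = 0.
  apply/eqP; rewrite eq_le h2 andbT -(pmulr_rle0 _ ps0); lra.
move: h3; rewrite hesssq_rank1// => /eqP.
rewrite psumr_eq0; last by move=> a _; apply: sumr_ge0 => b _; exact: sqr_ge0.
move=> /allP/(_ i); rewrite mem_index_enum => /(_ isT).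
rewrite /= psumr_eq0; last by move=> b _; exact: sqr_ge0.
move=> /allP/(_ j); rewrite mem_index_enum => /(_ isT).
by rewrite /= sqrf_eq0 subr_eq0 => /eqP.
Qed.

(** With a rank one Hessian, the derivative of tau . grad u along v is (gHg / |g|^4) (g . v) (tau .
    g), with g = grad u: a linear homogeneous equation, to which [gronwall_zero] applies. *)
Lemma grad_perp z tau : Om z -> dotv tau (grad u z) = 0 ->
  forall x, Om x -> dotv tau (grad u x) = 0.
Proof.
move=> Oz tz.
have hE : (fun x => dotv tau (grad u x)) = fun x => \sum_k tau 0 k * partial k u x.
  by apply/funext => x; rewrite dotvE; apply: eq_bigr => k _; rewrite [grad u x 0 k]mxE.
pose d i x := \sum_k tau 0 k * partial i (partial k u) x.
have cst (c : R) x : {for x, continuous (fun=> c : R)} by exact: (@cst_continuous _ _ c x).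
have ch x : Om x -> {for x, continuous (fun x => dotv tau (grad u x))}.
  move=> Ox; rewrite hE; apply: for_continuous_sum => k.
  exact: (for_continuous_mul (cst _ _) (Ck_continuous (C1p C3 k) (OmU Ox))).
have dh i x : Om x -> is_derive x (evec i) (fun x => dotv tau (grad u x)) (d i x).
  move=> Ox; rewrite hE; apply: is_derive_bigsum => k; apply: is_derive_scale.
  by apply: derivableP; apply: ((C1p C3 k).2 i).1; exact: OmU.
have cd i x : Om x -> {for x, continuous (d i)}.
  move=> Ox; apply: for_continuous_sum => k.
  exact: (for_continuous_mul (cst _ _) (Ck_continuous (C1pp C3 k i) (OmU Ox))).
have [C1h ph] := Ck1_intro oOm ch dh cd.
apply: (gronwall_zero oOm cOm C1h Oz tz) => x Ox _.
(* A majorant of n |gHg| / |g|^3 free of absolute values and roots, by |a| <= a^2 + 1 and |g| <= 1 +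
   |g|^2; its continuity is then immediate. *)
pose K x := ((gHg u x / gsq u x ^+ 2) * (gHg u x / gsq u x ^+ 2) + 1) * (n%:R * (1 + gsq u x)).
have cK : {for x, continuous K}.
  have cg := continuous_gsq oU C3 (OmU Ox); have cq := continuous_gHg C3 (OmU Ox).
  have cr : {for x, continuous (fun x => gHg u x / gsq u x ^+ 2)}.
    apply: for_continuous_mul => //.
    have c2 := for_continuous_mul cg cg.
    have -> : (fun x => (gsq u x ^+ 2)^-1) = (fun x => (gsq u x * gsq u x)^-1).
      by apply/funext => y; rewrite expr2.
    by apply: (continuousV _ c2); rewrite mulf_neq0// gt_eqF// gs0.
  exact: (for_continuous_mul (for_continuous_add (for_continuous_mul cr cr) (cst _ _))
    (for_continuous_mul (cst _ _) (for_continuous_add (cst _ _) cg))).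
have K0 y : 0 <= K y.
  apply: mulr_ge0; first by rewrite addr_ge0// -expr2 sqr_ge0.
  by apply: mulr_ge0 => //; rewrite addr_ge0// gsq_ge0.
exists (K x + 1); split; first by rewrite addr_ge0.
have nK : \forall y \near x, K y < K x + 1.
  have c : K @ x --> K x := cK.
  by apply: (c [set t | t < K x + 1]); apply: lt_nbhsl; rewrite ltrDl.
have nO : \forall y \near x, Om y by exact: open_nbhs_nbhs.
apply: filterS2 nK nO => y Ky Oy v.
have -> : dotv (grad (fun x => dotv tau (grad u x)) y) v =
    gHg u y / gsq u y ^+ 2 * dotv (grad u y) v * dotv tau (grad u y).
  rewrite dotvE [X in _ = _ * X * _]dotvE mulr_sumr mulr_suml; apply: eq_bigr => i _.
  rewrite [grad _ y 0 i]mxE ph// /d dotvE mulr_suml mulr_sumr; apply: eq_bigr => k _.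
  have := hess_rank_one k i Oy; rewrite [LHS]mxE => ->; ring.
have e1 : enorm (grad u y) <= 1 + gsq u y.
  have := sqr_ge0 (enorm (grad u y) - 1); rewrite sqrrB1 enorm_sqr -/(gsq u y) -mulr_natr.
  have := enorm_ge0 (grad u y); lra.
have e2 : `|dotv (grad u y) v| <= n%:R * (1 + gsq u y) * `|v|.
  apply: le_trans (dotv_le_norm _ _) _; apply: ler_wpM2r => //; apply: ler_wpM2l => //.
  exact: le_trans (norm_le_enorm _) e1.
have e3 (a : R) : `|a| <= a * a + 1.
  have := sqr_ge0 (`|a| - 1); rewrite sqrrB1 real_normK ?num_real// expr2 -mulr_natr.
  have := normr_ge0 a; lra.
rewrite normrM [leRHS]mulrAC; apply: ler_wpM2r => //.
apply: (@le_trans _ _ (K y * `|v|)); last by apply: ler_wpM2r => //; exact: ltW.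
rewrite normrM /K -[leRHS]mulrA; apply: ler_pM => //; exact: e3.
Qed.

(** The part of grad u orthogonal to a = grad u z is 0 by [grad_perp]. The remaining coefficient
    never vanishes, since grad u does not, so connectedness keeps it positive. *)
Lemma grad_parallel z x : Om z -> Om x -> exists2 c : R, 0 < c & grad u x = c *: grad u z.
Proof.
move=> Oz; set a := grad u z.
have a0 : 0 < dotv a a by exact: (gs0 Oz).
have par y : Om y -> grad u y = (dotv (grad u y) a / dotv a a) *: a.
  move=> Oy; pose tau := grad u y - (dotv (grad u y) a / dotv a a) *: a.
  have ta : dotv tau a = 0.
    by rewrite /tau dotvDl dotvNl dotvZl; field; exact: lt0r_neq0.
  have tg := grad_perp Oz ta Oy.
  have : dotv tau tau = 0 by rewrite {2}/tau dotvDr dotvNr dotvZr ta tg mulr0 subr0.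
  by move=> /eqP; rewrite dotv_eq0 subr_eq0 => /eqP.
have ca y : Om y -> {for y, continuous (fun y => dotv (grad u y) a)}.
  move=> Oy.
  have -> : (fun y => dotv (grad u y) a) = fun y => \sum_k a 0 k * partial k u y.
    by apply/funext => t; rewrite dotvE; apply: eq_bigr => k _; rewrite [grad u t 0 k]mxE mulrC.
  apply: for_continuous_sum => k.
  exact: (for_continuous_mul (@cst_continuous _ _ _ y) (Ck_continuous (C1p C3 k) (OmU Oy))).
have nz y : Om y -> dotv (grad u y) a != 0.
  move=> Oy; apply/eqP => e; have := gs0 Oy; rewrite /gsq (par y Oy) e mul0r scale0r.
  by rewrite dotv0l ltxx.
have pos : forall y, Om y -> (Om `&` [set y | 0 < dotv (grad u y) a]) y.
  apply: (connected_open_closed cOm); [by exists z|by move=> y []| |].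
  - move=> y [Oy /= py].
    have nO : \forall t \near y, Om t by exact: open_nbhs_nbhs.
    have nP : \forall t \near y, 0 < dotv (grad u t) a.
      have c : (fun y => dotv (grad u y) a) @ y --> dotv (grad u y) a := ca y Oy.
      by apply: (c [set t | 0 < t]); exact: lt_nbhsr.
    by apply: filterS2 nO nP => t.
  - move=> y Oy cy; split => //=; rewrite lt0r nz//= -oppr_le0.
    apply: (closure_le_for cy (continuousN (ca y Oy))).
    by apply: filterE => t [_ /= pt]; rewrite oppr_le0 ltW.
move=> Ox; exists (dotv (grad u x) a / dotv a a); last exact: par.
by rewrite divr_gt0//; have [] := pos x Ox.
Qed.

(** Along v with a . v >= 0, u does not decrease, so a segment from inside cannot reach the
    boundary, where u = 0. This stability and the boundary point q determine [Om]: a point x of [Om]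
    with a . (x - q) <= 0 would put q in [Om], and if a . (x - q) > 0, points of [Om] close to q can
    be translated to x. *)
Lemma flat_halfspace z : Om z -> halfspace_parallel Om u.
Proof.
move=> Oz; set a := grad u z.
have a0 : 0 < dotv a a by exact: (gs0 Oz).
have gpos x v : Om x -> 0 <= dotv a v -> 0 <= dotv (grad u x) v.
  move=> Ox av; have [c c0 ->] := grad_parallel Oz Ox.
  by rewrite dotvZl mulr_ge0// ltW.
have stay x v : Om x -> 0 <= dotv a v -> Om (x + v).
  move=> Ox av; apply: ray_stays => // T /andP[T0 T1] Os bT.
  have mono s : 0 <= s < T -> u x <= u (x + s *: v).
    move=> /andP[s0 sT].
    have Oss (t : R) : 0 <= t <= 1 -> Om (x + t *: (s *: v)).
      move=> /andP[t0 t1]; rewrite scalerA; apply: Os; rewrite mulr_ge0//=.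
      by apply: le_lt_trans sT; rewrite ler_piMl.
    have [t /andP[t0 t1] e] := @mean_value_line _ _ u (fun y => dotv (grad u y) (s *: v)) x (s *: v)
      (fun t t01 => Ck1_is_derive _ oU (C1u C3) (OmU (Oss t t01))).
    rewrite -subr_ge0 e dotvZr mulr_ge0// gpos//; apply: Oss; by rewrite !ltW.
  pose A := [set y | u x <= u y].
  have cA : closure A (x + T *: v) by exact: closure_line.
  have : - u (x + T *: v) <= - u x.
    apply: (closure_le_for cA (continuousN (continuous_u C3 (cU bT.1)))).
    by apply: filterE => y; rewrite lerN2.
  by rewrite (u0 bT) lerN2 leNgt upos.
have nq : ~ Om q.
  by move=> Oq; apply: bq.2; apply: open_nbhs_nbhs.
have OmE x : Om x <-> 0 < dotv a (x - q).
  split=> [Ox|xq].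
    rewrite ltNge; apply/negP => le0; apply: nq; rewrite -(subrK x q) addrC.
    by apply: stay => //; rewrite -opprB dotvNr oppr_ge0.
  have cq : {for q, continuous (fun y => dotv a (x - y))}.
    have -> : (fun y => dotv a (x - y)) = fun y => dotv a x + \sum_k - a 0 k * y 0 k.
      apply/funext => y; rewrite dotvDr dotvNr; congr (_ + _).
      by rewrite dotvE -sumrN; apply: eq_bigr => k _; rewrite mulNr.
    apply: for_continuous_add; first exact: (@cst_continuous _ _ _ q).
    apply: for_continuous_sum => k.
    exact: (for_continuous_mul (@cst_continuous _ _ _ q) (@continuous_coord _ _ k q)).
  have c : (fun y => dotv a (x - y)) @ q --> dotv a (x - q) := cq.
  have : \forall y \near q, 0 < dotv a (x - y).
    by apply: (c [set t | 0 < t]); exact: lt_nbhsr.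
  move=> /(bq.1)[y [Oy /= hy]]; rewrite -(subrK y x) addrC.
  by apply: stay => //; exact: ltW.
(* The profile is u on the line through q with direction a. It gives u x because grad u has no
   component along x' - x, which is orthogonal to a. *)
exists q, a, (fun t => u (q + (t / dotv a a) *: a)); split; first by rewrite -dotv_gt0.
split; first by apply/seteqP; split => x /OmE.
move=> x Ox; set x' := q + _.
have perp : dotv a (x' - x) = 0.
  rewrite /x' (_ : q + _ - x = (dotv a (x - q) / dotv a a) *: a - (x - q)); last first.
    by apply/rowP => i; rewrite !mxE; ring.
  move: (x - q) => W.
  by rewrite dotvDr dotvNr dotvZr; field; exact: lt0r_neq0.
have Ot (t : R) : 0 <= t <= 1 -> Om (x + t *: (x' - x)).
  by move=> _; apply: stay => //; rewrite dotvZr perp mulr0.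
have [t /andP[t0 t1]] := @mean_value_line _ _ u (fun y => dotv (grad u y) (x' - x)) x (x' - x)
  (fun t t01 => Ck1_is_derive _ oU (C1u C3) (OmU (Ot t t01))).
have t01 : 0 <= t <= 1 by rewrite !ltW.
have [c c0 ->] := grad_parallel Oz (Ot t t01).
rewrite dotvZl perp mulr0 (addrC x) subrK => /eqP.
by rewrite subr_eq0 => /eqP.
Qed.

End FlatCase.
Theorem theorem1p1 (R : realType) (n : nat) (p kappa : R)
    (Om : set 'rV[R]_n) (u : 'rV[R]_n -> R) (f F : R -> R) :
  (2 <= n)%N -> 1 < p -> C1_domain Om -> 0 < kappa ->
  (* f in C^1(R) *)
  (forall s, derivable f s 1) -> continuous (derive1 f) ->
  (* u is a bounded C^3 function up to the boundary *)
  (exists U, open U /\ closure Om `<=` U /\ Ck 3 U u) ->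
  (exists M, forall x, Om x -> `|u x| <= M) ->
  (* div(|grad u|^(p-2) grad u) + f(u) = 0 in Omega *)
  (forall x, Om x ->
     (forall i, derivable (fun y => plap_field p u y 0 i) x (evec i)) /\
     divergence (plap_field p u) x + f (u x) = 0) ->
  (forall x, Om x -> 0 < u x) ->
  (forall q, bd Om q -> u q = 0) ->
  (forall q nu, bd Om q -> ext_normal Om q nu -> dotv (grad u q) nu = - kappa) ->
  (* F in C^2(R), F' = f, F <= 0, F(0) >= -(p-1)/p kappa^p *)
  (forall s, derivable F s 1) -> (forall s, derivable (derive1 F) s 1) ->
  continuous (derive1 (derive1 F)) -> derive1 F = f ->
  (forall s, F s <= 0) ->
  - ((p - 1) / p) * kappa `^ p <= F 0 ->
  (2 < p -> forall u0, F u0 = 0 ->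
     exists C delta, 0 < delta /\
       forall s, `|s - u0| < delta -> `|F s| <= C * `|s - u0| `^ p) ->
  halfspace_parallel Om u \/
  (forall q, bd Om q -> exists h, mean_curvature Om q h /\ h < 0).
Proof.
move=> n2 p1 dom k0 df cf' [U [oU [cU C3]]] [M uM] hdiv upos u0 unu dF _ _ dFf Fle0 F0 F2.
have [[z0 Oz0] [oOm [cOm _]]] := dom.
pose f' := derive1 f.
have dF' (s : R) : is_derive s 1 F (f s).
  by rewrite -dFf derive1E; exact: derivableP.
have df' (s : R) : is_derive s 1 f (f' s).
  by rewrite /f' derive1E; exact: derivableP.
have hdiv' x : Om x -> divergence (plap_field p u) x + f (u x) = 0.
  by move=> /hdiv[].
have gq := gsq_bd oU (C1u C3) dom cU k0 upos u0 unu.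
have Pbd0 : 0 <= Pbd p kappa F by rewrite /Pbd; move: F0; rewrite mulNr; lra.
have Ple x : Om x -> Pf p u F x <= Pbd p kappa F.
  exact: (modica_bound p1 oU C3 dF' df' oOm cU k0 upos u0 gq hdiv' Fle0 uM Pbd0).
have pde := pde_Om oU C3 cU hdiv'.
have npde := near_pde oU C3 oOm cU hdiv'.
have [[x0 [Ox0 Px0]]|nP] := pselect (exists x, Om x /\ Pf p u F x = Pbd p kappa F).
  (* The rigidity argument needs a boundary point; when there is none, the second alternative holds
     vacuously. *)
  have [[q bq]|nbd] := pselect (bd Om !=set0); last first.
    by right => q bq; exfalso; apply: nbd; exists q.
  left.
  have Fflat := F_flat p1 dF' df' cf' Fle0 F2.
  have Pc := Pf_const p1 oU C3 dF' df' oOm cOm cU upos u0 npde Fle0 Fflat Pbd0 Ple bq Ox0 Px0.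
  exact: (flat_halfspace p1 oU C3 dF' df' oOm cOm cU upos u0 npde Fle0 Fflat Pbd0 Ple bq Pc Ox0).
right => q bq; apply: (mean_curvature_lt0 oU C3 df' dom cU k0 upos u0 unu pde n2 bq).
apply: (boundary_hopf p1 oU C3 dF' df' dom cU k0 upos u0 unu pde bq) => x Ox.
rewrite (Pf_bd p F k0 u0 gq bq) lt_neqAle Ple// andbT; apply/eqP => Px.
by apply: nP; exists x.
Qed.
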